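(* Let $p_{Z|XY}$ be a randomized function in normal form and let $p_{XY}$ have full support on $\mathcal X\times\mathcal Y$. Then every secure protocol $\Pi(p_{XY},p_{Z|XY})$ satisfies \[H(M_{23}) \ge \Big(\sup_{p_{X'}} RI(X';Z')\Big) + \Big(\sup_{p_{X''}} H(Y,Z''|X'')\Big),\] where the terms are evaluated under $p_{X'YZ'}(x,y,z)=p_{X'}(x)p_Y(y)p_{Z|XY}(z|x,y)$ and $p_{X''YZ''}(x,y,z)=p_{X''}(x)p_Y(y)p_{Z|XY}(z|x,y)$ with $p_Y$ the marginal of $Y$ under $p_{XY}$; \[H(M_{31}) \ge \Big(\sup_{p_{Y'}} RI(Y';Z')\Big) + \Big(\sup_{p_{Y''}} H(X,Z''|Y'')\Big),\] evaluated analogously using the marginal $p_X$ of $X$ under $p_{XY}$; and \[H(M_{12}) \ge \max\left\{\begin{array}{l}\sup_{p_{X'}}\Big[\Big(\sup_{p_{Y'}} RI(Y';Z')\Big)+\Big(\sup_{p_{Y''}} \big(RI(X';Z'')+H(X',Y''|Z'')\big)\Big)\Big],\\[2pt] \sup_{p_{Y'}}\Big[\Big(\sup_{p_{X'}} RI(X';Z')\Big)+\Big(\sup_{p_{X''}} \big(RI(Y';Z'')+H(X'',Y'|Z'')\big)\Big)\Big]\end{array}\right\},\] where in the first row the terms are evaluated under $p_{X'}(x)p_{Y'}(y)p_{Z|XY}(z|x,y)$ (for $X',Y',Z'$) and $p_{X'}(x)p_{Y''}(y)p_{Z|XY}(z|x,y)$ (for $X',Y'',Z''$), and symmetrically in the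 second row. All suprema range over distributions $p_{X'},p_{X''}$ on $\mathcal X$ and $p_{Y'},p_{Y''}$ on $\mathcal Y$ with full support. The left-hand sides are computed under the original distribution $p_{XY}$ and the protocol.
   Context: Setting: $\mathcal X,\mathcal Y,\mathcal Z$ are finite sets. Alice (party 1) holds input $X\in\mathcal X$, Bob (party 2) holds $Y\in\mathcal Y$, with $(X,Y)\sim p_{XY}$; Charlie (party 3) has no input and outputs $Z\in\mathcal Z$. A randomized function is a conditional distribution $p_{Z|XY}$. In a protocol the three parties, each using private randomness (no shared randomness), exchange messages over multiple rounds on three pairwise private links; each message on a link is a codeword of a prefix-free code determined by the previous messages on that link, and the protocol terminates with probability 1. The protocol may depend on $p_{XY}$. $M_{12},M_{23},M_{31}$ denote the final transcripts (all bits sent in both directions) on the Alice–Bob, Bob–Charlie and Charlie–Alice links. A secure protocol $\Pi(p_{XY},p_{Z|XY})$ satisfies: (correctness) on inputs $x,y$ Charlie's output is distributed as $p_{Z|X=x,Y=y}$; (privacy) under the joint distribution induced by $(X,Y)\sim p_{XY}$ and the protocol, the Markov chains $(M_{12},M_{31})-X-(Y,Z)$, $(M_{12},M_{23})-Y-(X,Z)$ and $(M_{23},M_{31})-Z-(X,Y)$ hold. Logarithms are base 2. Normal form: $p_{Z|XY}$ is in normal form if (i) whenever $p(z|x,y)=p(z|x',y)$ for all $y,z$ then $x=x'$; (ii) whenever $p(z|x,y)=p(z|x,y')$ for all $x,z$ then $y=y'$; (iii) whenever there is a constant $c$ with $p(z|x,y)=c\,p(z'|x,y)$ for all $x,y$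 then $z=z'$. Residual information: $RI(U;V)=I(U;V)-H(U\sqcap V)$, where $U\sqcap V$ (Gács–Körner common part) is a random variable of maximum entropy among those of the form $f(U)=g(V)$ for deterministic $f,g$. *)

(* Defs.v *)
From HB Require Import structures.
From mathcomp Require Import all_boot all_order all_algebra.
From mathcomp Require Import all_classical all_reals all_analysis.

Set Implicit Arguments.
Unset Strict Implicit.
Unset Printing Implicit Defensive.

Import Order.TTheory GRing.Theory Num.Theory.
Local Open Scope ring_scope.
Local Open Scope classical_set_scope.

Section FiniteInfo.
Variable R : realType.

Definition hterm (r : R) : R := if r == 0 then 0 else - r * ln r / ln 2.

Definition fullsupp (T : finType) (p : T -> R) : Prop :=
  (forall t, 0 < p t) /\ \sum_(t : T) p t = 1.

Definition sup_fs (T : finType) (F : (T -> R) -> R) : R :=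
  sup [set r | exists p : T -> R, fullsupp p /\ r = F p].

Variable T : finType.
Variable q : T -> R.

Definition Hf (A : finType) (f : T -> A) : R :=
  \sum_(a : A) hterm (\sum_(t : T | f t == a) q t).

Definition If (A B : finType) (f : T -> A) (g : T -> B) : R :=
  Hf f + Hf g - Hf (fun t => (f t, g t)).

(* entropy of the Gacs--Korner common part of f and g: maximum entropy of a
   random variable of the form a(f) = b(g) (almost surely); every such
   variable has finite range, hence is relabelled into some 'I_n. *)
Definition H_GK (A B : finType) (f : T -> A) (g : T -> B) : R :=
  sup [set r | exists (n : nat) (a : A -> 'I_n) (b : B -> 'I_n),
        (forall t, 0 < q t -> a (f t) = b (g t)) /\ r = Hf (fun t => a (f t))].

Definition RIf (A B : finType) (f : T -> A) (g : T -> B) : R :=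
  If f g - H_GK f g.

End FiniteInfo.

Section Setting.
Variable R : realType.
Variables X Y Z : finType.

Definition prodpmf (pX : X -> R) (pY : Y -> R) (pZ : X -> Y -> Z -> R)
  (t : X * Y * Z) : R := pX t.1.1 * pY t.1.2 * pZ t.1.1 t.1.2 t.2.

Definition vX (t : X * Y * Z) : X := t.1.1.
Definition vY (t : X * Y * Z) : Y := t.1.2.
Definition vZ (t : X * Y * Z) : Z := t.2.

Definition marginalX (pXY : X -> Y -> R) (x : X) : R := \sum_(y : Y) pXY x y.
Definition marginalY (pXY : X -> Y -> R) (y : Y) : R := \sum_(x : X) pXY x y.

Definition full_support_joint (pXY : X -> Y -> R) : Prop :=
  (forall x y, 0 < pXY x y) /\ \sum_(x : X) \sum_(y : Y) pXY x y = 1.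

Definition cond_dist (pZ : X -> Y -> Z -> R) : Prop :=
  forall x y, (forall z, 0 <= pZ x y z) /\ \sum_(z : Z) pZ x y z = 1.

Definition normal_form (pZ : X -> Y -> Z -> R) : Prop :=
  [/\ (forall x x', (forall y z, pZ x y z = pZ x' y z) -> x = x'),
      (forall y y', (forall x z, pZ x y z = pZ x y' z) -> y = y') &
      (forall z z', (exists c : R, forall x y, pZ x y z = c * pZ x y z') -> z = z')].

Definition bits := seq bool.
(* one round on a link: (forward message, backward message); orientation:
   link 12 : forward = Alice->Bob,   backward = Bob->Alice
   link 23 : forward = Bob->Charlie, backward = Charlie->Bob
   link 31 : forward = Charlie->Alice, backward = Alice->Charlie *)
Definition lmsg := (bits * bits)%type.
Definition lhist := seq lmsg.
Definition round := (lmsg * lmsg * lmsg)%type.   (* (link12, link23, link31) *)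

Definition ltrans (h : lhist) : lmsg :=
  (flatten (map fst h), flatten (map snd h)).

Definition prefix_free_code (C : pred bits) : Prop :=
  (exists u, C u) /\ (forall u v, C u -> C v -> prefix u v -> u = v).

Record protocol := Protocol {
  code12f : lhist -> pred bits; code12b : lhist -> pred bits;
  code23f : lhist -> pred bits; code23b : lhist -> pred bits;
  code31f : lhist -> pred bits; code31b : lhist -> pred bits;
  (* next-round message kernels (private randomness); each party's kernel
     depends on its own input and its view (messages on its own links):
     alice x h12 h31 (m_AB, m_AC), bob y h12 h23 (m_BA, m_BC),
     charlie h23 h31 (m_CB, m_CA) *)
  alice : X -> lhist -> lhist -> lmsg -> R;
  bob : Y -> lhist -> lhist -> lmsg -> R;
  charlie : lhist -> lhist -> lmsg -> R;
  (* Charlie's output kernel, given the final transcripts M23, M31 *)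
  output : lmsg -> lmsg -> Z -> R }.

Variable P : protocol.

Definition alice_ok : Prop := forall x h12 h31,
  (forall m, 0 <= alice P x h12 h31 m) /\
  (\esum_(m in [set: lmsg]) (alice P x h12 h31 m)%:E = 1%E) /\
  (forall m, 0 < alice P x h12 h31 m -> code12f P h12 m.1 /\ code31b P h31 m.2).
Definition bob_ok : Prop := forall y h12 h23,
  (forall m, 0 <= bob P y h12 h23 m) /\
  (\esum_(m in [set: lmsg]) (bob P y h12 h23 m)%:E = 1%E) /\
  (forall m, 0 < bob P y h12 h23 m -> code12b P h12 m.1 /\ code23f P h23 m.2).
Definition charlie_ok : Prop := forall h23 h31,
  (forall m, 0 <= charlie P h23 h31 m) /\
  (\esum_(m in [set: lmsg]) (charlie P h23 h31 m)%:E = 1%E) /\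
  (forall m, 0 < charlie P h23 h31 m -> code23b P h23 m.1 /\ code31f P h31 m.2).
Definition output_ok : Prop := forall m23 m31,
  (forall z, 0 <= output P m23 m31 z) /\ \sum_(z : Z) output P m23 m31 z = 1.
Definition codes_ok : Prop := forall h,
  prefix_free_code (code12f P h) /\ prefix_free_code (code12b P h) /\
  prefix_free_code (code23f P h) /\ prefix_free_code (code23b P h) /\
  prefix_free_code (code31f P h) /\ prefix_free_code (code31b P h).

Fixpoint runp_from (x : X) (y : Y) (h12 h23 h31 : lhist) (rs : seq round) : R :=
  match rs with
  | [::] => 1
  | (a12, a23, a31) :: rs' =>
      alice P x h12 h31 (a12.1, a31.2) * bob P y h12 h23 (a12.2, a23.1) *
      charlie P h23 h31 (a23.2, a31.1) *
      runp_from x y (rcons h12 a12) (rcons h23 a23) (rcons h31 a31) rs'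
  end.
Definition runp x y rs := runp_from x y [::] [::] [::] rs.

Definition h12_of (rs : seq round) : lhist := map (fun r => r.1.1) rs.
Definition h23_of (rs : seq round) : lhist := map (fun r => r.1.2) rs.
Definition h31_of (rs : seq round) : lhist := map (fun r => r.2) rs.

Definition silent_code (C : pred bits) : Prop := forall u, C u = (u == [::]).
(* a state is terminal when no bit can ever be sent again on any link *)
Definition silent_state (rs : seq round) : Prop :=
  forall k : nat, let rs' := rs ++ nseq k (([::], [::]), ([::], [::]), ([::], [::])) in
  silent_code (code12f P (h12_of rs')) /\ silent_code (code12b P (h12_of rs')) /\
  silent_code (code23f P (h23_of rs')) /\ silent_code (code23b P (h23_of rs')) /\
  silent_code (code31f P (h31_of rs')) /\ silent_code (code31b P (h31_of rs')).
Definition complete (rs : seq round) : Prop :=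
  silent_state rs /\ forall k, (k < size rs)%N -> ~ silent_state (take k rs).

Definition terminates : Prop :=
  forall x y, \esum_(rs in complete) (runp x y rs)%:E = 1%E.

Definition valid_protocol : Prop :=
  codes_ok /\ alice_ok /\ bob_ok /\ charlie_ok /\ output_ok /\ terminates.

Definition outcome := (X * Y * lmsg * lmsg * lmsg * Z)%type.
Definition oX (o : outcome) : X := o.1.1.1.1.1.
Definition oY (o : outcome) : Y := o.1.1.1.1.2.
Definition oM12 (o : outcome) : lmsg := o.1.1.1.2.
Definition oM23 (o : outcome) : lmsg := o.1.1.2.
Definition oM31 (o : outcome) : lmsg := o.1.2.
Definition oZ (o : outcome) : Z := o.2.

Definition condp (x : X) (y : Y) (m12 m23 m31 : lmsg) (z : Z) : \bar R :=
  \esum_(rs in [set rs | complete rs /\ ltrans (h12_of rs) = m12 /\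
                  ltrans (h23_of rs) = m23 /\ ltrans (h31_of rs) = m31])
     (runp x y rs * output P m23 m31 z)%:E.

Definition jointp (pXY : X -> Y -> R) (o : outcome) : \bar R :=
  (pXY (oX o) (oY o))%:E * condp (oX o) (oY o) (oM12 o) (oM23 o) (oM31 o) (oZ o).

Definition prob (pXY : X -> Y -> R) (A : set outcome) : \bar R :=
  \esum_(o in A) jointp pXY o.

Definition markov (pXY : X -> Y -> R) (A B C : Type)
  (F : outcome -> A) (G : outcome -> B) (K : outcome -> C) : Prop :=
  forall a b c,
    (prob pXY [set o | F o = a /\ G o = b /\ K o = c] *
     prob pXY [set o | G o = b])%E =
    (prob pXY [set o | F o = a /\ G o = b] *
     prob pXY [set o | G o = b /\ K o = c])%E.

Definition correct (pZ : X -> Y -> Z -> R) : Prop :=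
  forall x y z,
    \esum_(m in [set: lmsg * lmsg * lmsg]) condp x y m.1.1 m.1.2 m.2 z =
    (pZ x y z)%:E.

Definition private (pXY : X -> Y -> R) : Prop :=
  [/\ markov pXY (fun o => (oM12 o, oM31 o)) oX (fun o => (oY o, oZ o)),
      markov pXY (fun o => (oM12 o, oM23 o)) oY (fun o => (oX o, oZ o)) &
      markov pXY (fun o => (oM23 o, oM31 o)) oZ (fun o => (oX o, oY o))].

Definition secure (pXY : X -> Y -> R) (pZ : X -> Y -> Z -> R) : Prop :=
  [/\ valid_protocol, correct pZ & private pXY].

Definition ent_hterm (p : \bar R) : \bar R := (hterm (fine p))%:E.
Definition Hout (pXY : X -> Y -> R) (A : choiceType) (F : outcome -> A) : \bar R :=
  \esum_(a in [set: A]) ent_hterm (prob pXY [set o | F o = a]).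

End Setting.

Definition Hc (R : realType) (T : finType) (q : T -> R) (A B : finType)
  (f : T -> A) (g : T -> B) : R :=
  Hf q (fun t => (f t, g t)) - Hf q g.

(* Main.v *)
(* Write A, B, C for the transcripts M12, M23, M31.  Privacy and full support make
   the law of (A, B) depend only on p_Y, the law of (A, C) only on p_X, and the law
   of A on neither, so in H(B) = I(A;B) + H(B|A) the two terms may be evaluated
   under different p_X, and similarly for the other links.  The normal form forces
   (A, C), (A, B), (B, C) to determine X, Y, Z; hence H(B|A) >= H(B|A,C) >= H(Y,Z|X).
   For product inputs the co-information I(A;B) - I(A;B|C) does not decrease when a
   party speaks, hence I(A;B) >= I(A;B|C), and I(A;B|C) >= RI(X;Z) because C is
   independent of (X, Z) given a common part of X and Z.  The former inequality is
   proved for histories truncated after n rounds; X and Z are recovered from these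
   up to an error that tends to 0, which Fano's inequality absorbs. *)
Require Import Defs.
From HB Require Import structures.
From mathcomp Require Import all_boot all_order all_algebra.
From mathcomp Require Import all_classical all_reals all_analysis.
From mathcomp Require Import ring lra.
Import Order.TTheory GRing.Theory Num.Theory.
Set Implicit Arguments.
Unset Strict Implicit.
Unset Printing Implicit Defensive.
Local Open Scope classical_set_scope.
Local Open Scope ring_scope.

(** * Sums over countable types and discrete probability *)

(** Nothing bounds the entropy of a transcript, so the entropies in the argument may be infinite and
    cannot be subtracted. Each entropy is therefore replaced by a density, the logarithm of the
    probability of the observed value: identities between entropies become pointwise identities, and
    inequalities are stated with [nn]. For the same reason the bound for truncated histories is not
    passed to a limit of transcripts. Only the finite-valued X and Z are approximated, with an error
    controlled by the probability that a run is cut. A view determines its party's variable because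
    two descriptions of its probability must agree. By privacy, the probability of a view of Alice
    together with z is p(z|x,y) times a function of x. By the product form of a run, replacing x by
    x' multiplies it by a factor free of y and z. Hence p(z|x,y) and p(z|x',y) are proportional, and
    summing over z makes them equal. For Charlie the constant survives, which is why the third
    clause of the normal form allows one. *)

Section Esum.
Context {R : realType}.
Local Open Scope ereal_scope.

Lemma esum_fiber (I J : choiceType) (S : set I) (F : I -> J) (a : I -> \bar R) :
  (forall i, 0 <= a i) ->
  \esum_(i in S) a i =
  \esum_(j in [set: J]) \esum_(i in S `&` [set i | F i = j]) a i.
Proof.
move=> a0; rewrite esum_esum; last by move=> i j _ _.
apply: reindex_esum; split.
- by move=> [j i] /= [_ []].
- move=> [j i] [j' i']; rewrite !inE /= => -[_ [_ <-]] [_ [_ <-]] ->.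
  by [].
- by move=> i Si; exists (F i, i).
Qed.

Lemma esum_finType (J : finType) (a : J -> \bar R) : (forall j, 0 <= a j) ->
  \esum_(j in [set: J]) a j = \sum_(j : J) a j.
Proof.
move=> a0; have e : [set: J] = [set` index_enum J].
  by apply/seteqP; split=> x //= _; exact: mem_index_enum.
rewrite e esum_fset; [|exact: finite_seq|by move=> *; exact: a0].
by rewrite -fsbig_seq ?index_enum_uniq.
Qed.

(** Finite partial sums give one inequality; the other is the same inequality for the factor
    [c^-1]. *)
Lemma esumZ (I : choiceType) (S : set I) (a : I -> \bar R) (c : R) :
  (0 <= c)%R -> (forall i, 0 <= a i) ->
  \esum_(i in S) (c%:E * a i) = c%:E * \esum_(i in S) a i.
Proof.
have le_ (b : I -> \bar R) (d : R) : (0 <= d)%R -> (forall i, 0 <= b i) ->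
    \esum_(i in S) (d%:E * b i) <= d%:E * \esum_(i in S) b i.
  move=> d0 b0; apply: ge_ereal_sup => _ [A [finA AS] <-].
  rewrite -ge0_mule_fsumr//; apply: lee_wpmul2l; first by rewrite lee_fin.
  by apply: ereal_sup_ubound; exists A.
move=> c0 a0; have [->|cN0] := eqVneq c 0%R.
  by rewrite mul0e esum1// => i _; rewrite mul0e.
apply/eqP; rewrite eq_le le_//=.
have c_gt0 : (0 < c)%R by rewrite lt_neqAle eq_sym cN0.
have -> : \esum_(i in S) a i = \esum_(i in S) ((c^-1)%:E * (c%:E * a i)).
  by apply: eq_esum => i _; rewrite muleA -EFinM mulVf// mul1e.
apply: (@le_trans _ _ (c%:E * ((c^-1)%:E * \esum_(i in S) (c%:E * a i)))).
  apply: lee_wpmul2l; first by rewrite lee_fin.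
  apply: le_; first by rewrite invr_ge0.
  by move=> i; rewrite mule_ge0// lee_fin.
by rewrite muleA -EFinM divff// mul1e.
Qed.

Lemma le_esum_set (I : choiceType) (S S' : set I) (a : I -> \bar R) :
  (forall i, 0 <= a i) -> S `<=` S' ->
  \esum_(i in S) a i <= \esum_(i in S') a i.
Proof.
move=> a0 SS'; rewrite esum_mkcond [leRHS]esum_mkcond; apply: le_esum => i _.
case: ifPn => [|_]; last by case: ifP.
by rewrite inE => /SS' Si; rewrite ifT// inE.
Qed.

Lemma esum_pair (I J : choiceType) (a : I -> J -> \bar R) :
  (forall i j, 0 <= a i j) ->
  \esum_(k in [set: I * J]) a k.1 k.2 =
  \esum_(i in [set: I]) \esum_(j in [set: J]) a i j.
Proof.
move=> a0; rewrite esum_esum; last by move=> *.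
by congr esum; apply/seteqP; split.
Qed.

(** The family [b - a] is nonnegative and has total mass 0. *)
Lemma esum_le_eq (I : choiceType) (a b : I -> R) :
  (forall i, 0 <= a i)%R -> (forall i, a i <= b i)%R ->
  \esum_(i in [set: I]) (b i)%:E = 1 ->
  \esum_(i in [set: I]) (a i)%:E = 1 -> a =1 b.
Proof.
move=> a0 ab b1 a1 i.
have d0 j : 0 <= (b j - a j)%:E by rewrite lee_fin subr_ge0.
have : \esum_(i in [set: I]) (b i - a i)%:E = 0.
  have : \esum_(i in [set: I]) ((a i)%:E + (b i - a i)%:E) = 1.
    by rewrite -b1; apply: eq_esum => j _; rewrite -EFinD addrC subrK.
  rewrite esumD//; last by move=> j _; rewrite lee_fin.
  rewrite a1; case: esum => [r| |]//.
  by rewrite -EFinD => -[r0]; congr EFin; lra.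
move=> h; have := @le_esum_set _ [set i] setT _ d0 (@subsetT _ _).
rewrite h esum_set1// lee_fin subr_le0 => ba.
by apply/eqP; rewrite eq_le ab.
Qed.

End Esum.

Section Probability.
Context {R : realType} {I : choiceType} (w : I -> R).
Hypothesis w0 : forall o, 0 <= w o.
Hypothesis w1 : \esum_(o in [set: I]) (w o)%:E = 1%E.

Definition Pr (S : set I) : R := fine (\esum_(o in S) (w o)%:E).
(** [esum] is a supremum of finite partial sums, so this is the expectation only of functions that
    are nonnegative on the support. *)
Definition Ex (f : I -> R) : \bar R := \esum_(o in [set: I]) (w o * f o)%:E.

Let wE0 o : (0 <= (w o)%:E)%E. Proof. by rewrite lee_fin. Qed.

Lemma PrE S : (Pr S)%:E = \esum_(o in S) (w o)%:E.
Proof.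
rewrite /Pr fineK// ge0_fin_numE ?esum_ge0//.
rewrite (@le_lt_trans _ _ 1%E) ?ltry// -w1.
exact: le_esum_set.
Qed.

Lemma Pr_ge0 S : 0 <= Pr S.
Proof. by rewrite fine_ge0// esum_ge0. Qed.

Lemma Pr_le S S' : S `<=` S' -> Pr S <= Pr S'.
Proof. by move=> SS'; rewrite -lee_fin !PrE le_esum_set. Qed.

Lemma Pr_setT : Pr setT = 1.
Proof. by rewrite /Pr w1. Qed.

Lemma Pr_le1 S : Pr S <= 1.
Proof. by rewrite -Pr_setT Pr_le. Qed.

Lemma Pr_gt0 S o : S o -> 0 < w o -> 0 < Pr S.
Proof.
move=> So /lt_le_trans; apply.
rewrite -lee_fin PrE -(@esum_set1 _ _ o (fun o => (w o)%:E))//.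
by apply: le_esum_set => // _ ->.
Qed.

Lemma Pr_eq S S' : (forall o, 0 < w o -> S o <-> S' o) -> Pr S = Pr S'.
Proof.
move=> h; rewrite /Pr esum_mkcond [in RHS]esum_mkcond; congr fine.
apply: eq_esum => o _; have := w0 o; rewrite le_eqVlt => /predU1P[<-|/h wo].
  by rewrite !if_same.
case: ifPn; case: ifPn => //; rewrite !(inE, notin_setE) => a b; exfalso; tauto.
Qed.

Lemma Pr_eq0 S : (forall o, S o -> w o = 0) -> Pr S = 0.
Proof. by move=> h; rewrite /Pr esum1//= => o /h ->. Qed.

Lemma Pr_exists S : 0 < Pr S -> exists2 o, S o & 0 < w o.
Proof.
move=> PS; apply: contrapT => h; suff : Pr S = 0 by move=> e; rewrite e ltxx in PS.
apply: Pr_eq0 => o So; apply/eqP; rewrite eq_le w0 andbT leNgt.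
by apply/negP => wo; apply: h; exists o.
Qed.

Lemma Pr_fiber (J : choiceType) (S : set I) (F : I -> J) :
  (Pr S)%:E = \esum_(j in [set: J]) (Pr (S `&` [set o | F o = j]))%:E.
Proof. by rewrite PrE (esum_fiber _ F)//; apply: eq_esum => j _; rewrite PrE. Qed.

Lemma Pr_finfiber (J : finType) (S : set I) (F : I -> J) :
  Pr S = \sum_(j : J) Pr (S `&` [set o | F o = j]).
Proof.
apply: EFin_inj; rewrite (Pr_fiber _ F) esum_finType ?sumEFin//.
by move=> j; rewrite lee_fin Pr_ge0.
Qed.

Lemma Pr_setC S : Pr (~` S) = 1 - Pr S.
Proof.
have := esumID S setT (fun o => (w o)%:E) (fun o _ => wE0 o).
by rewrite !setTI w1 -!PrE => -[]; lra.
Qed.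

Lemma Ex_comp (J : choiceType) (F : I -> J) (g : J -> R) :
  (forall j, 0 <= g j) ->
  Ex (fun o => g (F o)) =
  \esum_(j in [set: J]) (Pr [set o | F o = j] * g j)%:E.
Proof.
move=> g0; rewrite /Ex (esum_fiber _ F); last by move=> o; rewrite lee_fin mulr_ge0.
apply: eq_esum => j _; rewrite EFinM PrE setTI muleC -esumZ//.
by apply: eq_esum => o /= <-; rewrite EFinM muleC.
Qed.

Lemma Ex_cst (c : R) : 0 <= c -> Ex (fun=> c) = c%:E.
Proof.
move=> c0; rewrite /Ex -[RHS]mule1 -w1 -esumZ//.
by apply: eq_esum => o _; rewrite mulrC EFinM.
Qed.

Lemma ExD f g : (forall o, 0 < w o -> 0 <= f o) ->
  (forall o, 0 < w o -> 0 <= g o) ->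
  Ex (fun o => f o + g o) = (Ex f + Ex g)%E.
Proof.
have pos h : (forall o, 0 < w o -> 0 <= h o) ->
    forall o, [set: I] o -> (0 <= (w o * h o)%:E)%E.
  move=> h0 o _; rewrite lee_fin; have := w0 o.
  by rewrite le_eqVlt => /predU1P[<-|wo]; rewrite ?mul0r// mulr_ge0// h0.
move=> f0 g0; rewrite /Ex -esumD; [|exact: pos|exact: pos].
by apply: eq_esum => o _; rewrite mulrDr EFinD.
Qed.

Lemma le_Ex f g : (forall o, 0 < w o -> f o <= g o) -> (Ex f <= Ex g)%E.
Proof.
move=> fg; apply: le_esum => o _; rewrite lee_fin.
have := w0 o; rewrite le_eqVlt => /predU1P[<-|wo]; first by rewrite !mul0r.
by rewrite ler_pM2l// fg.
Qed.

Lemma eq_Ex f g : (forall o, 0 < w o -> f o = g o) -> Ex f = Ex g.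
Proof. by move=> fg; apply/eqP; rewrite eq_le !le_Ex// => o /fg ->. Qed.

End Probability.

(** * Entropy densities *)

Section Density.
Context {R : realType} {I : choiceType} (w : I -> R).
Hypothesis w0 : forall o, 0 <= w o.
Hypothesis w1 : \esum_(o in [set: I]) (w o)%:E = 1%E.
Local Notation Pr := (Pr w).
Local Notation Ex := (Ex w).

(** The surprisal of [F] at [o], in nats and with the sign changed: the entropy of [F] is the
    expectation of [- lp F]. *)
Definition lp (T : Type) (F : I -> T) (o : I) : R := ln (Pr [set o' | F o' = F o]).

(* A form of "f has nonnegative expectation" that is meaningful, additive and
   monotone even when f is not integrable: transcripts may have infinite
   entropy, so entropy differences are only handled at the level of densities. *)
Definition nn (f : I -> R) : Prop := exists (N : R) (T : I -> R),
  [/\ forall o, 0 <= T o, (Ex T <= N%:E)%E & forall o, 0 < w o -> N <= f o + T o].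

Lemma nn_ge0 f : (forall o, 0 < w o -> 0 <= f o) -> nn f.
Proof.
move=> f0; exists 0, (fun=> 0); split=> // [|o /f0]; last by rewrite addr0.
by rewrite Ex_cst.
Qed.

Lemma nnD f g : nn f -> nn g -> nn (fun o => f o + g o).
Proof.
move=> [N [T [T0 ET NT]]] [N1 [T1 [T10 ET1 NT1]]].
exists (N + N1), (fun o => T o + T1 o); split=> [z| |o wo].
- by rewrite addr_ge0.
- by rewrite ExD// EFinD leeD.
- by have := NT o wo; have := NT1 o wo; lra.
Qed.

Lemma nn_le f g : nn f -> (forall o, 0 < w o -> f o <= g o) -> nn g.
Proof.
move=> [N [T [T0 ET NT]]] fg; exists N, T; split=> // o wo.
by rewrite (le_trans (NT o wo))// lerD2r fg.
Qed.

(** The way back from densities to expectations. The bound [N] is finite, so it can be added to both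
    sides and cancelled even if [Ex g] is infinite. *)
Lemma nn_Ex f g : nn (fun o => g o - f o) -> (forall o, 0 < w o -> 0 <= f o) ->
  (forall o, 0 < w o -> 0 <= g o) -> (Ex f <= Ex g)%E.
Proof.
move=> [N [T [T0 ET NT]]] f0 g0.
have N0 : 0 <= N.
  by rewrite -lee_fin (le_trans _ ET)// esum_ge0// => o _; rewrite lee_fin mulr_ge0.
have : (Ex f + N%:E <= Ex g + N%:E)%E.
  rewrite -(Ex_cst w0 w1 N0) -ExD//.
  apply: (@le_trans _ _ (Ex (fun o => g o + T o))).
    by apply: le_Ex => // o wo; have := NT o wo; lra.
  by rewrite ExD// Ex_cst// leeD.
by rewrite leeD2rE.
Qed.

Lemma nn_Ex_cst f g c : nn (fun o => g o - (f o + c)) ->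
  (forall o, 0 < w o -> 0 <= f o) -> (forall o, 0 < w o -> 0 <= g o) ->
  (Ex f + c%:E <= Ex g)%E.
Proof.
move=> h f0 g0; have [c0|c0] := leP 0 c.
  rewrite -(Ex_cst w0 w1 c0) -ExD//; apply: nn_Ex => // o wo.
  by rewrite addr_ge0 ?f0.
have nc0 : 0 <= - c by lra.
have : (Ex f <= Ex g + (- c)%:E)%E.
  rewrite -(Ex_cst w0 w1 nc0) -ExD//; apply: nn_Ex => //.
    by apply: nn_le h _ => o _; lra.
  by move=> o /g0 go; lra.
by rewrite EFinN leeBrDr.
Qed.

Lemma Pr_self_gt0 (T : Type) (F : I -> T) o :
  0 < w o -> 0 < Pr [set o' | F o' = F o].
Proof. exact: Pr_gt0. Qed.

Lemma lp_le0 (T : Type) (F : I -> T) o : lp F o <= 0.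
Proof. by rewrite ln_le0// Pr_le1. Qed.

(** Only the fibre through [o], up to null points, matters; this is how tuples carrying the same
    information are exchanged. *)
Lemma lp_eq (T T' : Type) (F : I -> T) (G : I -> T') o :
  (forall o', 0 < w o' -> F o' = F o <-> G o' = G o) -> lp F o = lp G o.
Proof. by move=> FG; congr ln; apply: Pr_eq. Qed.

Lemma lp_le (T T' : Type) (F : I -> T) (G : I -> T') o : 0 < w o ->
  (forall o', 0 < w o' -> F o' = F o -> G o' = G o) -> lp F o <= lp G o.
Proof.
move=> wo FG; rewrite ler_ln ?posrE ?Pr_self_gt0//.
rewrite [leLHS](@Pr_eq _ _ _ _ _ [set o' | F o' = F o /\ G o' = G o])//.
  by apply: Pr_le => // o' [].
by move=> o' wo'; split=> [h|[]//]; split=> //; exact: FG.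
Qed.

Lemma Pr_pair (T : choiceType) (T' : Type) (V : I -> T') (W : I -> T) v :
  \esum_(k in [set: T]) (Pr [set o | (V o, W o) = (v, k)])%:E =
  (Pr [set o | V o = v])%:E.
Proof.
rewrite (Pr_fiber w0 w1 _ W); apply: eq_esum => k _; congr EFin.
by apply: Pr_eq => // o _; split=> [[/= -> ->]|[/= -> ->]].
Qed.

Lemma le_ln_sub1 (t : R) : 0 < t -> ln t <= t - 1.
Proof. 
move=> t0; have := @le_ln1Dx R (t - 1).
by rewrite (_ : 1 + (t - 1) = t); [apply; lra|ring]. Qed.

(* The witness is t = p(u,v) p(v,w) / (p(u,v,w) p(v)), which has expectation at
   most 1, together with ln t <= t - 1. *)
Lemma nn_ssa (TU TV TW : choiceType) (U : I -> TU) (V : I -> TV) (W : I -> TW) :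
  nn (fun o => lp (fun o => (U o, V o, W o)) o + lp V o
             - lp (fun o => (U o, V o)) o - lp (fun o => (V o, W o)) o).
Proof.
pose p u v := Pr [set o | (U o, V o) = (u, v)].
pose q v k := Pr [set o | (V o, W o) = (v, k)].
pose r u v k := Pr [set o | (U o, V o, W o) = (u, v, k)].
pose s v := Pr [set o | V o = v].
pose g (k : TU * TV * TW) :=
  p k.1.1 k.1.2 * q k.1.2 k.2 / (r k.1.1 k.1.2 k.2 * s k.1.2).
have g0 k : 0 <= g k by rewrite divr_ge0// mulr_ge0// Pr_ge0.
exists 1, (fun o => g (U o, V o, W o)); split=> // [|o wo].
  rewrite (Ex_comp w0 w1 (fun o => (U o, V o, W o)))//.
  pose h (uv : TU * TV) k := p uv.1 uv.2 / s uv.2 * q uv.2 k.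
  have h0 uv k : 0 <= h uv k by rewrite mulr_ge0 ?divr_ge0 ?Pr_ge0.
  apply: (@le_trans _ _ (\esum_(k in [set: TU * TV * TW]) (h k.1 k.2)%:E)).
    apply: le_esum => -[[u v] k] _; rewrite lee_fin /g /h /=.
    have := Pr_ge0 w0 [set o | (U o, V o, W o) = (u, v, k)].
    rewrite -/(r u v k) le_eqVlt => /predU1P[<-|r0].
      by rewrite mul0r mulr_ge0 ?divr_ge0 ?Pr_ge0.
    have s0 : 0 < s v by apply: (lt_le_trans r0); apply: Pr_le => // o [].
    rewrite le_eqVlt; apply/orP; left; apply/eqP.
    by field; rewrite !gt_eqF.
  rewrite (@esum_pair _ _ _ (fun uv k => (h uv k)%:E))//.
  rewrite -(Pr_setT w1) (Pr_fiber w0 w1 _ (fun o => (U o, V o))).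
  apply: le_esum => -[u v] _; rewrite setTI.
  under eq_esum => k _ do rewrite /h/= EFinM.
  rewrite esumZ//; last 2 first.
  - by rewrite divr_ge0// Pr_ge0.
  - by move=> k; rewrite lee_fin Pr_ge0.
  rewrite Pr_pair -EFinM lee_fin -/(p u v) -/(s v).
  have := Pr_ge0 w0 [set o | V o = v]; rewrite -/(s v) le_eqVlt => /predU1P[<-|v0].
    by rewrite mulr0 Pr_ge0.
  by rewrite divfK// gt_eqF.
rewrite /lp -/(p (U o) (V o)) -/(q (V o) (W o)) -/(r (U o) (V o) (W o)) -/(s (V o)).
have p0 : 0 < p (U o) (V o) by apply: Pr_gt0 wo.
have q0 : 0 < q (V o) (W o) by apply: Pr_gt0 wo.
have r0 : 0 < r (U o) (V o) (W o) by apply: Pr_gt0 wo.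
have s0 : 0 < s (V o) by apply: Pr_gt0 wo.
have gt0 : 0 < g (U o, V o, W o) by rewrite divr_gt0// mulr_gt0.
have := le_ln_sub1 gt0; rewrite {1}/g/= ln_div ?posrE ?mulr_gt0// !lnM ?posrE//.
by lra.
Qed.

(** The hypothesis is the Markov chain G - F - K, given by a kernel so that no division occurs.
    Summing it over g shows that [kap] is also the law of K given F alone, after which the
    logarithms of [kap] cancel. *)
Lemma lp_ci (TF TK : Type) (TG : choiceType) (F : I -> TF) (G : I -> TG)
    (K : I -> TK) (kap : TF -> TK -> R) :
  (forall f k, 0 <= kap f k) ->
  (forall f g k, Pr [set o | (F o, G o, K o) = (f, g, k)] =
                 Pr [set o | (F o, G o) = (f, g)] * kap f k) ->
  forall o, 0 < w o ->
  lp (fun o => (F o, G o, K o)) o + lp F o =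
  lp (fun o => (F o, G o)) o + lp (fun o => (F o, K o)) o.
Proof.
move=> k0 h o wo.
have hFK f k : Pr [set o | (F o, K o) = (f, k)] = Pr [set o | F o = f] * kap f k.
  apply: EFin_inj; rewrite (Pr_fiber w0 w1 _ G) [in RHS]mulrC EFinM (Pr_fiber w0 w1 _ G).
  rewrite -esumZ//; last by move=> j; rewrite lee_fin Pr_ge0.
  apply: eq_esum => g _; rewrite -EFinM mulrC; congr EFin.
  rewrite (@Pr_eq _ _ _ w0 ([set o | F o = f] `&` [set o | G o = g]) [set o | (F o, G o) = (f, g)]).
    rewrite -h; apply: Pr_eq => // o' _.
    by split=> [[/= [-> ->] ->]|[/= -> -> ->]].
  by move=> o' _; split=> [[/= -> ->]|[/= -> ->]].
rewrite /lp h hFK.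
have p0 := Pr_self_gt0 (fun o => (F o, G o, K o)) wo.
rewrite h in p0.
have q0 := Pr_self_gt0 (fun o => (F o, G o)) wo.
have r0 := Pr_self_gt0 F wo.
have kap0 : 0 < kap (F o) (K o) by rewrite -(pmulr_rgt0 _ q0).
rewrite !lnM ?posrE//; lra.
Qed.

(** A function of a finite variable is bounded by some [M], so [M - g] is an admissible witness and
    [nn] reduces to a real expectation. *)
Lemma nn_fin (J : finType) (F : I -> J) (g : J -> R) :
  0 <= \sum_j Pr [set o | F o = j] * g j -> nn (fun o => g (F o)).
Proof.
move=> h; pose M := \sum_j `|g j|.
have gM j : g j <= M.
  apply: (le_trans (ler_norm _)); rewrite /M (bigD1 j)//= lerDl.
  by rewrite sumr_ge0.
exists M, (fun o => M - g (F o)); split=> [z| |o wo].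
- by rewrite subr_ge0.
- rewrite (@Ex_comp _ _ _ w0 w1 _ F (fun j => M - g j)); last by move=> j; rewrite subr_ge0.
  rewrite esum_finType; last by move=> j; rewrite lee_fin mulr_ge0 ?subr_ge0 ?Pr_ge0.
  rewrite sumEFin lee_fin.
  under eq_bigr => j _ do rewrite mulrBr.
  rewrite sumrB -mulr_suml.
  have <- : 1 = \sum_j Pr [set o | F o = j].
    rewrite -(Pr_setT w1) (Pr_finfiber w0 w1 _ F).
    by apply: eq_bigr => j _; rewrite setTI.
  by rewrite mul1r gerBl.
- by lra.
Qed.

(** From ln t <= t at t = 1 / sqrt p. It gives an explicit bound for - p ln p that tends to 0 with
    p. *)
Lemma lnN_le_sqrt (p : R) : 0 <= p -> - p * ln p <= 2 * Num.sqrt p.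
Proof.
rewrite le_eqVlt => /predU1P[<-|p0]; first by rewrite oppr0 mul0r mulr_ge0// sqrtr_ge0.
have s0 : 0 < Num.sqrt p by rewrite sqrtr_gt0.
have e : p = Num.sqrt p ^+ 2 by rewrite sqr_sqrtr// ltW.
have := @ln_sublinear R (Num.sqrt p)^-1; rewrite invr_gt0 => /(_ s0).
rewrite lnV ?posrE// => h.
have -> : ln p = 2 * ln (Num.sqrt p) by rewrite {1}e lnXn// mulr_natl.
rewrite {1}e expr2.
have : Num.sqrt p * Num.sqrt p * (- ln (Num.sqrt p)) <= Num.sqrt p.
  rewrite -[leRHS]mulr1 -mulrA ler_pM2l//.
  by rewrite -[leRHS](@divff _ (Num.sqrt p)) ?gt_eqF// ler_pM2l// ltW.
nra.
Qed.

(** A crude form of Fano's inequality for H(U|V). Each pair (u,v) contributes at most 2 sqrt d + d: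
    on the diagonal ln t <= t - 1 gives at most q(v) - p(v,v) <= d, and off the diagonal p(u,v) <= d
    and [lnN_le_sqrt] apply. Only the convergence to 0 with d matters. *)
Lemma nn_fano (J : finType) (U V : I -> J) (d : R) :
  Pr [set o | U o <> V o] <= d ->
  nn (fun o => lp (fun o => (U o, V o)) o - lp V o
     + (2 * Num.sqrt d + d) *+ #|{: J * J}|).
Proof.
move=> hd; have d0 : 0 <= d := le_trans (Pr_ge0 w0 _) hd.
have s0 := sqrtr_ge0 d.
pose p j := Pr [set o | (U o, V o) = j]; pose q v := Pr [set o | V o = v].
pose g (j : J * J) := ln (p j) - ln (q j.2)
     + (2 * Num.sqrt d + d) *+ #|{: J * J}|.
suff : nn (fun o => g (U o, V o)) by [].
apply: (@nn_fin _ (fun o => (U o, V o)) g); rewrite /g.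
under eq_bigr => j _ do rewrite mulrDr.
rewrite big_split/= -mulr_suml.
have -> : \sum_j Pr [set o | (U o, V o) = j] = 1.
  rewrite -(Pr_setT w1) (Pr_finfiber w0 w1 _ (fun o => (U o, V o))).
  by apply: eq_bigr => j _; rewrite setTI.
rewrite mul1r -sumr_const -big_split/=; apply: sumr_ge0 => -[u v] _.
rewrite -/(p _) /=.
have := Pr_ge0 w0 [set o | (U o, V o) = (u, v)].
rewrite -/(p _) le_eqVlt => /predU1P[<-|p0]; first by rewrite mul0r; lra.
have pq : p (u, v) <= q v by apply: Pr_le => // o [].
have q0 : 0 < q v := lt_le_trans p0 pq.
have [uv|uv] := eqVneq u v.
  subst u; have := @le_ln_sub1 (q v / p (v, v)); rewrite divr_gt0// => /(_ isT).
  rewrite ln_div ?posrE// -(ler_pM2l p0) mulrBr.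
  have -> : p (v, v) * (q v / p (v, v) - 1) = q v - p (v, v).
    by field; rewrite gt_eqF.
  have : q v - p (v, v) <= d.
    apply: le_trans hd; rewrite lerBlDr.
    rewrite -lee_fin EFinD !(PrE w0 w1) (esumID [set o | U o = V o])/=; last first.
      by move=> *; rewrite lee_fin.
    rewrite addeC leeD//; apply: le_esum_set.
    - by move=> *; rewrite lee_fin.
    - by move=> o [].
    - by move=> *; rewrite lee_fin.
    - by move=> o [/= -> ->].
  lra.
have pd : p (u, v) <= d.
  apply: le_trans hd; apply: Pr_le => // o /= [-> ->]; exact/eqP.
have : Num.sqrt (p (u, v)) <= Num.sqrt d by rewrite ler_wsqrtr.
have := lnN_le_sqrt (ltW p0).
have : p (u, v) * ln (q v) <= 0 by rewrite pmulr_rle0// ln_le0// Pr_le1.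
rewrite mulrBr; lra.
Qed.

End Density.

Notation "F ** G" := (fun o => (F o, G o)) (at level 40, left associativity).

Ltac lpeq := apply: lp_eq => // ? ?; split; intros; simpl in *; congruence.

(** * Co-information, data processing and residual information *)

Section Information.
Context {R : realType} {I : choiceType} (w : I -> R).
Hypothesis w0 : forall o, 0 <= w o.
Hypothesis w1 : \esum_(o in [set: I]) (w o)%:E = 1%E.
Local Notation Pr := (Pr w).
Local Notation lp := (lp w).
Local Notation nn := (nn w).

Definition determines (TF TG : Type) (F : I -> TF) (G : I -> TG) : Prop :=
  forall o o', 0 < w o -> 0 < w o' -> F o = F o' -> G o = G o'.

Lemma lp_determined (TF TG : Type) (F : I -> TF) (G : I -> TG) o : 0 < w o ->
  determines F G -> lp (F ** G) o = lp F o.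
Proof. by move=> wo FG; apply: lp_eq => // o' wo'; split=> [[]//|h]; rewrite h (FG _ _ wo' wo h). Qed.

(** Density of I(A;B) - I(A;B|C), in the form that shows its symmetry in the three variables. *)
Definition coinfo (TA TB TC : Type) (A : I -> TA) (B : I -> TB) (C : I -> TC) o :=
  lp (A ** B) o + lp (A ** C) o + lp (B ** C) o
  - lp A o - lp B o - lp C o - lp (A ** B ** C) o.

Definition cmi (TA TB TC : Type) (A : I -> TA) (B : I -> TB) (C : I -> TC) o :=
  lp (A ** B ** C) o + lp C o - lp (A ** C) o - lp (B ** C) o.

Definition mi (TA TB : Type) (A : I -> TA) (B : I -> TB) o :=
  lp (A ** B) o - lp A o - lp B o.

(* A party that sends U and V on its links to A and C, independently of B given
   its view (A, C), can only increase the co-information. *)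
Lemma coinfo_step (TA TB TC TU TV : choiceType) (A : I -> TA) (B : I -> TB)
    (C : I -> TC) (U : I -> TU) (V : I -> TV) :
  (forall o, 0 < w o ->
    lp (A ** C ** B ** (U ** V)) o + lp (A ** C) o =
    lp (A ** C ** B) o + lp (A ** C ** (U ** V)) o) ->
  nn (coinfo A B C) -> nn (coinfo (A ** U) B (C ** V)).
Proof.
move=> ci h.
(* The increment is I(U;B|A) + I(V;B|C) - I(U,V;B|A,C), and [ci] makes the last term vanish. *)
apply: (nn_le (nnD w0 h (nnD w0 (nn_ssa w0 w1 U A B) (nn_ssa w0 w1 V C B)))) => o wo.
have := ci o wo; rewrite /coinfo.
have -> : lp (A ** C ** B) o = lp (A ** B ** C) o by lpeq.
have -> : lp (A ** C ** B ** (U ** V)) o = lp (A ** U ** B ** (C ** V)) o by lpeq.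
have -> : lp (A ** C ** (U ** V)) o = lp (A ** U ** (C ** V)) o by lpeq.
have -> : lp (U ** A ** B) o = lp (A ** U ** B) o by lpeq.
have -> : lp (V ** C ** B) o = lp (B ** (C ** V)) o by lpeq.
have -> : lp (U ** A) o = lp (A ** U) o by lpeq.
have -> : lp (V ** C) o = lp (C ** V) o by lpeq.
have -> : lp (C ** B) o = lp (B ** C) o by lpeq.
lra.
Qed.

Lemma coinfo_rot (TA TB TC : Type) (A : I -> TA) (B : I -> TB) (C : I -> TC) o :
  coinfo A B C o = coinfo B C A o.
Proof.
rewrite /coinfo.
have -> : lp (B ** A) o = lp (A ** B) o by lpeq.
have -> : lp (C ** A) o = lp (A ** C) o by lpeq.
have -> : lp (B ** C ** A) o = lp (A ** B ** C) o by lpeq.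
ring.
Qed.

Lemma coinfo_swap (TA TB TC : Type) (A : I -> TA) (B : I -> TB) (C : I -> TC) o :
  coinfo A B C o = coinfo B A C o.
Proof.
rewrite /coinfo.
have -> : lp (B ** A) o = lp (A ** B) o by lpeq.
have -> : lp (B ** A ** C) o = lp (A ** B ** C) o by lpeq.
ring.
Qed.

Lemma coinfo_congr (TA TB TC TA' TB' TC' : Type) (A : I -> TA) (B : I -> TB)
    (C : I -> TC) (A' : I -> TA') (B' : I -> TB') (C' : I -> TC') o :
  0 < w o -> (forall o', 0 < w o' -> A o' = A o <-> A' o' = A' o) ->
  (forall o', 0 < w o' -> B o' = B o <-> B' o' = B' o) ->
  (forall o', 0 < w o' -> C o' = C o <-> C' o' = C' o) ->
  coinfo A B C o = coinfo A' B' C' o.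
Proof.
move=> wo hA hB hC; rewrite /coinfo.
have pair_ (T1 T2 T1' T2' : Type) (F : I -> T1) (G : I -> T2) (F' : I -> T1') (G' : I -> T2') :
    (forall o', 0 < w o' -> F o' = F o <-> F' o' = F' o) ->
    (forall o', 0 < w o' -> G o' = G o <-> G' o' = G' o) ->
    (forall o', 0 < w o' -> (F ** G) o' = (F ** G) o <-> (F' ** G') o' = (F' ** G') o).
  move=> hF hG o' wo'; have := hF o' wo'; have := hG o' wo'.
  move=> [g1 g2] [f1 f2]; split=> -[/= eF eG].
    by rewrite (f1 eF) (g1 eG).
  by rewrite (f2 eF) (g2 eG).
have e (T T' : Type) (F : I -> T) (F' : I -> T') :
    (forall o', 0 < w o' -> F o' = F o <-> F' o' = F' o) -> lp F o = lp F' o.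
  exact: lp_eq.
rewrite (e _ _ _ _ hA) (e _ _ _ _ hB) (e _ _ _ _ hC).
rewrite (e _ _ _ _ (pair_ _ _ _ _ _ _ _ _ hA hB)).
rewrite (e _ _ _ _ (pair_ _ _ _ _ _ _ _ _ hA hC)).
rewrite (e _ _ _ _ (pair_ _ _ _ _ _ _ _ _ hB hC)).
by rewrite (e _ _ _ _ (pair_ _ _ _ _ _ _ _ _ (pair_ _ _ _ _ _ _ _ _ hA hB) hC)).
Qed.

(** Data processing: the difference is I(A;B|A') + I(B;A'|B'). *)
Lemma nn_mi_mono (TA TB TA' TB' : choiceType) (A : I -> TA) (B : I -> TB)
    (A' : I -> TA') (B' : I -> TB') :
  determines A A' -> determines B B' -> nn (fun o => mi A B o - mi A' B' o).
Proof.
move=> hA hB.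
apply: (nn_le (nnD w0 (nn_ssa w0 w1 A A' B) (nn_ssa w0 w1 B B' A'))) => o wo.
rewrite /mi.
have -> : lp (A ** A' ** B) o = lp (A ** B) o.
  by apply: lp_eq => // o' wo'; split=> [[-> _ ->]//|[a ->]]; rewrite a (hA _ _ wo' wo a).
have -> : lp (B ** B' ** A') o = lp (A' ** B) o.
  by apply: lp_eq => // o' wo'; split=> [[-> _ ->]//|[-> b]]; rewrite b (hB _ _ wo' wo b).
rewrite (lp_determined wo hA) (lp_determined wo hB).
have -> : lp (B' ** A') o = lp (A' ** B') o by lpeq.
lra.
Qed.

(** [U] and [V] estimate X and Z, and Q = al(X) = be(Z) is a common part. Since V and U are computed
    from (B,C) and (A,C), I(A;B|C) >= H(V|C) - H(V|U). Here H(V|U) <= H(X|U) + H(Z|X) + H(V|Z) <=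
    H(Z|X) + 2e. Moreover H(V|C) >= H(Z|C) - e >= H(Z|Q) - e, because D determines C and is
    independent of Z given Q; and H(Z|Q) = H(Z) - H(Q). The variable D is separate from C so that C
    may be a truncation of it. *)
Lemma nn_residual (TA TB TC TD : choiceType) (TX TZ : finType) (TQ : choiceType)
    (A : I -> TA) (B : I -> TB) (C : I -> TC) (D : I -> TD)
    (X U : I -> TX) (Z V : I -> TZ) (al : TX -> TQ) (be : TZ -> TQ)
    (kap : TQ -> TD -> R) (e : R) :
  determines (A ** C) U -> determines (B ** C) V -> determines D C ->
  (forall o, 0 < w o -> al (X o) = be (Z o)) ->
  (forall k d, 0 <= kap k d) ->
  (forall x z d, Pr [set o | (X o, Z o, D o) = (x, z, d)] =
                 Pr [set o | (X o, Z o) = (x, z)] * kap (al x) d) ->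
  nn (fun o => lp (X ** U) o - lp U o + e) ->
  nn (fun o => lp (Z ** V) o - lp V o + e) ->
  nn (fun o => lp (V ** Z) o - lp Z o + e) ->
  nn (fun o => cmi A B C o + 3 * e - (mi X Z o + lp (al \o X) o)).
Proof.
move=> hU hV hC Qe kap0 hD f1 f2 f3.
pose Q := al \o X.
have ci o : 0 < w o -> lp (Q ** Z ** D) o + lp Q o = lp (Q ** Z) o + lp (Q ** D) o.
  apply: (lp_ci w0 w1 kap0) => q z d.
  have fib (S : set I) : Pr S = \sum_x Pr (S `&` [set o | X o = x]).
    exact: Pr_finfiber.
  rewrite !(fib [set _ | _]) mulr_suml; apply: eq_bigr => x _.
  have [<-|qx] := eqVneq (al x) q; last first.
    rewrite !Pr_eq0 ?mul0r// => o1 /= [].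
      by case=> qo _ xo; move: qx; rewrite -qo /Q/= xo eqxx.
    by case=> qo _ _ xo; move: qx; rewrite -qo /Q/= xo eqxx.
  transitivity (Pr [set o | (X o, Z o, D o) = (x, z, d)]).
    by apply: Pr_eq => // o1 _; rewrite /Q /=; split=> [[[_ -> ->] ->]|[-> -> ->]].
  rewrite hD; congr (_ * _).
  by apply: Pr_eq => // o1 _; rewrite /Q /=; split=> [[-> ->]|[[_ ->] ->]].
have s1 := nn_ssa w0 w1 B (V ** C) A.
have s2 := nn_ssa w0 w1 V U (A ** C).
have s3 := nn_ssa w0 w1 Z V C.
have s4 := nn_ssa w0 w1 Z X U.
have s5 := nn_ssa w0 w1 V Z (X ** U).
have s6 := nn_ssa w0 w1 Z C (D ** Q).
have S := nnD w0 (nnD w0 (nnD w0 s1 s2) (nnD w0 s3 s4)) (nnD w0 (nnD w0 s5 s6)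
  (nnD w0 f1 (nnD w0 f2 f3))).
apply: (nn_le S) => o wo; have := ci o wo; rewrite /cmi /mi -/Q.
have -> : lp (B ** (V ** C) ** A) o = lp (A ** B ** C) o.
  apply: lp_eq => // o' wo'; split=> [[-> _ -> ->]//|[-> b c]].
  by rewrite b c (hV o' o wo' wo _)//= b c.
have -> : lp (B ** (V ** C)) o = lp (B ** C) o.
  apply: lp_eq => // o' wo'; split=> [[-> _ ->]//|[b c]].
  by rewrite b c (hV o' o wo' wo _)//= b c.
have -> : lp (V ** C ** A) o = lp (V ** U ** (A ** C)) o.
  apply: lp_eq => // o' wo'; split=> [[-> c a]|[-> _ -> ->]//].
  by rewrite a c (hU o' o wo' wo _)//= a c.
have -> : lp (U ** (A ** C)) o = lp (A ** C) o.
  apply: lp_eq => // o' wo'; split=> [[_ -> ->]//|[a c]].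
  by rewrite a c (hU o' o wo' wo _)//= a c.
have l1 : lp (Z ** V ** C) o <= lp (Z ** C) o.
  by apply: lp_le => // o' _ [-> _ ->].
have -> : lp (Z ** X ** U) o = lp (Z ** (X ** U)) o by lpeq.
have -> : lp (Z ** X) o = lp (X ** Z) o by lpeq.
have l2 : lp (V ** Z ** (X ** U)) o <= lp (V ** U) o.
  by apply: lp_le => // o' _ [-> _ _ ->].
have -> : lp (Z ** C ** (D ** Q)) o = lp (Q ** Z ** D) o.
  apply: lp_eq => // o' wo'; split=> [[-> _ -> ->]//|[-> -> d]].
  by rewrite d (hC o' o wo' wo d).
have -> : lp (C ** (D ** Q)) o = lp (Q ** D) o.
  apply: lp_eq => // o' wo'; split=> [[_ -> ->]//|[-> d]].
  by rewrite d (hC o' o wo' wo d).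
have -> : lp (Q ** Z) o = lp Z o.
  apply: lp_eq => // o' wo'; split=> [[_ ->]//|z].
  by rewrite /Q /= !Qe// z.
lra.
Qed.

End Information.

(** * Entropies of finite variables, and their transfer to densities *)

Section FiniteVariables.
Context {R : realType} {T : finType} (q : T -> R).
Hypothesis q0 : forall t, 0 <= q t.

Definition lpf (A : eqType) (f : T -> A) (t : T) : R :=
  ln (\sum_(t' | f t' == f t) q t').

Lemma ln2_gt0 : 0 < ln 2 :> R.
Proof. by rewrite ln_gt0// ltr1n. Qed.

(** The factor [ln 2] converts bits into nats, the unit of [lp]. *)
Lemma Hf_lpf (A : finType) (f : T -> A) :
  ln 2 * Hf q f = - \sum_t q t * lpf f t.
Proof.
rewrite /Hf mulr_sumr -sumrN (partition_big f xpredT)//=; apply: eq_bigr => a _.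
transitivity (- (\sum_(t | f t == a) q t) * ln (\sum_(t | f t == a) q t)).
  rewrite /hterm; case: eqP => [->|_]; first by rewrite mulr0 oppr0 mul0r.
  by field; rewrite gt_eqF// ln2_gt0.
rewrite mulNr mulr_suml -sumrN; apply: eq_bigr => t /eqP fta.
by rewrite /lpf fta.
Qed.

Lemma Hf_comp_le (A B : finType) (f : T -> A) (g : A -> B) :
  Hf q (g \o f) <= Hf q f.
Proof.
rewrite -(ler_pM2l ln2_gt0) !Hf_lpf lerN2; apply: ler_sum => t _.
have := q0 t; rewrite le_eqVlt => /predU1P[<-|qt]; first by rewrite !mul0r.
rewrite ler_pM2l//.
have le_ : \sum_(t' | f t' == f t) q t' <= \sum_(t' | (g \o f) t' == (g \o f) t) q t'.
  rewrite [leRHS](bigID (fun t' => f t' == f t))/=.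
  rewrite [X in X + _](_ : _ = \sum_(t' | f t' == f t) q t').
    by rewrite lerDl sumr_ge0.
  by apply: eq_bigl => t'; case: (f t' =P f t) => [e|_]; rewrite ?andbF//= e eqxx.
have pos : 0 < \sum_(t' | f t' == f t) q t'.
  by rewrite (bigD1 t)//= ltr_pwDl// sumr_ge0.
by rewrite ler_ln ?posrE// (lt_le_trans pos le_).
Qed.

(** An element lies below [sup] only if the set is bounded above; here [Hf q f] is a bound, since
    every competitor is a function of [f]. *)
Lemma H_GK_ge (A B : finType) (f : T -> A) (g : T -> B) n (a : A -> 'I_n)
    (b : B -> 'I_n) :
  (forall t, 0 < q t -> a (f t) = b (g t)) -> Hf q (a \o f) <= H_GK q f g.
Proof.
move=> h; apply: ub_le_sup; last by exists n, a, b.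
by exists (Hf q f) => _ [m [a' [b' [_ ->]]]]; exact: Hf_comp_le.
Qed.

End FiniteVariables.

Section FiniteDensity.
Context {R : realType} {I : choiceType} (w : I -> R).
Hypothesis w0 : forall o, 0 <= w o.
Hypothesis w1 : \esum_(o in [set: I]) (w o)%:E = 1%E.
Context {T : finType} (F : I -> T) (q : T -> R).
Hypothesis Fq : forall t, Pr w [set o | F o = t] = q t.
Local Notation lp := (lp w).
Local Notation nn := (nn w).

Let q0 t : 0 <= q t. Proof. by rewrite -Fq Pr_ge0. Qed.

Lemma lp_lpf (A : eqType) (f : T -> A) o : lp (f \o F) o = lpf q f (F o).
Proof.
congr ln; rewrite (Pr_finfiber w0 w1 _ F) [RHS]big_mkcond/=; apply: eq_bigr => t _.
case: eqP => [ft|nft].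
  rewrite -Fq; apply: Pr_eq => // o' _; split=> [[]//|/= e]; split=> //.
  by rewrite e.
by apply: Pr_eq0 => o' /= [e e']; case: nft; rewrite -e' e.
Qed.

Lemma sum_q : \sum_t q t = 1.
Proof.
rewrite -(Pr_setT w1) (Pr_finfiber w0 w1 _ F).
by apply: eq_bigr => t _; rewrite setTI Fq.
Qed.

Lemma nn_fin_cst (g : T -> R) c : c <= \sum_t q t * g t -> nn (fun o => g (F o) - c).
Proof.
move=> h; apply: (@nn_fin _ _ _ w0 w1 _ F (fun t => g t - c)).
under eq_bigr => t _ do rewrite Fq mulrBr.
by rewrite sumrB -mulr_suml sum_q mul1r subr_ge0.
Qed.

Lemma nn_Hc (A B : finType) (f : T -> A) (g : T -> B) :
  nn (fun o => lp (g \o F) o - lp ((f \o F) ** (g \o F)) o - ln 2 * Hc q f g).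
Proof.
have h : ln 2 * Hc q f g <= \sum_t q t * (lpf q g t - lpf q (fun t => (f t, g t)) t).
  rewrite /Hc mulrBr !Hf_lpf opprK.
  under [leRHS]eq_bigr => t _ do rewrite mulrBr.
  by rewrite sumrB addrC.
apply: (nn_le (nn_fin_cst h)) => o wo.
by rewrite lp_lpf -(lp_lpf (fun t => (f t, g t))).
Qed.

(** Residual information subtracts the largest entropy of a common function, so I(f;g) minus the
    entropy of any particular common function is at least as large. No maximal common part has to be
    constructed. *)
Lemma nn_RIf (A B : finType) (f : T -> A) (g : T -> B) n (a : A -> 'I_n)
    (b : B -> 'I_n) :
  (forall t, 0 < q t -> a (f t) = b (g t)) ->
  nn (fun o => mi w (f \o F) (g \o F) o + lp (a \o (f \o F)) o - ln 2 * RIf q f g).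
Proof.
move=> h; have hH := H_GK_ge q0 h.
have hs : ln 2 * RIf q f g <= \sum_t q t *
    (lpf q (fun t => (f t, g t)) t - lpf q f t - lpf q g t + lpf q (a \o f) t).
  under [leRHS]eq_bigr => t _ do rewrite mulrDr !mulrBr.
  rewrite big_split/= !sumrB.
  have := Hf_lpf q f; have := Hf_lpf q g; have := Hf_lpf q (fun t => (f t, g t)).
  have := Hf_lpf q (a \o f); rewrite /RIf /If; have := @ln2_gt0 R.
  by nra.
apply: (nn_le (nn_fin_cst hs)) => o wo.
by rewrite /mi !lp_lpf (lp_lpf (a \o f)) -(lp_lpf (fun t => (f t, g t))).
Qed.

End FiniteDensity.

(** * Runs of a protocol *)

Section Runs.
Context {R : realType} {X Y Z : finType} (P : protocol R X Y Z).

Definition e0 : lmsg := ([::], [::]).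
Definition r0 : round := (e0, e0, e0).

(** Cuts long runs and, through the default value [r0], pads short ones with silent rounds, so that
    every truncation has length exactly [n]. *)
Definition trunc n (rs : seq round) : seq round := mkseq (nth r0 rs) n.

Definition mA (a12 a31 : lmsg) : lmsg := (a12.1, a31.2).
Definition mB (a12 a23 : lmsg) : lmsg := (a12.2, a23.1).
Definition mC (a23 a31 : lmsg) : lmsg := (a23.2, a31.1).

(** The factor that one party contributes to the probability of a run: the product of its message
    kernels along the histories of its own two links. *)
Definition pk (k : lhist -> lhist -> lmsg -> R) (ms : lmsg -> lmsg -> lmsg)
    (g1 g2 : lhist) : R :=
  \prod_(i < size g1) k (take i g1) (take i g2) (ms (nth e0 g1 i) (nth e0 g2 i)).

Lemma pk_rcons k ms g1 g2 a b : size g1 = size g2 ->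
  pk k ms (rcons g1 a) (rcons g2 b) = pk k ms g1 g2 * k g1 g2 (ms a b).
Proof.
move=> sz; rewrite /pk size_rcons big_ord_recr/=; congr (_ * _); last first.
  rewrite !nth_rcons sz ltnn eqxx -{1}sz.
  by rewrite -!cats1 !takel_cat ?sz// -{1}sz !take_size.
apply: eq_bigr => i _; rewrite !nth_rcons -sz ltn_ord.
by rewrite -!cats1 !takel_cat// ?(ltnW (ltn_ord i))// -sz ltnW.
Qed.

Definition step x y (rs : seq round) (r : round) : R :=
  alice P x (h12_of rs) (h31_of rs) (mA r.1.1 r.2) *
  bob P y (h12_of rs) (h23_of rs) (mB r.1.1 r.1.2) *
  charlie P (h23_of rs) (h31_of rs) (mC r.1.2 r.2).

Lemma runp_rcons x y rs r : runp P x y (rcons rs r) = runp P x y rs * step x y rs r.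
Proof.
rewrite /runp /step.
have gen (h12 h23 h31 : lhist) : runp_from P x y h12 h23 h31 (rcons rs r) =
    runp_from P x y h12 h23 h31 rs *
    (alice P x (h12 ++ h12_of rs) (h31 ++ h31_of rs) (mA r.1.1 r.2) *
     bob P y (h12 ++ h12_of rs) (h23 ++ h23_of rs) (mB r.1.1 r.1.2) *
     charlie P (h23 ++ h23_of rs) (h31 ++ h31_of rs) (mC r.1.2 r.2)).
  elim: rs h12 h23 h31 => [|[[a12 a23] a31] rs IH] h12 h23 h31.
    by case: r => [[b12 b23] b31]; rewrite /= !cats0 mulr1 mul1r.
  by rewrite /= IH /= !cat_rcons mulrA.
exact: gen.
Qed.

(** The rectangle property: x enters only through a factor on the links 12 and 31, and y only
    through a factor on the links 12 and 23. *)
Lemma runpE x y rs : runp P x y rs =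
  pk (alice P x) mA (h12_of rs) (h31_of rs) *
  pk (bob P y) mB (h12_of rs) (h23_of rs) *
  pk (charlie P) mC (h23_of rs) (h31_of rs).
Proof.
elim/last_ind: rs => [|rs r IH]; first by rewrite /pk/= !big_ord0 !mulr1.
rewrite runp_rcons IH /step /h12_of /h23_of /h31_of !map_rcons.
by rewrite !pk_rcons ?size_map//; ring.
Qed.

Lemma size_trunc n rs : size (trunc n rs) = n.
Proof. exact: size_mkseq. Qed.

Lemma truncS n rs : trunc n.+1 rs = rcons (trunc n rs) (nth r0 rs n).
Proof. exact: mkseqS. Qed.

Lemma trunc_pad n rs : (size rs <= n)%N -> trunc n rs = rs ++ nseq (n - size rs) r0.
Proof.
move=> sz; apply: (@eq_from_nth _ r0).
  by rewrite size_trunc size_cat size_nseq subnKC.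
move=> i; rewrite size_trunc => lt_in; rewrite nth_mkseq// nth_cat.
by case: ltnP => // le_si; rewrite nth_nseq if_same nth_default.
Qed.

Lemma take_trunc n m rs : (n <= m)%N -> take n (trunc m rs) = trunc n rs.
Proof.
move=> nm; apply: (@eq_from_nth _ r0).
  by rewrite size_takel ?size_trunc.
move=> i; rewrite size_takel ?size_trunc// => lt_in.
by rewrite nth_take// !nth_mkseq// (leq_trans lt_in).
Qed.

Hypothesis V : valid_protocol P.

Lemma alice0 x g1 g2 m : 0 <= alice P x g1 g2 m.
Proof. by case: V => _ [/(_ x g1 g2)[]]. Qed.
Lemma bob0 y g1 g2 m : 0 <= bob P y g1 g2 m.
Proof. by case: V => _ [_ [/(_ y g1 g2)[]]]. Qed.
Lemma charlie0 g1 g2 m : 0 <= charlie P g1 g2 m.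
Proof. by case: V => _ [_ [_ [/(_ g1 g2)[]]]]. Qed.
Lemma alice1 x g1 g2 : \esum_(m in [set: lmsg]) (alice P x g1 g2 m)%:E = 1%E.
Proof. by case: V => _ [/(_ x g1 g2)[_ []]]. Qed.
Lemma bob1 y g1 g2 : \esum_(m in [set: lmsg]) (bob P y g1 g2 m)%:E = 1%E.
Proof. by case: V => _ [_ [/(_ y g1 g2)[_ []]]]. Qed.
Lemma charlie1 g1 g2 : \esum_(m in [set: lmsg]) (charlie P g1 g2 m)%:E = 1%E.
Proof. by case: V => _ [_ [_ [/(_ g1 g2)[_ []]]]]. Qed.
Lemma output0 m n z : 0 <= output P m n z.
Proof. by case: V => _ [_ [_ [_ [/(_ m n)[]]]]]. Qed.
Lemma output1 m n : \sum_z output P m n z = 1.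
Proof. by case: V => _ [_ [_ [_ [/(_ m n)[]]]]]. Qed.
Lemma terminates1 x y : \esum_(rs in complete P) (runp P x y rs)%:E = 1%E.
Proof. by case: V => _ [_ [_ [_ [_]]]]; exact. Qed.

Lemma pk_ge0 k ms g1 g2 : (forall g1 g2 m, 0 <= k g1 g2 m) -> 0 <= pk k ms g1 g2.
Proof. by move=> k0; rewrite prodr_ge0. Qed.

Lemma runp0 x y rs : 0 <= runp P x y rs.
Proof.
rewrite runpE !mulr_ge0// pk_ge0// => *; [exact: alice0|exact: bob0|exact: charlie0].
Qed.

Lemma step0 x y rs r : 0 <= step x y rs r.
Proof. by rewrite !mulr_ge0 ?alice0 ?bob0 ?charlie0. Qed.

Lemma step1 x y rs : \esum_(r in [set: round]) (step x y rs r)%:E = 1%E.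
Proof.
(* Regroups the six messages of a round from senders to links, so that the sum splits into one sum
   per party. *)
pose psi (u : lmsg * lmsg * lmsg) : round :=
  ((u.1.1.1, u.1.2.1), (u.1.2.2, u.2.1), (u.2.2, u.1.1.2)).
have bij : set_bij [set: lmsg * lmsg * lmsg] [set: round] psi.
  split=> // [[[[u1 u2] [v1 v2]] [k1 k2]] [[[u1' u2'] [v1' v2']] [k1' k2']] _ _|].
    by move=> -[-> -> -> -> -> ->].
  move=> [[[a b] [c d]] [e f]] _.
  by exists ((a, f), (b, c), (d, e)).
rewrite (reindex_esum setT setT psi)//.
rewrite (eq_esum (b := fun u : lmsg * lmsg * lmsg => (alice P x (h12_of rs) (h31_of rs) u.1.1 *
  bob P y (h12_of rs) (h23_of rs) u.1.2 *
  charlie P (h23_of rs) (h31_of rs) u.2)%:E)); last first.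
  by move=> [[[? ?] [? ?]] [? ?]] _.
rewrite (@esum_pair _ _ _ (fun u v => (alice P x (h12_of rs) (h31_of rs) u.1 *
  bob P y (h12_of rs) (h23_of rs) u.2 * charlie P (h23_of rs) (h31_of rs) v)%:E)); last first.
  by move=> *; rewrite lee_fin !mulr_ge0 ?alice0 ?bob0 ?charlie0.
under eq_esum => u _.
  under eq_esum => v _ do rewrite EFinM.
  rewrite esumZ; last 2 first.
  - by rewrite mulr_ge0 ?alice0 ?bob0.
  - by move=> v; rewrite lee_fin charlie0.
  rewrite charlie1 mule1; over.
rewrite (@esum_pair _ _ _ (fun u v => (alice P x (h12_of rs) (h31_of rs) u *
  bob P y (h12_of rs) (h23_of rs) v)%:E)); last first.
  by move=> *; rewrite lee_fin !mulr_ge0 ?alice0 ?bob0.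
under eq_esum => u _.
  under eq_esum => v _ do rewrite EFinM.
  rewrite esumZ; last 2 first.
  - exact: alice0.
  - by move=> v; rewrite lee_fin bob0.
  rewrite bob1 mule1; over.
exact: alice1.
Qed.

Lemma esum_extensions x y n N (hs : seq round) : size hs = n -> (n <= N)%N ->
  \esum_(h in [set h | size h = N /\ take n h = hs]) (runp P x y h)%:E =
  (runp P x y hs)%:E.
Proof.
move=> szh /subnKC <-; move: (N - n)%N => d.
elim: d => [|d IH].
  rewrite addn0 -(@esum_set1 _ _ hs (fun h => (runp P x y h)%:E)) ?lee_fin ?runp0//.
  congr esum; apply/seteqP; split=> h /=; first by move=> [<-]; rewrite take_size.
  by move=> ->; rewrite -szh take_size.
rewrite -IH addnS.
pose S d := [set h : seq round | size h = d /\ take n h = hs].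
rewrite -/(S (n + d).+1) -/(S (n + d)%N).
pose psi (u : seq round * round) := rcons u.1 u.2.
have bij : set_bij (S (n + d)%N `*` [set: round]) (S (n + d).+1) psi.
  split.
  - move=> [h r] [/= [sh th] _]; rewrite /psi/=; split; first by rewrite size_rcons sh.
    by rewrite -cats1 takel_cat// sh leq_addr.
  - by move=> [h r] [h' r'] _ _ /rcons_inj[-> ->].
  - move=> h [sh th]; case/lastP: h sh th => // h r; rewrite size_rcons => -[sh] th.
    exists (h, r) => //; split=> //; split=> //.
    by move: th; rewrite -cats1 takel_cat// sh leq_addr.
rewrite (reindex_esum _ _ psi _ bij).
rewrite -(@esum_esum _ _ _ (S (n + d)%N) (fun=> [set: round])
  (fun h r => (runp P x y (rcons h r))%:E)); last first.
  by move=> *; rewrite lee_fin runp0.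
apply: eq_esum => h _.
under eq_esum => r _ do rewrite runp_rcons EFinM.
rewrite esumZ ?runp0//; last by move=> r; rewrite lee_fin step0.
by rewrite step1 mule1.
Qed.

Lemma esum_silent (k : lmsg -> R) : (forall m, 0 <= k m) ->
  \esum_(m in [set: lmsg]) (k m)%:E = 1%E ->
  (forall m, 0 < k m -> m = e0) -> k e0 = 1.
Proof.
move=> k0 k1 ke; apply: EFin_inj; rewrite -[RHS]k1.
rewrite -(@esum_set1 _ _ e0 (fun m => (k m)%:E)) ?lee_fin//.
rewrite esum_mkcond [RHS]esum_mkcond; apply: eq_esum => m _.
rewrite in_setT; case: ifPn => //; rewrite notin_setE /= => me.
by congr EFin; apply/eqP; rewrite eq_le k0 leNgt /=; apply/negP => /ke.
Qed.

(** The empty word is a prefix of every word, so no other codeword can coexist with it. *)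
Lemma code_nil (C : pred bits) : prefix_free_code C -> C [::] -> forall u, C u -> u = [::].
Proof. by move=> [_ h] Cn u Cu; rewrite (h _ _ Cn Cu)// prefix0s. Qed.

Lemma alice_nil x g1 g2 : code12f P g1 [::] -> code31b P g2 [::] ->
  alice P x g1 g2 e0 = 1.
Proof.
move=> c1 c2; case: V => co [/(_ x g1 g2)[k0 [k1 kc]] _].
apply: esum_silent => // -[u v] /kc /= [cu cv].
have [C1 _] := co g1; have [_ [_ [_ [_ [_ C2]]]]] := co g2.
by rewrite (code_nil C1 c1 cu) (code_nil C2 c2 cv).
Qed.

Lemma bob_nil y g1 g2 : code12b P g1 [::] -> code23f P g2 [::] ->
  bob P y g1 g2 e0 = 1.
Proof.
move=> c1 c2; case: V => co [_ [/(_ y g1 g2)[k0 [k1 kc]] _]].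
apply: esum_silent => // -[u v] /kc /= [cu cv].
have [_ [C1 _]] := co g1; have [_ [_ [C2 _]]] := co g2.
by rewrite (code_nil C1 c1 cu) (code_nil C2 c2 cv).
Qed.

Lemma charlie_nil g1 g2 : code23b P g1 [::] -> code31f P g2 [::] ->
  charlie P g1 g2 e0 = 1.
Proof.
move=> c1 c2; case: V => co [_ [_ [/(_ g1 g2)[k0 [k1 kc]] _]]].
apply: esum_silent => // -[u v] /kc /= [cu cv].
have [_ [_ [_ [C1 _]]]] := co g1; have [_ [_ [_ [_ [C2 _]]]]] := co g2.
by rewrite (code_nil C1 c1 cu) (code_nil C2 c2 cv).
Qed.

Lemma runp_silent x y rs k : silent_state P rs ->
  runp P x y (rs ++ nseq k r0) = runp P x y rs.
Proof.
move=> sil; elim: k => [|k IH]; first by rewrite cats0.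
have -> : nseq k.+1 r0 = rcons (nseq k r0) r0 by rewrite -cats1 -[[:: r0]]/(nseq 1 r0) -nseqD addn1.
rewrite -rcons_cat runp_rcons IH /step.
have [s1 [s2 [s3 [s4 [s5 s6]]]]] := sil k.
by rewrite alice_nil ?bob_nil ?charlie_nil ?mulr1// ?s1 ?s2 ?s3 ?s4 ?s5 ?s6.
Qed.

Lemma trunc_take n rs : (n <= size rs)%N -> trunc n rs = take n rs.
Proof.
move=> sz; apply: (@eq_from_nth _ r0); rewrite size_trunc ?size_takel// => i lt_in.
by rewrite nth_mkseq// nth_take.
Qed.

(** After padding, the shorter run is still a prefix of the longer one. It is silent, so if it were
    a proper prefix the longer run would have stopped there. *)
Lemma complete_inj N rs rs' : complete P rs -> complete P rs' ->
  (size rs <= N)%N -> (size rs' <= N)%N -> trunc N rs = trunc N rs' -> rs = rs'.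
Proof.
wlog le_ : rs rs' / (size rs <= size rs')%N => [H c c' sz sz' e|].
  have [le_|/ltnW le_] := leqP (size rs) (size rs'); first exact: H.
  by symmetry; apply: H.
move=> [sil _] [_ c'] sz sz' e.
have rsE : rs = take (size rs) rs'.
  by rewrite -trunc_take// -(take_trunc rs' sz) -e take_trunc// trunc_take// take_size.
move: le_; rewrite leq_eqVlt => /orP[/eqP e'|/c' []]; last by rewrite -rsE.
by rewrite rsE e' take_size.
Qed.

(* The runs through hs weigh at most as much as hs, because runs stopped at
   different times stay distinct after padding; both families of weights have
   total mass 1, hence they agree. *)
Lemma esum_trunc x y n hs : size hs = n ->
  \esum_(rs in complete P `&` [set rs | trunc n rs = hs]) (runp P x y rs)%:E =
  (runp P x y hs)%:E.
Proof.
pose S hs := complete P `&` [set rs | trunc (size hs) rs = hs].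
pose a hs := \esum_(rs in S hs) (runp P x y rs)%:E.
have runp0' h : (0 <= (runp P x y h)%:E)%E by rewrite lee_fin runp0.
have le_ h : (a h <= (runp P x y h)%:E)%E.
  apply: ge_ereal_sup => _ [A [finA AS] <-].
  have /finite_seqP[s As] := finA.
  (* Finitely many runs can be padded to one common length, and silence preserves their
     probabilities. *)
  pose N := maxn (size h) (\max_(rs <- s) size rs).
  have hN : (size h <= N)%N by rewrite leq_maxl.
  have AN rs : A rs -> (size rs <= N)%N.
    move=> Ars; rewrite leq_max; apply/orP; right.
    have rs_s : rs \in s by move: Ars; rewrite As.
    exact: (@leq_bigmax_seq (seq round) s xpredT (fun rs => size rs) rs rs_s isT).
  rewrite -esum_fset//.
  rewrite (eq_esum (b := fun rs => (runp P x y (trunc N rs))%:E)); last first.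
    move=> rs Ars; have [[sil _] _] := AS _ Ars.
    by rewrite trunc_pad ?AN// runp_silent.
  rewrite -(esum_image A (trunc N) (fun h => (runp P x y h)%:E)); last first.
    move=> rs rs' /[!inE] Ars Ars'; have [c _] := AS _ Ars; have [c' _] := AS _ Ars'.
    exact: complete_inj c c' (AN _ Ars) (AN _ Ars').
  rewrite -(esum_extensions x y (erefl (size h)) hN).
  apply: le_esum_set => // _ [rs Ars <-] /=; rewrite size_trunc take_trunc//.
  by have [_] := AS _ Ars.
have a_fin h : a h = (fine (a h))%:E.
  rewrite fineK// ge0_fin_numE ?esum_ge0//.
  by rewrite (le_lt_trans (le_ h))// ltry.
move=> sh.
have := @esum_le_eq R _ (fun h : seq round => if size h == n then fine (a h) else 0)
  (fun h => if size h == n then runp P x y h else 0) _ _ _ _ hs.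
rewrite sh eqxx -sh => <-; first by rewrite -a_fin.
- by move=> h; case: ifP => // _; rewrite fine_ge0// esum_ge0.
- by move=> h; case: ifP => // _; rewrite -lee_fin -a_fin.
- transitivity (\esum_(h in [set h : seq round | size h = size hs /\ take 0 h = [::]])
      (runp P x y h)%:E); last by rewrite esum_extensions.
  rewrite [RHS]esum_mkcond; apply: eq_esum => h _.
  case: eqP => [hn|hn]; first by rewrite mem_set //; split; rewrite ?take0.
  by rewrite ifF//; apply/negbTE; rewrite notin_setE => -[].
- rewrite -[RHS](terminates1 x y) [RHS](esum_fiber _ (trunc (size hs)))//; apply: eq_esum => h _.
  case: eqP => [<-|hn]; first by rewrite -a_fin.
  by rewrite esum1// => rs [_ /= e]; case: hn; rewrite -e size_trunc.
Qed.

End Runs.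

(** Where no point of the support lies, both sides of the kernel identity of [lp_ci] are 0. It thus
    suffices to check it at attained values, which matters because arbitrary link histories need not
    come from one run. *)
Lemma lp_ci_supp {R : realType} {I : choiceType} (w : I -> R)
    (w0 : forall o, 0 <= w o) (w1 : \esum_(o in [set: I]) (w o)%:E = 1%E)
    (TF TK : Type) (TG : choiceType) (F : I -> TF) (G : I -> TG) (K : I -> TK)
    (kap : TF -> TK -> R) :
  (forall f k, 0 <= kap f k) ->
  (forall o k, 0 < w o ->
    Pr w [set o' | (F ** G ** K) o' = (F o, G o, k)] =
    Pr w [set o' | (F ** G) o' = (F o, G o)] * kap (F o) k) ->
  forall o, 0 < w o ->
  lp w (F ** G ** K) o + lp w F o = lp w (F ** G) o + lp w (F ** K) o.
Proof.
move=> k0 h; apply: (lp_ci w0 w1 k0) => f g k.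
have [[i [wo <- <-]]|no] := pselect (exists o, [/\ 0 < w o, F o = f & G o = g]).
  exact: h.
have z o : F o = f -> G o = g -> w o = 0.
  move=> fo go; apply/eqP; rewrite eq_le w0 andbT leNgt; apply/negP => wo.
  by apply: no; exists o.
rewrite [LHS]Pr_eq0; last by move=> o [fo go _]; exact: z.
by rewrite Pr_eq0 ?mul0r// => o [fo go]; exact: z.
Qed.

(** * The messages of a party whose input is random *)

Section Mixture.
Context {R : realType} {T : finType} (a : T -> R) (k : T -> lhist -> lhist -> lmsg -> R).
Variable ms : lmsg -> lmsg -> lmsg.
Hypothesis a0 : forall t, 0 <= a t.
Hypothesis k0 : forall t g1 g2 m, 0 <= k t g1 g2 m.
Hypothesis k1 : forall t g1 g2, \esum_(m in [set: lmsg]) (k t g1 g2 m)%:E = 1%E.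

Definition mix g1 g2 : R := \sum_t a t * pk (k t) ms g1 g2.
(** Law of the next messages given the view, the input being averaged under its posterior law. Where
    [mix] vanishes the quotient is 0 and no longer a probability law, hence the hypothesis of
    [mixk1]. *)
Definition mixk g1 g2 m : R :=
  (\sum_t a t * pk (k t) ms g1 g2 * k t g1 g2 m) / mix g1 g2.

Let apk0 t g1 g2 : 0 <= a t * pk (k t) ms g1 g2.
Proof. by rewrite mulr_ge0// prodr_ge0. Qed.

Lemma mix_ge0 g1 g2 : 0 <= mix g1 g2.
Proof. by rewrite sumr_ge0. Qed.

Lemma mixk_ge0 g1 g2 m : 0 <= mixk g1 g2 m.
Proof. by rewrite divr_ge0 ?mix_ge0// sumr_ge0// => t _; rewrite mulr_ge0. Qed.

Lemma mix_rcons g1 g2 x y : size g1 = size g2 ->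
  mix (rcons g1 x) (rcons g2 y) = mix g1 g2 * mixk g1 g2 (ms x y).
Proof.
move=> sz; rewrite /mixk mulrC.
have -> : mix (rcons g1 x) (rcons g2 y) =
    \sum_t a t * pk (k t) ms g1 g2 * k t g1 g2 (ms x y).
  by apply: eq_bigr => t _; rewrite pk_rcons// mulrA.
have [m0|m0] := eqVneq (mix g1 g2) 0; last by rewrite divfK.
rewrite m0 mulr0 big1// => t _; move/eqP: m0.
by rewrite psumr_eq0// => /allP/(_ t (mem_index_enum t))/eqP ->; rewrite mul0r.
Qed.

Lemma mixk1 g1 g2 : mix g1 g2 != 0 ->
  \esum_(m in [set: lmsg]) (mixk g1 g2 m)%:E = 1%E.
Proof.
move=> m0.
have c0 t : 0 <= a t * pk (k t) ms g1 g2 / mix g1 g2 by rewrite divr_ge0 ?mix_ge0.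
transitivity (\esum_(m in [set: lmsg]) \sum_t
    (a t * pk (k t) ms g1 g2 / mix g1 g2)%:E * (k t g1 g2 m)%:E)%E.
  apply: eq_esum => m _; rewrite /mixk mulr_suml -sumEFin; apply: eq_bigr => t _.
  by rewrite -EFinM mulrAC.
rewrite esum_sum; last by move=> *; rewrite mule_ge0// lee_fin.
rewrite (eq_bigr (fun t => (a t * pk (k t) ms g1 g2 / mix g1 g2)%:E)); last first.
  by move=> t _; rewrite esumZ// ?k1 ?mule1// => m; rewrite lee_fin.
by rewrite sumEFin -mulr_suml divff.
Qed.

End Mixture.

(** * Joint law of inputs, output and complete run *)

Section JointLaw.
Context {R : realType} {X Y Z : finType} (P : protocol R X Y Z).
Hypothesis V : valid_protocol P.

Definition outp (rs : seq round) (z : Z) : R :=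
  output P (ltrans (h23_of rs)) (ltrans (h31_of rs)) z.

(** All input laws [j] give weights on one fixed sample space, so replacing the input law means
    comparing two weights. *)
Definition wt (j : X -> Y -> R) (o : X * Y * Z * seq round) : R :=
  if `[< complete P o.2 >]
  then j (vX o.1) (vY o.1) * (runp P (vX o.1) (vY o.1) o.2 * outp o.2 (vZ o.1))
  else 0.

(** The conditional probability, given inputs x and y, that the complete run lies in [S] and the
    output is z; [kap] is the same number as a real. Neither involves the law of the inputs. *)
Definition kE x y z (S : set (seq round)) : \bar R :=
  \esum_(rs in complete P `&` S) (runp P x y rs * outp rs z)%:E.

Let ro0 x y rs z : 0 <= runp P x y rs * outp rs z.
Proof. by rewrite mulr_ge0 ?runp0 ?output0. Qed.

Lemma sum_kE x y S :
  (\sum_z kE x y z S = \esum_(rs in complete P `&` S) (runp P x y rs)%:E)%E.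
Proof.
rewrite /kE -esum_sum; last by move=> *; rewrite lee_fin.
apply: eq_esum => rs _; rewrite sumEFin -mulr_sumr /outp output1 ?mulr1//.
Qed.

Lemma kE_ge0 x y z S : (0 <= kE x y z S)%E.
Proof. by rewrite esum_ge0// => *; rewrite lee_fin. Qed.

Lemma kE_le1 x y z S : (kE x y z S <= 1)%E.
Proof.
rewrite -(terminates1 V x y) -(setIT (complete P)) -sum_kE (bigD1 z)//=.
apply: (@le_trans _ _ (kE x y z setT)).
  by apply: le_esum_set => [rs|rs []//]; rewrite lee_fin.
by rewrite leeDl// sume_ge0// => *; rewrite kE_ge0.
Qed.

Definition kap x y z S : R := fine (kE x y z S).

Lemma kapE x y z S : (kap x y z S)%:E = kE x y z S.
Proof.
rewrite fineK// ge0_fin_numE ?kE_ge0//.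
by rewrite (le_lt_trans (kE_le1 _ _ _ _))// ltry.
Qed.

Lemma kap_ge0 x y z S : 0 <= kap x y z S.
Proof. by rewrite fine_ge0// kE_ge0. Qed.

Variable j : X -> Y -> R.
Hypothesis j0 : forall x y, 0 <= j x y.
Hypothesis j1 : \sum_x \sum_y j x y = 1.

Lemma wt0 o : 0 <= wt j o.
Proof. by rewrite /wt; case: ifP => // _; rewrite mulr_ge0. Qed.

Lemma esum_wt t S : \esum_(o in [set o | o.1 = t /\ S o.2]) (wt j o)%:E =
  ((j (vX t) (vY t))%:E * kE (vX t) (vY t) (vZ t) S)%E.
Proof.
rewrite (reindex_esum S _ (fun rs => (t, rs))); last first.
  split; first by move=> rs.
    by move=> rs rs' _ _ [].
  by move=> [t' rs] [/= -> Srs]; exists rs.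
rewrite -esumZ//; last by move=> rs; rewrite lee_fin.
rewrite esum_mkcondl; apply: eq_esum => rs _.
rewrite /wt /=; case: ifPn => [/asboolP c|nc].
  by rewrite mem_set// EFinM.
by rewrite memNset//; apply/asboolPn.
Qed.

Lemma esum_wt_runs S : \esum_(o in [set o | S o.2]) (wt j o)%:E =
  (\sum_x \sum_y (j x y)%:E * \esum_(rs in complete P `&` S) (runp P x y rs)%:E)%E.
Proof.
rewrite (esum_fiber _ fst); last by move=> o; rewrite lee_fin wt0.
rewrite esum_finType; last first.
  by move=> t; rewrite esum_ge0// => o _; rewrite lee_fin wt0.
under eq_bigr => t _.
  rewrite (_ : _ `&` _ = [set o | o.1 = t /\ S o.2]); last first.
    by apply/seteqP; split=> o [].
  rewrite esum_wt; over.
rewrite pair_bigA /=.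
rewrite -(pair_big xpredT xpredT (fun xy z => (j xy.1 xy.2)%:E * kE xy.1 xy.2 z S)%E)/=.
apply: eq_bigr => xy _.
by rewrite -sum_kE ge0_sume_distrr// => z _; rewrite kE_ge0.
Qed.

Lemma wt1 : \esum_(o in [set: X * Y * Z * seq round]) (wt j o)%:E = 1%E.
Proof.
rewrite (_ : setT = [set o | setT o.2])// esum_wt_runs.
under eq_bigr => x _ do under eq_bigr => y _ do
  rewrite setIT terminates1// mule1.
under eq_bigr => x _ do rewrite sumEFin.
by rewrite sumEFin j1.
Qed.

Lemma Pr_wt t S : Pr (wt j) [set o | o.1 = t /\ S o.2] =
  j (vX t) (vY t) * kap (vX t) (vY t) (vZ t) S.
Proof. by rewrite /Pr esum_wt -kapE -EFinM. Qed.

Lemma Pr_trunc n hs : size hs = n ->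
  Pr (wt j) [set o | trunc n o.2 = hs] = \sum_x \sum_y j x y * runp P x y hs.
Proof.
move=> sz; apply: EFin_inj; rewrite (PrE wt0 wt1) (esum_wt_runs [set rs | trunc n rs = hs]).
under eq_bigr => x _.
  under eq_bigr => y _ do rewrite esum_trunc// -EFinM.
  rewrite sumEFin; over.
by rewrite sumEFin.
Qed.

End JointLaw.

Lemma links_inj (rs rs' : seq round) : h12_of rs = h12_of rs' ->
  h23_of rs = h23_of rs' -> h31_of rs = h31_of rs' -> rs = rs'.
Proof.
elim: rs rs' => [|[[r1 r2] r3] rs IH] [|[[r1' r2'] r3'] rs']//=.
by move=> [-> e1] [-> e2] [-> e3]; rewrite (IH rs').
Qed.

Lemma lmsg_eq (p p' : lmsg) : p.1 = p'.1 -> p.2 = p'.2 -> p = p'.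
Proof. by case: p p' => [? ?] [? ?] /= -> ->. Qed.

(** * Co-information never decreases along the rounds, for product inputs *)

Section ProductInputs.
Context {R : realType} {X Y Z : finType} (P : protocol R X Y Z).
Hypothesis V : valid_protocol P.
Variables (a : X -> R) (b : Y -> R).
Hypothesis a0 : forall x, 0 <= a x.
Hypothesis b0 : forall y, 0 <= b y.
Hypothesis a1 : \sum_x a x = 1.
Hypothesis b1 : \sum_y b y = 1.

Definition jprod x y : R := a x * b y.

Lemma jprod_ge0 x y : 0 <= jprod x y. Proof. by rewrite mulr_ge0. Qed.

Lemma sum_jprod : \sum_x \sum_y jprod x y = 1.
Proof.
rewrite -a1; apply: eq_bigr => x _.
by rewrite /jprod -mulr_sumr b1 mulr1.
Qed.

Local Notation w := (wt P jprod).
Let w0 : forall o, 0 <= w o := wt0 V jprod_ge0.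
Let w1 : \esum_(o in [set: X * Y * Z * seq round]) (w o)%:E = 1%E :=
  wt1 V jprod_ge0 sum_jprod.

Definition kA := mixk a (alice P) mA.
Definition kB := mixk b (bob P) mB.

(** Independence of the inputs splits the double sum over x and y, so the product form survives
    averaging. *)
Lemma Pr_trunc_prod n hs : size hs = n -> Pr w [set o | trunc n o.2 = hs] =
  mix a (alice P) mA (h12_of hs) (h31_of hs) *
  mix b (bob P) mB (h12_of hs) (h23_of hs) *
  pk (charlie P) mC (h23_of hs) (h31_of hs).
Proof.
move=> sz; rewrite (Pr_trunc V jprod_ge0 sum_jprod sz) /mix.
rewrite mulr_suml mulr_suml; apply: eq_bigr => x _.
rewrite mulr_sumr mulr_suml; apply: eq_bigr => y _.
by rewrite runpE /jprod; ring.
Qed.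

Section Step.
Variable n : nat.
Implicit Types o : X * Y * Z * seq round.
Let H o := trunc n o.2.
Let A o := h12_of (H o).
Let B o := h23_of (H o).
Let C o := h31_of (H o).
Let r o := nth r0 o.2 n.
Let ua o := mA (r o).1.1 (r o).2.
Let ub o := mB (r o).1.1 (r o).1.2.
Let uc o := mC (r o).1.2 (r o).2.

(** Given the history, the three parties speak independently, each from a kernel on its own view. *)
Let Pr3 hs u v k : size hs = n ->
  Pr w [set o | H o = hs /\ ua o = u /\ ub o = v /\ uc o = k] =
  Pr w [set o | H o = hs] * kA (h12_of hs) (h31_of hs) u *
  kB (h12_of hs) (h23_of hs) v * charlie P (h23_of hs) (h31_of hs) k.
Proof.
move=> sz; pose s : round := ((u.1, v.1), (v.2, k.1), (k.2, u.2)).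
have -> : [set o | H o = hs /\ ua o = u /\ ub o = v /\ uc o = k] =
    [set o | trunc n.+1 o.2 = rcons hs s].
  apply/seteqP; split=> o /=; rewrite truncS -/(H o) -/(r o).
    move=> [-> [eu [ev ek]]]; congr rcons; rewrite /s -eu -ev -ek /ua /ub /uc /mA /mB /mC /=.
    by case: (r o) => [[[? ?] [? ?]] [? ?]].
  move=> /rcons_inj[e1 e2]; rewrite /ua /ub /uc e1 e2 /s /mA /mB /mC /=.
  by rewrite -!surjective_pairing.
rewrite Pr_trunc_prod ?size_rcons ?sz// Pr_trunc_prod//.
rewrite /h12_of /h23_of /h31_of !map_rcons.
rewrite !mix_rcons ?pk_rcons ?size_map//; last 2 first.
- exact: bob0.
- exact: alice0.
rewrite /kA /kB /mA /mB /mC /=.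
by move: u v k {s} => [? ?] [? ?] [? ?] /=; ring.
Qed.

Let kA0 g1 g2 u : 0 <= kA g1 g2 u.
Proof. by apply: mixk_ge0 => // *; apply: alice0. Qed.

Let kB0 g1 g2 u : 0 <= kB g1 g2 u.
Proof. by apply: mixk_ge0 => // *; apply: bob0. Qed.

Let Pr2 hs u v : size hs = n ->
  Pr w [set o | H o = hs /\ ua o = u /\ ub o = v] =
  Pr w [set o | H o = hs] * kA (h12_of hs) (h31_of hs) u *
  kB (h12_of hs) (h23_of hs) v.
Proof.
move=> sz; apply: EFin_inj; rewrite (Pr_fiber w0 w1 _ uc).
rewrite (eq_esum (b := fun k => (Pr w [set o | H o = hs] *
  kA (h12_of hs) (h31_of hs) u * kB (h12_of hs) (h23_of hs) v)%:E *
  (charlie P (h23_of hs) (h31_of hs) k)%:E)%E); last first.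
  move=> k _; rewrite -EFinM -Pr3//; congr (Pr w _)%:E.
  by apply/seteqP; split=> o /=; tauto.
rewrite esumZ ?charlie1 ?mule1//; first exact: mulr_ge0 (mulr_ge0 (Pr_ge0 w0 _) (kA0 _ _ _)) (kB0 _ _ _).
by move=> k; rewrite lee_fin (charlie0 V).
Qed.

Let Pr1 hs u : size hs = n ->
  Pr w [set o | H o = hs /\ ua o = u] =
  Pr w [set o | H o = hs] * kA (h12_of hs) (h31_of hs) u.
Proof.
move=> sz; apply: EFin_inj; rewrite (Pr_fiber w0 w1 _ ub).
rewrite (eq_esum (b := fun v => (Pr w [set o | H o = hs] *
  kA (h12_of hs) (h31_of hs) u)%:E *
  (kB (h12_of hs) (h23_of hs) v)%:E)%E); last first.
  move=> k _; rewrite -EFinM -Pr2//; congr (Pr w _)%:E.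
  by apply/seteqP; split=> o /=; tauto.
rewrite esumZ; [|exact: mulr_ge0 (Pr_ge0 w0 _) (kA0 _ _ _)|by move=> v; rewrite lee_fin kB0].
(* Where Bob's averaged kernel fails to be a probability law, the history itself has probability
   0. *)
have [m0|m0] := eqVneq (mix b (bob P) mB (h12_of hs) (h23_of hs)) 0.
  by rewrite Pr_trunc_prod// m0 mulr0 !mul0r mul0e.
by rewrite mixk1 ?mule1// => *; [exact: bob0|exact: bob1].
Qed.

Let HE o o' : H o = H o' <-> A o = A o' /\ B o = B o' /\ C o = C o'.
Proof.
split=> [|[e1 [e2 e3]]]; first by rewrite /A /B /C => ->.
exact: links_inj.
Qed.

Let uaE o o' : ua o = ua o' ->
  (r o).1.1.1 = (r o').1.1.1 /\ (r o).2.2 = (r o').2.2.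
Proof. by case. Qed.

Let ubE o o' : ub o = ub o' ->
  (r o).1.1.2 = (r o').1.1.2 /\ (r o).1.2.1 = (r o').1.2.1.
Proof. by case. Qed.

Let sH o : size (H o) = n. Proof. exact: size_trunc. Qed.

(** The messages of a round are simultaneous, but [coinfo_step] treats one speaker at a time. They
    are therefore revealed in the order Alice, Bob, Charlie. In [ci1], [ci2] and [ci3] the speaker's
    messages are independent of the third link given the speaker's two links, each including what
    has already been revealed on it. *)
Let ci1 o : 0 < w o ->
  lp w (A ** C ** B ** ua) o + lp w (A ** C) o =
  lp w (A ** C ** B) o + lp w (A ** C ** ua) o.
Proof.
apply: (lp_ci_supp w0 w1 (kap := fun f u => kA f.1 f.2 u)) => // o1 u wo1 /=.
have -> : [set o' | (A ** C ** B) o' = (A o1, C o1, B o1)] = [set o' | H o' = H o1].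
  by apply/seteqP; split=> o' /=; rewrite HE; [move=> [-> -> ->]|move=> [-> [-> ->]]].
rewrite -Pr1//; congr (Pr w _).
by apply/seteqP; split=> o' /=; rewrite HE; [move=> [-> -> -> ->]|move=> [[-> [-> ->]] ->]].
Qed.

Let ci2 o : 0 < w o ->
  lp w (A ** (fun o => (ua o).1) ** B ** (C ** (fun o => (ua o).2)) ** ub) o +
  lp w (A ** (fun o => (ua o).1) ** B) o =
  lp w (A ** (fun o => (ua o).1) ** B ** (C ** (fun o => (ua o).2))) o +
  lp w (A ** (fun o => (ua o).1) ** B ** ub) o.
Proof.
apply: (lp_ci_supp w0 w1 (kap := fun f u => kB f.1.1 f.2 u)) => // o1 u wo1 /=.
transitivity (Pr w [set o | H o = H o1 /\ ua o = ua o1 /\ ub o = u]).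
  congr (Pr w _); apply/seteqP; split=> o' /=; rewrite HE.
    by move=> [-> e1 -> -> e2 ->]; rewrite (lmsg_eq (p := ua o') (p' := ua o1) e1 e2).
  by move=> [[-> [-> ->]] [/uaE[-> ->] ->]].
rewrite Pr2// -Pr1//; congr (Pr w _ * _).
apply/seteqP; split=> o' /=; rewrite HE; first by move=> [[-> [-> ->]] /uaE[-> ->]].
by move=> [-> e1 -> -> e2]; rewrite (lmsg_eq (p := ua o') (p' := ua o1) e1 e2).
Qed.

Let ci3 o : 0 < w o ->
  lp w (B ** (fun o => (ub o).2) ** (C ** (fun o => (ua o).2)) **
        (A ** (fun o => (ua o).1) ** (fun o => (ub o).1)) ** uc) o +
  lp w (B ** (fun o => (ub o).2) ** (C ** (fun o => (ua o).2))) o =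
  lp w (B ** (fun o => (ub o).2) ** (C ** (fun o => (ua o).2)) **
        (A ** (fun o => (ua o).1) ** (fun o => (ub o).1))) o +
  lp w (B ** (fun o => (ub o).2) ** (C ** (fun o => (ua o).2)) ** uc) o.
Proof.
apply: (lp_ci_supp w0 w1 (kap := fun (f : lhist * bits * (lhist * bits)) u => charlie P f.1.1 f.2.1 u)).
  by move=> *; exact: charlie0.
move=> o1 u wo1 /=.
transitivity (Pr w [set o | H o = H o1 /\ ua o = ua o1 /\ ub o = ub o1 /\ uc o = u]).
  congr (Pr w _); apply/seteqP; split=> o' /=; rewrite HE.
    move=> [-> e1 -> e2 -> e3 e4 ->].
    by rewrite (lmsg_eq (p := ua o') (p' := ua o1) e3 e2) (lmsg_eq (p := ub o') (p' := ub o1) e4 e1).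
  by move=> [[-> [-> ->]] [/uaE[-> ->] [/ubE[-> ->] ->]]].
rewrite Pr3// -Pr2//; congr (Pr w _ * _).
apply/seteqP; split=> o' /=; rewrite HE.
  by move=> [[-> [-> ->]] [/uaE[-> ->] /ubE[-> ->]]].
move=> [-> e1 -> e2 -> e3 e4].
by rewrite (lmsg_eq (p := ua o') (p' := ua o1) e3 e2) (lmsg_eq (p := ub o') (p' := ub o1) e4 e1).
Qed.

Lemma nn_coinfo_truncS : nn w (coinfo w A B C) ->
  nn w (coinfo w (fun o => h12_of (trunc n.+1 o.2)) (fun o => h23_of (trunc n.+1 o.2))
    (fun o => h31_of (trunc n.+1 o.2))).
Proof.
move=> h0.
pose U1 o := (ua o).1; pose U2 o := (ua o).2; pose U3 o := (ub o).1.
pose U4 o := (ub o).2; pose U5 o := (uc o).1; pose U6 o := (uc o).2.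
have h1 : nn w (coinfo w (A ** U1) B (C ** U2)).
  exact: (coinfo_step w0 w1 ci1 h0).
(* [coinfo_step] extends the first and third arguments; the symmetry of the co-information moves the
   next speaker's links there. *)
have h2 : nn w (coinfo w (A ** U1) (C ** U2) B).
  by apply: nn_le h1 _ => o _; rewrite [leLHS](coinfo_swap w0) [leLHS](coinfo_rot w0).
have h3 : nn w (coinfo w (A ** U1 ** U3) (C ** U2) (B ** U4)).
  exact: (coinfo_step w0 w1 ci2 h2).
have h4 : nn w (coinfo w (B ** U4) (A ** U1 ** U3) (C ** U2)).
  by apply: nn_le h3 _ => o _; rewrite [leLHS](coinfo_rot w0) [leLHS](coinfo_rot w0).
have h5 : nn w (coinfo w (B ** U4 ** U5) (A ** U1 ** U3) (C ** U2 ** U6)).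
  exact: (coinfo_step w0 w1 ci3 h4).
apply: nn_le h5 _ => o wo; rewrite [leLHS](coinfo_swap w0) le_eqVlt; apply/orP; left; apply/eqP.
apply: coinfo_congr => // o' wo'.
- rewrite /U1 /U3 /A /h12_of !truncS !map_rcons /= -/(H o) -/(H o') -/(r o) -/(r o').
  split=> [[-> e1 e2]|/rcons_inj[-> ->]//].
  by rewrite (lmsg_eq (p := (r o').1.1) (p' := (r o).1.1) e1 e2).
- rewrite /U4 /U5 /B /h23_of !truncS !map_rcons /= -/(H o) -/(H o') -/(r o) -/(r o').
  split=> [[-> e1 e2]|/rcons_inj[-> ->]//].
  by rewrite (lmsg_eq (p := (r o').1.2) (p' := (r o).1.2) e1 e2).
- rewrite /U2 /U6 /C /h31_of !truncS !map_rcons /= -/(H o) -/(H o') -/(r o) -/(r o').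
  split=> [[-> e1 e2]|/rcons_inj[-> ->]//].
  by rewrite (lmsg_eq (p := (r o').2) (p' := (r o).2) e2 e1).
Qed.

End Step.

Lemma nn_coinfo_trunc n :
  nn w (coinfo w (fun o => h12_of (trunc n o.2)) (fun o => h23_of (trunc n o.2))
    (fun o => h31_of (trunc n o.2))).
Proof.
elim: n => [|n IH]; last exact: nn_coinfo_truncS.
apply: nn_ge0 => // o wo.
have l0 (T : Type) (F : _ -> T) : (forall o', F o' = F o) -> lp w F o = 0.
  move=> F0; rewrite /lp (_ : [set _ | _] = setT) ?Pr_setT ?ln1//.
  by apply/seteqP; split=> // o' _; exact: F0.
by rewrite /coinfo !l0// !subr0 !addr0.
Qed.

End ProductInputs.

(** * Recovering finite variables from truncated transcripts *)

Section Approximation.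
Context {R : realType} {I : choiceType} (w : I -> R).
Hypothesis w0 : forall o, 0 <= w o.
Hypothesis w1 : \esum_(o in [set: I]) (w o)%:E = 1%E.
Local Notation Pr := (Pr w).
Local Notation lp := (lp w).
Local Notation nn := (nn w).
Local Notation determines := (determines w).

Lemma support_exists : exists o, 0 < w o.
Proof.
have [|o _ wo] := @Pr_exists _ _ w w0 setT; last by exists o.
by rewrite Pr_setT.
Qed.

(** A total decoder is wanted because it will also be applied to truncated transcripts, which may be
    values that no complete run produces. *)
Lemma determines_fun (TF TG : Type) (F : I -> TF) (G : I -> TG) :
  determines F G -> exists g : TF -> TG, forall o, 0 < w o -> g (F o) = G o.
Proof.
move=> FG; have [i _] := support_exists.
pose Q t o := 0 < w o /\ F o = t.
exists (fun t => if pselect (exists o, Q t o) is left h then G (projT1 (cid h)) else G i).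
move=> o wo; case: pselect => [h|[]]; last by exists o.
by case: (cid h) => o' [wo' FF] /=; apply: FG.
Qed.

Lemma fano_small (N : nat) (e : R) : 0 < e ->
  exists2 d : R, 0 < d & (2 * Num.sqrt d + d) *+ N <= e.
Proof.
(* With d = s^2 and s <= 1 one has 2 sqrt d + d <= 3 s; dividing by N + 1 instead of N covers N =
   0. *)
move=> e0; pose s := Num.min 1 (e / (3 * N.+1%:R)).
have s0 : 0 < s by rewrite lt_min ltr01 divr_gt0.
have s1 : s <= 1 by rewrite ge_min lexx.
have se : s <= e / (3 * N.+1%:R) by rewrite ge_min lexx orbT.
exists (s ^+ 2); first by rewrite exprn_gt0.
rewrite sqrtr_sqr gtr0_norm// -mulr_natr.
have N0 : 0 <= N%:R :> R by [].
rewrite ler_pdivlMr ?mulr_gt0// in se.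
have sN : 0 <= s * N%:R by rewrite mulr_ge0// ltW.
rewrite -natr1 in se; nra.
Qed.

Section Residual.
Context {TA TB TC TA' TB' TC' : choiceType} {TX TZ : finType} {TQ : choiceType}.
Context (A : I -> TA) (B : I -> TB) (C : I -> TC) (X : I -> TX) (Z : I -> TZ).
Context (al : TX -> TQ) (be : TZ -> TQ) (kap : TQ -> TC -> R).
Hypothesis dX : determines (A ** C) X.
Hypothesis dZ : determines (B ** C) Z.
Hypothesis albe : forall o, 0 < w o -> al (X o) = be (Z o).
Hypothesis kap0 : forall k d, 0 <= kap k d.
Hypothesis hC : forall x z d, Pr [set o | (X o, Z o, C o) = (x, z, d)] =
  Pr [set o | (X o, Z o) = (x, z)] * kap (al x) d.

(** The case without truncation: X and Z are their own estimates and the error is 0. *)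
Lemma nn_cmi_residual :
  nn (fun o => cmi w A B C o - (mi w X Z o + lp (al \o X) o)).
Proof.
have self (T : finType) (F : I -> T) : nn (fun o => lp (F ** F) o - lp F o + 0).
  apply: nn_ge0 => // o wo; rewrite addr0 subr_ge0 le_eqVlt; apply/orP; left.
  by apply/eqP; lpeq.
have fZ := self _ Z.
apply: (nn_le (nn_residual w0 w1 dX dZ _ albe kap0 hC (self _ X) fZ fZ)) => //.
by move=> o _; rewrite mulr0 addr0.
Qed.

Context (An : nat -> I -> TA') (Bn : nat -> I -> TB') (Cn : nat -> I -> TC').
Context (fA : TA' -> TA) (fB : TB' -> TB) (fC : TC' -> TC) (bad : nat -> set I).
Hypothesis dA : forall n, determines A (An n).
Hypothesis dB : forall n, determines B (Bn n).
Hypothesis dC : forall n, determines C (Cn n).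
Hypothesis gA : forall n o, ~ bad n o -> fA (An n o) = A o.
Hypothesis gB : forall n o, ~ bad n o -> fB (Bn n o) = B o.
Hypothesis gC : forall n o, ~ bad n o -> fC (Cn n o) = C o.
Hypothesis badP : forall d, 0 < d -> exists n, Pr (bad n) <= d.
Hypothesis coinfo0 : forall n, nn (coinfo w (An n) (Bn n) (Cn n)).

(** I(A;B) is at least I(An;Bn), hence at least I(An;Bn|Cn), and [nn_residual] bounds the latter
    with [Cn n] as C and the full transcript as D. The decoders fail only on [bad n]; each of the
    three Fano bounds receives e / 3. *)
Lemma nn_mi_residual e : 0 < e ->
  nn (fun o => mi w A B o - (mi w X Z o + lp (al \o X) o) + e).
Proof.
move=> e0; have e3 : 0 < e / 3 by rewrite divr_gt0.
have [d1 d10 hd1] := fano_small #|{: TX * TX}| e3.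
have [d2 d20 hd2] := fano_small #|{: TZ * TZ}| e3.
(* One [n] serves both alphabets; the constants [d1] and [d2] do not depend on it. *)
have [n hn] := badP (d := Num.min d1 d2) ltac:(by rewrite lt_min d10).
have [xi hxi] := determines_fun dX.
have [ze hze] := determines_fun dZ.
pose U o := xi (fA (An n o), fC (Cn n o)).
pose V o := ze (fB (Bn n o), fC (Cn n o)).
have err (T : Type) (F G : I -> T) d : (forall o, 0 < w o -> ~ bad n o -> F o = G o) ->
    Num.min d1 d2 <= d -> Pr [set o | F o <> G o] <= d.
  move=> FG dd; apply: le_trans dd; apply: le_trans hn.
  rewrite (@Pr_eq _ _ w w0 _ ([set o | F o <> G o] `&` bad n)); first by apply: Pr_le => // o [].
  move=> o wo; split=> [h|[]//]; split=> //; apply: contrapT => nb.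
  by apply: h; exact: FG.
have UX o : 0 < w o -> ~ bad n o -> X o = U o.
  by move=> wo nb; rewrite /U gA// gC// hxi.
have VZ o : 0 < w o -> ~ bad n o -> Z o = V o.
  by move=> wo nb; rewrite /V gB// gC// hze.
have fX : nn (fun o => lp (X ** U) o - lp U o + e / 3).
  apply: nn_le (nn_fano w0 w1 (err _ X U d1 UX _)) _; first by rewrite ge_min lexx.
  by move=> o _; rewrite lerD2l.
have fZ : nn (fun o => lp (Z ** V) o - lp V o + e / 3).
  apply: nn_le (nn_fano w0 w1 (err _ Z V d2 VZ _)) _; first by rewrite ge_min lexx orbT.
  by move=> o _; rewrite lerD2l.
have fV : nn (fun o => lp (V ** Z) o - lp Z o + e / 3).
  apply: nn_le (nn_fano w0 w1 (err _ V Z d2 _ _)) _.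
  - by move=> o wo nb; rewrite VZ.
  - by rewrite ge_min lexx orbT.
  - by move=> o _; rewrite lerD2l.
have dU : determines (An n ** Cn n) U.
  by move=> o o' _ _ [h1 h2]; rewrite /U h1 h2.
have dV : determines (Bn n ** Cn n) V.
  by move=> o o' _ _ [h1 h2]; rewrite /V h1 h2.
have res := nn_residual w0 w1 dU dV (dC n) albe kap0 hC fX fZ fV.
have mono := nn_mi_mono w0 w1 (dA n) (dB n).
apply: (nn_le (nnD w0 (nnD w0 res mono) (coinfo0 n))) => o wo.
rewrite /mi /cmi /coinfo; lra.
Qed.

End Residual.

(** Dropping C costs nothing by strong subadditivity, and (A,B,C) determines G. Finally H(G|A,C) =
    H(G|X), because (A,C) determines X and is independent of G given X. *)
Lemma nn_cond_entropy (TA TB TC TG : choiceType) (TX : Type)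
    (A : I -> TA) (B : I -> TB) (C : I -> TC) (X : I -> TX) (G : I -> TG) :
  determines (A ** C) X -> determines (A ** B ** C) G ->
  (forall o, 0 < w o -> lp (X ** G ** (A ** C)) o + lp X o =
                        lp (X ** G) o + lp (X ** (A ** C)) o) ->
  nn (fun o => (lp A o - lp (B ** A) o) - (lp X o - lp (G ** X) o)).
Proof.
move=> dX dG ci; apply: (nn_le (nn_ssa w0 w1 B A C)) => o wo.
have := ci o wo; have -> : lp (X ** (A ** C)) o = lp (A ** C) o.
  by rewrite -(lp_determined w0 wo dX); lpeq.
have -> : lp (X ** G) o = lp (G ** X) o by lpeq.
have : lp (B ** A ** C) o <= lp (X ** G ** (A ** C)) o.
  apply: lp_le => // o' wo' [b a c].
  by rewrite a c (dX o' o wo' wo _)/= ?a ?c// (dG o' o wo' wo _)//= a b c.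
lra.
Qed.

(** H(A|B,C) >= H(G|B,C) = H(G|Z). Both links B and C stay in the condition, so the densities
    compare pointwise. *)
Lemma nn_joint_entropy (TA TB TC : choiceType) (TG TZ : Type)
    (A : I -> TA) (B : I -> TB) (C : I -> TC) (Z : I -> TZ) (G : I -> TG) :
  determines (B ** C) Z -> determines (A ** B ** C) G ->
  (forall o, 0 < w o -> lp (Z ** G ** (B ** C)) o + lp Z o =
                        lp (Z ** G) o + lp (Z ** (B ** C)) o) ->
  nn (fun o => (lp (B ** C) o - lp (A ** B ** C) o) - (lp Z o - lp (G ** Z) o)).
Proof.
move=> dZ dG ci; apply: nn_ge0 => // o wo.
have := ci o wo; have -> : lp (Z ** (B ** C)) o = lp (B ** C) o.
  by rewrite -(lp_determined w0 wo dZ); lpeq.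
have -> : lp (Z ** G) o = lp (G ** Z) o by lpeq.
have : lp (A ** B ** C) o <= lp (Z ** G ** (B ** C)) o.
  apply: lp_le => // o' wo' [a b c].
  by rewrite b c (dZ o' o wo' wo _)/= ?b ?c// (dG o' o wo' wo _)//= a b c.
lra.
Qed.

End Approximation.

(** A level set of [D] is encoded by the rank of a chosen representative, since [H_GK] asks for
    values in an ordinal; [rp] returns the representative, so that a kernel can be read off the
    code. A value z receives the code of any x related to it. *)
Lemma common_part (TX TZ : finType) (S : Type) (D : TX -> S) (D' : TZ -> S)
    (r : TX -> TZ -> Prop) (x0 : TX) : (forall x z, r x z -> D x = D' z) ->
  exists (al : TX -> 'I_#|TX|) (be : TZ -> 'I_#|TX|) (rp : 'I_#|TX| -> TX),
    (forall x, D (rp (al x)) = D x) /\ (forall x z, r x z -> al x = be z).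
Proof.
move=> rD; pose rep x := odflt x [pick x' | `[< D x' = D x >]].
have Drep x : D (rep x) = D x.
  by rewrite /rep; case: pickP => [x' /asboolP|].
have repE x x' : D x = D x' -> rep x = rep x'.
  move=> DD; rewrite /rep -DD; case: pickP => // /(_ x).
  by move=> h; exfalso; move/negP: h; apply; apply/asboolP.
exists (fun x => enum_rank (rep x)).
exists (fun z => if [pick x | `[< r x z >]] is Some x then enum_rank (rep x)
                 else enum_rank x0).
exists enum_val; split=> [x|x z rxz]; first by rewrite enum_rankK.
case: pickP => [x' /asboolP rx'z|/(_ x)/negP []]; last exact/asboolP.
by congr enum_rank; apply: repE; rewrite (rD _ _ rxz) (rD _ _ rx'z).
Qed.

(** * Decoding transcripts *)

Section Decoding.
Variables (cf cb : lhist -> pred bits).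
Hypothesis cfP : forall h, prefix_free_code (cf h).
Hypothesis cbP : forall h, prefix_free_code (cb h).

Fixpoint coded (g h : lhist) : Prop :=
  if h is m :: h' then [/\ cf g m.1, cb g m.2 & coded (rcons g m) h'] else True.

Lemma prefix_free_cat (C : pred bits) (u v s t : bits) :
  prefix_free_code C -> C u -> C v -> u ++ s = v ++ t -> u = v.
Proof.
move=> [_ pf] Cu Cv e; case: (leqP (size u) (size v)) => [|/ltnW] sz.
  apply: pf => //; apply/prefixP; exists (drop (size u) v).
  have := congr1 (take (size u)) e; rewrite take_size_cat// takel_cat// => {1}->.
  by rewrite cat_take_drop.
apply/esym/pf => //; apply/prefixP; exists (drop (size v) u).
have := congr1 (take (size v)) e; rewrite takel_cat// take_size_cat// => {1}<-.
by rewrite cat_take_drop.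
Qed.

Lemma silent_nth (h : lhist) i : ltrans h = ([::], [::]) -> nth e0 h i = e0.
Proof.
elim: h i => [|[u v] h IH] i; first by rewrite nth_nil.
case: u => [|//]; case: v => [|? ?]; rewrite /ltrans//= => -[e1 e2].
by case: i => [//|i]; apply: IH; rewrite /ltrans e1 e2.
Qed.

(** Unique decoding, message by message. Equal transcripts do not force equal lengths, because
    trailing empty messages leave no bits; the comparison is therefore entrywise, with default value
    [e0]. *)
Lemma coded_inj g h h' i : coded g h -> coded g h' -> ltrans h = ltrans h' ->
  nth e0 h i = nth e0 h' i.
Proof.
elim: h g h' i => [|[u v] h IH] g [|[u' v'] h'] i.
- by [].
- by move=> _ _ e; rewrite nth_nil silent_nth// -e.
- by move=> _ _ e; rewrite nth_nil silent_nth// e.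
move=> [/= cu cv ch] [/= cu' cv' ch'] [e1 e2].
have uu := prefix_free_cat (cfP g) cu cu' e1.
have vv := prefix_free_cat (cbP g) cv cv' e2.
subst u' v'; case: i => [//|i] /=.
apply: (IH _ _ _ ch ch').
by move/eqP: e1; move/eqP: e2; rewrite !eqseq_cat// !eqxx /= => /eqP e1 /eqP e2; rewrite /ltrans e1 e2.
Qed.

Lemma coded_nth g h i : coded g h -> (i < size h)%N ->
  cf (g ++ take i h) (nth e0 h i).1 /\ cb (g ++ take i h) (nth e0 h i).2.
Proof.
elim: h g i => [//|m h IH] g [|i] [/= c1 c2 c3]; first by rewrite cats0.
by rewrite ltnS => /(IH _ _ c3); rewrite cat_rcons.
Qed.

Lemma coded_nil h i : coded [::] h -> (i < size h)%N -> nth e0 h i = e0 ->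
  cf (take i h) [::] /\ cb (take i h) [::].
Proof. by move=> c /(coded_nth c) /= + e; rewrite e. Qed.

End Decoding.

Lemma nth_link (f : round -> lmsg) rs i : f r0 = e0 ->
  nth e0 (map f rs) i = f (nth r0 rs i).
Proof.
move=> fr; case: (ltnP i (size rs)) => h; first by rewrite (nth_map r0).
by rewrite !nth_default ?size_map.
Qed.

Lemma map_trunc_eq (f : round -> lmsg) n rs rs' : f r0 = e0 ->
  (forall i, nth e0 (map f rs) i = nth e0 (map f rs') i) ->
  map f (trunc n rs) = map f (trunc n rs').
Proof.
move=> fr h; rewrite -!map_comp; apply: eq_map => i /=.
by rewrite -!nth_link.
Qed.

Lemma ltrans_pad h k : ltrans (h ++ nseq k e0) = ltrans h.
Proof.
rewrite /ltrans !map_cat !flatten_cat.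
have -> : flatten [seq i.1 | i <- nseq k e0] = [::] by elim: k.
have -> : flatten [seq i.2 | i <- nseq k e0] = [::] by elim: k.
by rewrite !cats0.
Qed.

Lemma pad_of_nth (h h' : lhist) : (size h <= size h')%N ->
  (forall i, nth e0 h i = nth e0 h' i) -> h' = h ++ nseq (size h' - size h) e0.
Proof.
move=> sz e; apply: (@eq_from_nth _ e0); first by rewrite size_cat size_nseq subnKC.
move=> i _; rewrite nth_cat; case: ltnP => [//|le]; rewrite nth_nseq if_same.
by rewrite -e nth_default.
Qed.

(** * Runs that agree on the two links of a party *)

Section PossibleRuns.
Context {R : realType} {X Y Z : finType} (P : protocol R X Y Z).
Hypothesis V : valid_protocol P.

Definition poss (rs : seq round) := exists x y, 0 < runp P x y rs.

Definition coded12 := coded (code12f P) (code12b P).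
Definition coded23 := coded (code23f P) (code23b P).
Definition coded31 := coded (code31f P) (code31b P).

Lemma poss_coded rs : poss rs ->
  [/\ coded12 [::] (h12_of rs), coded23 [::] (h23_of rs) & coded31 [::] (h31_of rs)].
Proof.
move=> [x [y]].
suff gen (h12 h23 h31 : lhist) : 0 < runp_from P x y h12 h23 h31 rs ->
  [/\ coded12 h12 (h12_of rs), coded23 h23 (h23_of rs) & coded31 h31 (h31_of rs)].
  exact: gen.
elim: rs h12 h23 h31 => [//|[[a12 a23] a31] rs IH] h12 h23 h31 /=.
have A0 := alice0 V x h12 h31 (a12.1, a31.2).
have B0 := bob0 V y h12 h23 (a12.2, a23.1).
have C0 := charlie0 V h23 h31 (a23.2, a31.1).
have nz (u v : R) : 0 <= u -> 0 < u * v -> 0 < u /\ 0 < v.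
  by rewrite le_eqVlt => /predU1P[<-|u0]; [rewrite mul0r ltxx|rewrite pmulr_rgt0].
move=> /(nz _ _ (mulr_ge0 (mulr_ge0 A0 B0) C0)) [h /IH[i1 i2 i3]].
have [hab c] := nz _ _ (mulr_ge0 A0 B0) h; have [ha hb] := nz _ _ A0 hab.
case: V => _ [Va [Vb [Vc _]]].
have [_ [_ /(_ _ ha)[a1 a2]]] := Va x h12 h31.
have [_ [_ /(_ _ hb)[b1 b2]]] := Vb y h12 h23.
have [_ [_ /(_ _ c)[c1 c2]]] := Vc h23 h31.
by split.
Qed.

Lemma coded12_inj h h' i : coded12 [::] h -> coded12 [::] h' ->
  ltrans h = ltrans h' -> nth e0 h i = nth e0 h' i.
Proof. by apply: coded_inj => g; case: V => /(_ g)[? [? [? [? [? ?]]]]]. Qed.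

Lemma coded23_inj h h' i : coded23 [::] h -> coded23 [::] h' ->
  ltrans h = ltrans h' -> nth e0 h i = nth e0 h' i.
Proof. by apply: coded_inj => g; case: V => /(_ g)[? [? [? [? [? ?]]]]]. Qed.

Lemma coded31_inj h h' i : coded31 [::] h -> coded31 [::] h' ->
  ltrans h = ltrans h' -> nth e0 h i = nth e0 h' i.
Proof. by apply: coded_inj => g; case: V => /(_ g)[? [? [? [? [? ?]]]]]. Qed.

(** One run may be longer because the third link is still active, while this party's links carry
    only empty messages. In those rounds the party's kernel equals 1, by [kk]. *)
Lemma pk_pad (k : lhist -> lhist -> lmsg -> R) (ms : lmsg -> lmsg -> lmsg)
    (g1 g2 h1 h2 : lhist) :
  ms e0 e0 = e0 -> size g1 = size g2 -> size h1 = size h2 ->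
  (size g1 <= size h1)%N ->
  (forall i, nth e0 g1 i = nth e0 h1 i) -> (forall i, nth e0 g2 i = nth e0 h2 i) ->
  (forall i, (i < size h1)%N -> nth e0 h1 i = e0 -> nth e0 h2 i = e0 ->
    k (take i h1) (take i h2) e0 = 1) ->
  pk k ms g1 g2 = pk k ms h1 h2.
Proof.
move=> ms0 sg sh sz e1 e2 kk; rewrite /pk.
rewrite -(big_mkord xpredT (fun i => k (take i g1) (take i g2) (ms (nth e0 g1 i) (nth e0 g2 i)))).
rewrite -(big_mkord xpredT (fun i => k (take i h1) (take i h2) (ms (nth e0 h1 i) (nth e0 h2 i)))).
rewrite [RHS](big_cat_nat (n := size g1))//=.
rewrite [X in _ = _ * X]big1_seq ?mulr1.
  apply: eq_big_nat => i /andP[_ lt].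
  rewrite e1 e2 (pad_of_nth sz e1) (@pad_of_nth g2 h2)//; last by rewrite -sg -sh.
  by rewrite !takel_cat// -?sg ltnW.
move=> i /=; rewrite mem_index_iota => /andP[ge lt].
have n1 : nth e0 h1 i = e0 by rewrite -e1 nth_default.
have n2 : nth e0 h2 i = e0 by rewrite -e2 nth_default// -sg.
by rewrite n1 n2 ms0 kk.
Qed.

Lemma pk_alice_eq x rs rs' : poss rs -> poss rs' ->
  ltrans (h12_of rs) = ltrans (h12_of rs') -> ltrans (h31_of rs) = ltrans (h31_of rs') ->
  pk (alice P x) mA (h12_of rs) (h31_of rs) = pk (alice P x) mA (h12_of rs') (h31_of rs').
Proof.
wlog sz : rs rs' / (size rs <= size rs')%N => [H p p' e1 e2|].
  by have [sz|/ltnW sz] := leqP (size rs) (size rs'); [exact: H|symmetry; apply: H].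
move=> /poss_coded[c1 c2 c3] /poss_coded[c1' c2' c3'] t1 t2.
apply: pk_pad; rewrite ?size_map//.
- by move=> i; exact: coded12_inj.
- by move=> i; exact: coded31_inj.
- move=> i lt /(coded_nil c1') n1 /(coded_nil c3') n2.
  by apply: (alice_nil V); [apply: (n1 _).1|apply: (n2 _).2]; rewrite size_map.
Qed.

Lemma pk_bob_eq y rs rs' : poss rs -> poss rs' ->
  ltrans (h12_of rs) = ltrans (h12_of rs') -> ltrans (h23_of rs) = ltrans (h23_of rs') ->
  pk (bob P y) mB (h12_of rs) (h23_of rs) = pk (bob P y) mB (h12_of rs') (h23_of rs').
Proof.
wlog sz : rs rs' / (size rs <= size rs')%N => [H p p' e1 e2|].
  by have [sz|/ltnW sz] := leqP (size rs) (size rs'); [exact: H|symmetry; apply: H].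
move=> /poss_coded[c1 c2 c3] /poss_coded[c1' c2' c3'] t1 t2.
apply: pk_pad; rewrite ?size_map//.
- by move=> i; exact: coded12_inj.
- by move=> i; exact: coded23_inj.
- move=> i lt /(coded_nil c1') n1 /(coded_nil c2') n2.
  by apply: (bob_nil V); [apply: (n1 _).2|apply: (n2 _).1]; rewrite size_map.
Qed.

Lemma runp_not_poss x y rs : ~ poss rs -> runp P x y rs = 0.
Proof.
move=> np; apply/eqP; rewrite eq_le (runp0 V) andbT leNgt.
by apply/negP => h; apply: np; exists x, y.
Qed.

Local Notation pkA x rs := (pk (alice P x) mA (h12_of rs) (h31_of rs)).
Local Notation pkB y rs := (pk (bob P y) mB (h12_of rs) (h23_of rs)).

(** On runs with prescribed transcripts on Alice's links, replacing x by x' multiplies all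
    probabilities by one ratio, free of y and z. The cross-multiplied form avoids dividing by a
    factor that may vanish. *)
Lemma kap_alice rs (S : set (seq round)) x x' y z : poss rs ->
  (forall rs', S rs' -> ltrans (h12_of rs') = ltrans (h12_of rs) /\
                        ltrans (h31_of rs') = ltrans (h31_of rs)) ->
  pkA x' rs * kap P x y z S = pkA x rs * kap P x' y z S.
Proof.
move=> p hS.
have pk0 x1 : 0 <= pkA x1 rs by apply: pk_ge0 => *; exact: alice0.
have r0 x1 rs1 : (0 <= (runp P x1 y rs1 * outp P rs1 z)%:E)%E.
  by rewrite lee_fin mulr_ge0 ?(runp0 V)// (output0 V).
apply: EFin_inj; rewrite !EFinM !(kapE V) /kE -!esumZ//.
apply: eq_esum => rs' [_ /hS[e1 e2]]; rewrite -!EFinM; congr EFin.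
have [p'|np] := pselect (poss rs'); last by rewrite !(runp_not_poss _ _ np); ring.
by rewrite !runpE !(pk_alice_eq _ p' p e1 e2); ring.
Qed.

Lemma kap_bob rs (S : set (seq round)) x y y' z : poss rs ->
  (forall rs', S rs' -> ltrans (h12_of rs') = ltrans (h12_of rs) /\
                        ltrans (h23_of rs') = ltrans (h23_of rs)) ->
  pkB y' rs * kap P x y z S = pkB y rs * kap P x y' z S.
Proof.
move=> p hS.
have pk0 y1 : 0 <= pkB y1 rs by apply: pk_ge0 => *; exact: bob0.
have r0 y1 rs1 : (0 <= (runp P x y1 rs1 * outp P rs1 z)%:E)%E.
  by rewrite lee_fin mulr_ge0 ?(runp0 V)// (output0 V).
apply: EFin_inj; rewrite !EFinM !(kapE V) /kE -!esumZ//.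
apply: eq_esum => rs' [_ /hS[e1 e2]]; rewrite -!EFinM; congr EFin.
have [p'|np] := pselect (poss rs'); last by rewrite !(runp_not_poss _ _ np); ring.
by rewrite !runpE !(pk_bob_eq _ p' p e1 e2); ring.
Qed.

(** Charlie has no input; the output kernel, which also depends on two transcripts only, takes the
    place of a party's factor. *)
Lemma kap_charlie rs (S : set (seq round)) x y z z' :
  (forall rs', S rs' -> ltrans (h23_of rs') = ltrans (h23_of rs) /\
                        ltrans (h31_of rs') = ltrans (h31_of rs)) ->
  outp P rs z' * kap P x y z S = outp P rs z * kap P x y z' S.
Proof.
move=> hS.
have r0 z1 rs1 : (0 <= (runp P x y rs1 * outp P rs1 z1)%:E)%E.
  by rewrite lee_fin mulr_ge0 ?(runp0 V)// (output0 V).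
have o0 z1 : 0 <= outp P rs z1 by exact: output0.
apply: EFin_inj; rewrite !EFinM !(kapE V) /kE -!esumZ//.
apply: eq_esum => rs' [_ /hS[e1 e2]]; rewrite -!EFinM; congr EFin.
by rewrite /outp e1 e2; ring.
Qed.

End PossibleRuns.

(** * Privacy *)

Section Outcomes.
Context {R : realType} {X Y Z : finType} (P : protocol R X Y Z).
Hypothesis V : valid_protocol P.

Definition L12 (rs : seq round) := ltrans (h12_of rs).
Definition L23 (rs : seq round) := ltrans (h23_of rs).
Definition L31 (rs : seq round) := ltrans (h31_of rs).

Definition outc (o : X * Y * Z * seq round) : outcome X Y Z :=
  (vX o.1, vY o.1, L12 o.2, L23 o.2, L31 o.2, vZ o.1).

Lemma condpE x y m12 m23 m31 z : condp P x y m12 m23 m31 z =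
  kE P x y z [set rs | L12 rs = m12 /\ L23 rs = m23 /\ L31 rs = m31].
Proof.
rewrite /condp /kE; apply: eq_esum => rs [_ [_ [e1 e2]]].
by rewrite /outp e1 e2.
Qed.

Variable j : X -> Y -> R.
Hypothesis j0 : forall x y, 0 <= j x y.
Hypothesis j1 : \sum_x \sum_y j x y = 1.
Local Notation w := (wt P j).
Let w0 : forall o, 0 <= w o := wt0 V j0.
Let w1 : \esum_(o in [set: X * Y * Z * seq round]) (w o)%:E = 1%E := wt1 V j0 j1.

Lemma probE (A : set (outcome X Y Z)) : prob P j A = (Pr w (outc @^-1` A))%:E.
Proof.
rewrite (PrE w0 w1) (esum_fiber _ outc); last by move=> o; rewrite lee_fin.
rewrite /prob esum_mkcond; apply: eq_esum => u _; case: ifPn => [|nA].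
  rewrite inE => Au; rewrite /jointp condpE.
  transitivity (\esum_(o in [set o | o.1 = (oX u, oY u, oZ u) /\
    [set rs | L12 rs = oM12 u /\ L23 rs = oM23 u /\ L31 rs = oM31 u] o.2]) (w o)%:E).
    by rewrite (esum_wt V j0).
  congr esum; apply/seteqP; split=> o.
    move: u Au => [[[[[x y] m12] m23] m31] z] Au.
    move: o => [[[x' y'] z'] rs] [/= [-> -> ->] [e1 [e2 e3]]].
    have e : outc (x, y, z, rs) = (x, y, m12, m23, m31, z).
      by rewrite /outc /vX /vY /vZ /= e1 e2 e3.
    by split; rewrite //= e.
  move=> [_ /= <-]; rewrite /outc /=; split=> //.
  by case: (o) => [[[]]].
rewrite esum1// => o [/= Ao e]; move: nA; rewrite -e.
by rewrite notin_setE => /(_ Ao).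
Qed.

Lemma Pr_xyz (E : X -> Y -> Z -> Prop) (S : set (seq round)) :
  Pr w [set o | E (vX o.1) (vY o.1) (vZ o.1) /\ S o.2] =
  \sum_x \sum_y \sum_z (if `[< E x y z >] then j x y * kap P x y z S else 0).
Proof.
rewrite (Pr_finfiber w0 w1 _ fst) pair_bigA pair_bigA/=.
apply: eq_bigr => -[[x y] z] _ /=; case: asboolP => [e|ne].
  rewrite -(Pr_wt V j0 (x, y, z)); congr (Pr w _).
  apply/seteqP; split=> o /=; first by move=> [[_ s] <-].
  by move=> [-> s].
apply: Pr_eq0 => o /= [[h _] e]; case: ne.
by move: h; rewrite e.
Qed.

Lemma Pr_xyz1 x y z (S : set (seq round)) :
  Pr w [set o | vX o.1 = x /\ vY o.1 = y /\ vZ o.1 = z /\ S o.2] =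
  j x y * kap P x y z S.
Proof.
rewrite -(Pr_wt V j0 (x, y, z)); congr (Pr w _).
apply/seteqP; split=> -[[[x' y'] z'] rs] /=; first by move=> [<- [<- [<- ?]]].
by move=> [[-> -> ->]].
Qed.

End Outcomes.

Section Security.
Context {R : realType} {X Y Z : finType} (pXY : X -> Y -> R) (pZ : X -> Y -> Z -> R).
Context (P : protocol R X Y Z).
Hypothesis fs : full_support_joint pXY.
Hypothesis cd : cond_dist pZ.
Hypothesis nf : normal_form pZ.
Hypothesis sec : secure P pXY pZ.

Let V : valid_protocol P. Proof. by case: sec. Qed.
Let p0 x y : 0 < pXY x y. Proof. by case: fs. Qed.
Let p0' x y : 0 <= pXY x y. Proof. exact: ltW. Qed.
Let p1 : \sum_x \sum_y pXY x y = 1. Proof. by case: fs. Qed.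
Local Notation w := (wt P pXY).
Let w0 : forall o, 0 <= w o := wt0 V p0'.
Let w1 : \esum_(o in [set: X * Y * Z * seq round]) (w o)%:E = 1%E := wt1 V p0' p1.

Lemma kap_setT x y z : kap P x y z setT = pZ x y z.
Proof.
apply: EFin_inj; case: sec => _ /(_ x y z) <- _.
rewrite (kapE V) /kE setIT (esum_fiber _ (fun rs => (L12 rs, L23 rs, L31 rs))); last first.
  by move=> rs; rewrite lee_fin mulr_ge0 ?(runp0 V)// (output0 V).
apply: eq_esum => -[[m12 m23] m31] _; rewrite condpE /kE /=; congr esum.
by apply/seteqP; split=> rs [c /=]; [move=> [-> -> ->]|move=> [-> [-> ->]]].
Qed.

(** Both sides are additive in the value of [F], so the identity passes from points to events. *)
Lemma markov_event (TA TB TC : choiceType) (F : outcome X Y Z -> TA)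
    (G : outcome X Y Z -> TB) (K : outcome X Y Z -> TC) (E : set TA) b c :
  Defs.markov P pXY F G K ->
  Pr w [set o | E (F (outc o)) /\ G (outc o) = b /\ K (outc o) = c] *
  Pr w [set o | G (outc o) = b] =
  Pr w [set o | E (F (outc o)) /\ G (outc o) = b] *
  Pr w [set o | G (outc o) = b /\ K (outc o) = c].
Proof.
move=> mk.
have h a : Pr w [set o | F (outc o) = a /\ G (outc o) = b /\ K (outc o) = c] *
  Pr w [set o | G (outc o) = b] =
  Pr w [set o | F (outc o) = a /\ G (outc o) = b] *
  Pr w [set o | G (outc o) = b /\ K (outc o) = c].
  by apply: EFin_inj; rewrite !EFinM; have := mk a b c; rewrite !(probE V p0' p1).
apply: EFin_inj; rewrite !EFinM [LHS]muleC [RHS]muleC.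
rewrite (Pr_fiber w0 w1 [set o | E (F (outc o)) /\ G (outc o) = b /\ K (outc o) = c] (F \o outc)).
rewrite (Pr_fiber w0 w1 [set o | E (F (outc o)) /\ G (outc o) = b] (F \o outc)).
rewrite -!esumZ ?Pr_ge0//; try by move=> *; rewrite lee_fin Pr_ge0.
apply: eq_esum => a _; rewrite -!EFinM; congr EFin.
have [Ea|nE] := pselect (E a); last first.
  by rewrite [X in _ * X]Pr_eq0 ?[X in _ = _ * X]Pr_eq0 ?mulr0// => o /= [[e _] ea]; case: nE; rewrite -ea.
rewrite mulrC [RHS]mulrC; transitivity (Pr w [set o | F (outc o) = a /\ G (outc o) = b /\ K (outc o) = c] *
  Pr w [set o | G (outc o) = b]).
  congr (_ * _); congr (Pr w _); apply/seteqP; split=> o /=; first by move=> [[_ ?] ?].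
  by move=> [e ?]; rewrite e.
rewrite h; congr (_ * _); congr (Pr w _); apply/seteqP; split=> o /=.
  by move=> [e ?]; rewrite e.
by move=> [[_ ?] ?].
Qed.

(** The two unnamed hypotheses say that (G,K) amounts to (X,Y,Z). Full support allows division by
    [pXY x y], which turns the Markov chain into an identity for the conditional law given x and y.
    That identity no longer mentions the inputs' law and can be used under any other one. *)
Lemma privacy_kernel (TA TB TC : choiceType) (F : outcome X Y Z -> TA)
    (G : outcome X Y Z -> TB) (K : outcome X Y Z -> TC) :
  Defs.markov P pXY F G K ->
  (forall u u', G u = G u' -> K u = K u' -> oX u = oX u' /\ oY u = oY u' /\ oZ u = oZ u') ->
  (forall u u', oX u = oX u' -> oY u = oY u' -> oZ u = oZ u' -> G u = G u' /\ K u = K u') ->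
  exists kp : TB -> set TA -> R, (forall b E, 0 <= kp b E) /\
  forall x y z b (E : set TA), (forall rs, G (outc (x, y, z, rs)) = b) ->
    kap P x y z [set rs | E (F (outc (x, y, z, rs)))] = pZ x y z * kp b E.
Proof.
move=> mk GK1 GK2.
exists (fun b E => Pr w [set o | E (F (outc o)) /\ G (outc o) = b] / Pr w [set o | G (outc o) = b]).
split=> [b E|x y z b E Gb]; first by rewrite divr_ge0 ?Pr_ge0.
pose c := K (outc (x, y, z, [::])).
have m := markov_event E b c mk.
have e (S : set (seq round)) (U : set _) :
    (forall rs, U (x, y, z, rs) <-> S rs) ->
    Pr w (U `&` [set o | G (outc o) = b /\ K (outc o) = c]) = pXY x y * kap P x y z S.
  move=> US; rewrite -(Pr_xyz1 V p0'); congr (Pr w _).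
  apply/seteqP; split=> -[[[x' y'] z'] rs] /=.
    move=> [Uo [Go Ko]].
    have [] := GK1 (outc (x', y', z', rs)) (outc (x, y, z, [::])).
    - by rewrite Go Gb.
    - exact: Ko.
    rewrite /oX /oY /oZ /outc /vX /vY /vZ /= => ex [ey ez]; subst x' y' z'.
    by split=> //; split=> //; split=> //; apply/US.
  rewrite /vX /vY /vZ /= => -[ex [ey [ez Srs]]]; subst x' y' z'.
  have [] := GK2 (outc (x, y, z, rs)) (outc (x, y, z, [::])) erefl erefl erefl.
  by rewrite Gb => -> ->; split=> //; apply/US.
have e1 := e _ [set o | E (F (outc o))] (fun rs => iff_refl _).
have e2 := e setT setT (fun rs => iff_refl _).
rewrite setTI kap_setT in e2; rewrite e2 in m.
have e1' : Pr w [set o | E (F (outc o)) /\ G (outc o) = b /\ K (outc o) = c] =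
  pXY x y * kap P x y z [set rs | E (F (outc (x, y, z, rs)))] by rewrite -e1.
have le_ : Pr w [set o | E (F (outc o)) /\ G (outc o) = b /\ K (outc o) = c] <=
  Pr w [set o | G (outc o) = b] by apply: Pr_le => // o [_ []].
rewrite e1' in m le_.
(* If G = b has probability 0, the quotient defining the kernel is 0, and the left side vanishes as
   well. *)
have := Pr_ge0 w0 [set o | G (outc o) = b]; rewrite le_eqVlt => /predU1P[z0|pos].
  rewrite -z0 invr0 !mulr0; apply/eqP; rewrite eq_le (kap_ge0 V) andbT.
  by move: le_; rewrite -z0 pmulr_rle0.
apply: (mulfI (x := pXY x y)); first by rewrite gt_eqF.
apply: (mulIf (x := Pr w [set o | G (outc o) = b])); first by rewrite gt_eqF.
by rewrite m; field; rewrite gt_eqF.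
Qed.

Lemma privacy_alice : exists kp : X -> set (lmsg * lmsg) -> R,
  (forall x E, 0 <= kp x E) /\ forall x y z E,
  kap P x y z [set rs | E (L12 rs, L31 rs)] = pZ x y z * kp x E.
Proof.
case: sec => _ _ [mk _ _]; have [||kp [kp0 h]] := privacy_kernel mk.
- by move=> u u' gx [gy gz].
- by move=> u u' -> -> ->.
by exists kp; split=> // x y z E; exact: h.
Qed.

Lemma privacy_bob : exists kp : Y -> set (lmsg * lmsg) -> R,
  (forall y E, 0 <= kp y E) /\ forall x y z E,
  kap P x y z [set rs | E (L12 rs, L23 rs)] = pZ x y z * kp y E.
Proof.
case: sec => _ _ [_ mk _]; have [||kp [kp0 h]] := privacy_kernel mk.
- by move=> u u' gy [gx gz].
- by move=> u u' -> -> ->.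
by exists kp; split=> // x y z E; exact: h.
Qed.

Lemma privacy_charlie : exists kp : Z -> set (lmsg * lmsg) -> R,
  (forall z E, 0 <= kp z E) /\ forall x y z E,
  kap P x y z [set rs | E (L23 rs, L31 rs)] = pZ x y z * kp z E.
Proof.
case: sec => _ _ [_ _ mk]; have [||kp [kp0 h]] := privacy_kernel mk.
- by move=> u u' gz [gx gy].
- by move=> u u' -> -> ->.
by exists kp; split=> // x y z E; exact: h.
Qed.

End Security.

(** * Views determine inputs and output; link laws under changed inputs *)

Section SecureInputs.
Context {R : realType} {X Y Z : finType} (pXY : X -> Y -> R) (pZ : X -> Y -> Z -> R).
Context (P : protocol R X Y Z).
Hypothesis fs : full_support_joint pXY.
Hypothesis cd : cond_dist pZ.
Hypothesis nf : normal_form pZ.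
Hypothesis sec : secure P pXY pZ.

Let V : valid_protocol P. Proof. by case: sec. Qed.

Local Notation Omega := (X * Y * Z * seq round)%type.

Definition oL12 (o : Omega) := L12 o.2.
Definition oL23 (o : Omega) := L23 o.2.
Definition oL31 (o : Omega) := L31 o.2.

Lemma kap_gt0 x y z (S : set (seq round)) rs : complete P rs -> S rs ->
  0 < runp P x y rs -> 0 < outp P rs z -> 0 < kap P x y z S.
Proof.
move=> c Srs r p; apply: (@lt_le_trans _ _ (runp P x y rs * outp P rs z)).
  by rewrite mulr_gt0.
have pos rs' : (0 <= (runp P x y rs' * outp P rs' z)%:E)%E.
  by rewrite lee_fin mulr_ge0 ?(runp0 V)// (output0 V).
rewrite -lee_fin (kapE V) /kE.
rewrite -(@esum_set1 _ _ rs (fun rs => (runp P x y rs * outp P rs z)%:E))//.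
by apply: le_esum_set => // _ ->.
Qed.

Lemma pk_gt0 x y rs : 0 < runp P x y rs ->
  0 < pk (alice P x) mA (h12_of rs) (h31_of rs) /\
  0 < pk (bob P y) mB (h12_of rs) (h23_of rs).
Proof.
rewrite runpE => h.
have A0 : 0 <= pk (alice P x) mA (h12_of rs) (h31_of rs).
  by apply: pk_ge0 => *; exact: alice0.
have B0 : 0 <= pk (bob P y) mB (h12_of rs) (h23_of rs).
  by apply: pk_ge0 => *; exact: bob0.
move: A0 B0 h; rewrite !le_eqVlt => /predU1P[<-|hA] /predU1P[<-|hB];
  by rewrite ?mul0r ?mulr0 ?mul0r ?ltxx.
Qed.

Lemma alice_view_determines x y z rs x' y' z' rs' :
  complete P rs -> 0 < runp P x y rs -> 0 < outp P rs z ->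
  complete P rs' -> 0 < runp P x' y' rs' -> 0 < outp P rs' z' ->
  L12 rs = L12 rs' -> L31 rs = L31 rs' -> x = x'.
Proof.
move=> c r p c' r' p' e12 e31.
have [kp [kp0 h]] := privacy_alice fs sec.
pose E := [set (L12 rs, L31 rs)].
pose S := [set r1 | E (L12 r1, L31 r1)].
have hS rs1 : S rs1 -> L12 rs1 = L12 rs /\ L31 rs1 = L31 rs.
  by move=> e; split; [exact: (congr1 fst e)|exact: (congr1 snd e)].
have k1 : 0 < kap P x y z S by exact: (kap_gt0 (S := S) c erefl r p).
have k2 : 0 < kap P x' y' z' S by apply: (kap_gt0 (S := S) c' _ r' p'); rewrite /S /E e12 e31.
rewrite !h in k1 k2.
have [d0 d1] := cd x y.
have pos (u v : R) : 0 <= u -> 0 < u * v -> 0 < v.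
  by rewrite le_eqVlt => /predU1P[<-|u0]; [rewrite mul0r ltxx|rewrite pmulr_rgt0].
have a1 := pos _ _ (d0 z) k1.
have a2 := pos _ _ ((cd x' y').1 z') k2.
have ps : poss P rs by exists x, y.
have ps' : poss P rs' by exists x', y'.
have [f1 _] := pk_gt0 r; have [f2 _] := pk_gt0 r'.
rewrite -(pk_alice_eq V _ ps ps' e12 e31) in f2.
have key y1 z1 := kap_alice (S := S) V x x' y1 z1 ps hS.
set f := pk (alice P x) _ _ _ in f1 key; set f' := pk (alice P x') _ _ _ in f2 key.
have key2 y1 z1 : f' * (pZ x y1 z1 * kp x E) = f * (pZ x' y1 z1 * kp x' E).
  by rewrite -!h; exact: key.
(* Summing over z removes the proportionality constant. *)
have tot (y1 : Y) : f' * kp x E = f * kp x' E.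
  have : \sum_z1 f' * (pZ x y1 z1 * kp x E) = \sum_z1 f * (pZ x' y1 z1 * kp x' E).
    by apply: eq_bigr => z1 _.
  by rewrite -!mulr_sumr -!mulr_suml (cd x y1).2 (cd x' y1).2 !mul1r.
case: nf => nf1 _ _; apply: nf1 => y1 z1.
have nz : f' * kp x E != 0 by rewrite gt_eqF// mulr_gt0.
apply: (mulIf nz); rewrite {2}(tot y1).
by have := key2 y1 z1; rewrite mulrCA [RHS]mulrCA.
Qed.

Lemma bob_view_determines x y z rs x' y' z' rs' :
  complete P rs -> 0 < runp P x y rs -> 0 < outp P rs z ->
  complete P rs' -> 0 < runp P x' y' rs' -> 0 < outp P rs' z' ->
  L12 rs = L12 rs' -> L23 rs = L23 rs' -> y = y'.
Proof.
move=> c r p c' r' p' e12 e23.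
have [kp [kp0 h]] := privacy_bob fs sec.
pose E := [set (L12 rs, L23 rs)].
pose S := [set r1 | E (L12 r1, L23 r1)].
have hS rs1 : S rs1 -> L12 rs1 = L12 rs /\ L23 rs1 = L23 rs.
  by move=> e; split; [exact: (congr1 fst e)|exact: (congr1 snd e)].
have k1 : 0 < kap P x y z S by exact: (kap_gt0 (S := S) c erefl r p).
have k2 : 0 < kap P x' y' z' S by apply: (kap_gt0 (S := S) c' _ r' p'); rewrite /S /E e12 e23.
rewrite !h in k1 k2.
have [d0 d1] := cd x y.
have pos (u v : R) : 0 <= u -> 0 < u * v -> 0 < v.
  by rewrite le_eqVlt => /predU1P[<-|u0]; [rewrite mul0r ltxx|rewrite pmulr_rgt0].
have a1 := pos _ _ (d0 z) k1.
have a2 := pos _ _ ((cd x' y').1 z') k2.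
have ps : poss P rs by exists x, y.
have ps' : poss P rs' by exists x', y'.
have [_ f1] := pk_gt0 r; have [_ f2] := pk_gt0 r'.
rewrite -(pk_bob_eq V _ ps ps' e12 e23) in f2.
have key x1 z1 := kap_bob (S := S) V x1 y y' z1 ps hS.
set f := pk (bob P y) _ _ _ in f1 key; set f' := pk (bob P y') _ _ _ in f2 key.
have key2 x1 z1 : f' * (pZ x1 y z1 * kp y E) = f * (pZ x1 y' z1 * kp y' E).
  by rewrite -!h; exact: key.
have tot (x1 : X) : f' * kp y E = f * kp y' E.
  have : \sum_z1 f' * (pZ x1 y z1 * kp y E) = \sum_z1 f * (pZ x1 y' z1 * kp y' E).
    by apply: eq_bigr => z1 _.
  by rewrite -!mulr_sumr -!mulr_suml (cd x1 y).2 (cd x1 y').2 !mul1r.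
case: nf => _ nf2 _; apply: nf2 => x1 z1.
have nz : f' * kp y E != 0 by rewrite gt_eqF// mulr_gt0.
apply: (mulIf nz); rewrite {2}(tot x1).
by have := key2 x1 z1; rewrite mulrCA [RHS]mulrCA.
Qed.

(** Here z itself varies, so the constant cannot be summed away; it is handed to the third clause of
    the normal form. *)
Lemma charlie_view_determines x y z rs x' y' z' rs' :
  complete P rs -> 0 < runp P x y rs -> 0 < outp P rs z ->
  complete P rs' -> 0 < runp P x' y' rs' -> 0 < outp P rs' z' ->
  L23 rs = L23 rs' -> L31 rs = L31 rs' -> z = z'.
Proof.
move=> c r p c' r' p' e23 e31.
have [kp [kp0 h]] := privacy_charlie fs sec.
pose E := [set (L23 rs, L31 rs)].
pose S := [set r1 | E (L23 r1, L31 r1)].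
have hS rs1 : S rs1 -> L23 rs1 = L23 rs /\ L31 rs1 = L31 rs.
  by move=> e; split; [exact: (congr1 fst e)|exact: (congr1 snd e)].
have k1 : 0 < kap P x y z S by exact: (kap_gt0 (S := S) c erefl r p).
have k2 : 0 < kap P x' y' z' S by apply: (kap_gt0 (S := S) c' _ r' p'); rewrite /S /E e23 e31.
rewrite !h in k1 k2.
have pos (u v : R) : 0 <= u -> 0 < u * v -> 0 < v.
  by rewrite le_eqVlt => /predU1P[<-|u0]; [rewrite mul0r ltxx|rewrite pmulr_rgt0].
have a1 := pos _ _ ((cd x y).1 z) k1.
have a2 := pos _ _ ((cd x' y').1 z') k2.
have op' : 0 < outp P rs z' by move: p'; rewrite /outp -!/(L23 _) -!/(L31 _) e23 e31.
have key x1 y1 := kap_charlie (S := S) V x1 y1 z z' (rs := rs) hS.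
case: nf => _ _ nf3; apply: nf3.
exists (outp P rs z * kp z' E / (outp P rs z' * kp z E)) => x1 y1.
have := key x1 y1; rewrite !h => k.
apply: (mulfI (x := outp P rs z' * kp z E)); first by rewrite gt_eqF// mulr_gt0.
rewrite [LHS](_ : _ = outp P rs z' * (pZ x1 y1 z * kp z E)); last by ring.
by rewrite k; field; rewrite !gt_eqF.
Qed.

(** By privacy the law of Alice's links is the mixture of the kernels [kp x] weighted by the
    marginal of X. *)
Lemma Pr_link_x (j j' : X -> Y -> R) E : (forall x y, 0 <= j x y) ->
  (forall x y, 0 <= j' x y) -> \sum_x \sum_y j x y = 1 ->
  \sum_x \sum_y j' x y = 1 ->
  marginalX j =1 marginalX j' ->
  Pr (wt P j) [set o | E (oL12 o, oL31 o)] = Pr (wt P j') [set o | E (oL12 o, oL31 o)].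
Proof.
move=> j0 j0' j1 j1' mj; have [kp [kp0 h]] := privacy_alice fs sec.
have e (k : X -> Y -> R) : (forall x y, 0 <= k x y) -> \sum_x \sum_y k x y = 1 ->
    Pr (wt P k) [set o | E (oL12 o, oL31 o)] = \sum_x marginalX k x * kp x E.
  move=> k0 k1.
  have := Pr_xyz V k0 k1 (fun _ _ _ => True) [set rs | E (L12 rs, L31 rs)].
  rewrite (_ : [set o | True /\ _] = [set o | E (oL12 o, oL31 o)]); last first.
    by apply/seteqP; split=> o //= [].
  move=> ->; apply: eq_bigr => x _; rewrite /marginalX mulr_suml; apply: eq_bigr => y _.
  transitivity (\sum_z k x y * kp x E * pZ x y z); last first.
    by rewrite -mulr_sumr (cd x y).2 mulr1.
  by apply: eq_bigr => z _; rewrite asboolT// h; ring.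
by rewrite !e//; apply: eq_bigr => x _; rewrite mj.
Qed.

Lemma Pr_link_y (j j' : X -> Y -> R) E : (forall x y, 0 <= j x y) ->
  (forall x y, 0 <= j' x y) -> \sum_x \sum_y j x y = 1 ->
  \sum_x \sum_y j' x y = 1 ->
  marginalY j =1 marginalY j' ->
  Pr (wt P j) [set o | E (oL12 o, oL23 o)] = Pr (wt P j') [set o | E (oL12 o, oL23 o)].
Proof.
move=> j0 j0' j1 j1' mj; have [kp [kp0 h]] := privacy_bob fs sec.
have e (k : X -> Y -> R) : (forall x y, 0 <= k x y) -> \sum_x \sum_y k x y = 1 ->
    Pr (wt P k) [set o | E (oL12 o, oL23 o)] = \sum_y marginalY k y * kp y E.
  move=> k0 k1.
  have := Pr_xyz V k0 k1 (fun _ _ _ => True) [set rs | E (L12 rs, L23 rs)].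
  rewrite (_ : [set o | True /\ _] = [set o | E (oL12 o, oL23 o)]); last first.
    by apply/seteqP; split=> o //= [].
  move=> ->; rewrite exchange_big/=.
  apply: eq_bigr => y _; rewrite /marginalY mulr_suml; apply: eq_bigr => x _.
  transitivity (\sum_z k x y * kp y E * pZ x y z); last first.
    by rewrite -mulr_sumr (cd x y).2 mulr1.
  by apply: eq_bigr => z _; rewrite asboolT// h; ring.
by rewrite !e//; apply: eq_bigr => y _; rewrite mj.
Qed.

Lemma Pr_link12 (j j' : X -> Y -> R) E : (forall x y, 0 <= j x y) ->
  (forall x y, 0 <= j' x y) -> \sum_x \sum_y j x y = 1 ->
  \sum_x \sum_y j' x y = 1 ->
  Pr (wt P j) [set o | E (oL12 o)] = Pr (wt P j') [set o | E (oL12 o)].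
Proof.
(* An intermediate law with the X-marginal of [j] and the Y-marginal of [j']; link 12 belongs to
   both parties, so each half of the comparison applies. *)
move=> j0 j0' j1 j1'; pose k x y := marginalX j x * marginalY j' y.
have mX0 x : 0 <= marginalX j x by rewrite sumr_ge0.
have mY0 y : 0 <= marginalY j' y by rewrite sumr_ge0.
have mY1 : \sum_y marginalY j' y = 1 by rewrite -j1' exchange_big.
have k0 x y : 0 <= k x y by rewrite mulr_ge0.
have kX x : marginalX k x = marginalX j x.
  by rewrite /marginalX /k -mulr_sumr mY1 mulr1.
have kY y : marginalY k y = marginalY j' y.
  by rewrite /marginalY /k -mulr_suml j1 mul1r.
have k1 : \sum_x \sum_y k x y = 1 by rewrite -j1; apply: eq_bigr => x _; exact: kX.
rewrite (Pr_link_x (j' := k) (fun p => E p.1))//.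
exact: (Pr_link_y (j' := j') (fun p => E p.1)).
Qed.

End SecureInputs.

(** * Entropy bounds for one product input law *)

Section SecureProduct.
Context {R : realType} {X Y Z : finType} (pXY : X -> Y -> R) (pZ : X -> Y -> Z -> R).
Context (P : protocol R X Y Z).
Hypothesis fs : full_support_joint pXY.
Hypothesis cd : cond_dist pZ.
Hypothesis nf : normal_form pZ.
Hypothesis sec : secure P pXY pZ.
Context (a : X -> R) (b : Y -> R).
Hypothesis fa : fullsupp a.
Hypothesis fb : fullsupp b.

Let V : valid_protocol P. Proof. by case: sec. Qed.
Let a0 x : 0 <= a x. Proof. by case: fa => h _; exact: ltW. Qed.
Let b0 y : 0 <= b y. Proof. by case: fb => h _; exact: ltW. Qed.
Let a1 : \sum_x a x = 1. Proof. by case: fa. Qed.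
Let b1 : \sum_y b y = 1. Proof. by case: fb. Qed.
Let j0 := jprod_ge0 a0 b0.
Let j1 := sum_jprod a1 b1.

Local Notation w := (wt P (jprod a b)).
Local Notation q := (prodpmf a b pZ).
Local Notation Omega := (X * Y * Z * seq round)%type.
Local Notation lp := (lp w).
Local Notation nn := (nn w).
Local Notation determines := (determines w).

Lemma wp0 : forall o, 0 <= w o. Proof. exact (wt0 V j0). Qed.
Lemma wp1 : \esum_(o in [set: Omega]) (w o)%:E = 1%E. Proof. exact (wt1 V j0 j1). Qed.

Let xv : Omega -> X := @vX X Y Z \o fst.
Let yv : Omega -> Y := @vY X Y Z \o fst.
Let zv : Omega -> Z := @vZ X Y Z \o fst.
Local Notation A := (@oL12 X Y Z).
Local Notation B := (@oL23 X Y Z).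
Local Notation C := (@oL31 X Y Z).

Lemma Pr_input t : Pr w [set o | o.1 = t] = q t.
Proof.
rewrite (_ : [set o | o.1 = t] = [set o | o.1 = t /\ setT o.2]).
  by rewrite (Pr_wt V j0) (kap_setT sec).
by apply/seteqP; split=> o /=; [|case].
Qed.

Lemma w_gt0 o : 0 < w o -> [/\ complete P o.2,
  0 < runp P (vX o.1) (vY o.1) o.2 & 0 < outp P o.2 (vZ o.1)].
Proof.
rewrite /wt; case: asboolP => [c|_]; last by rewrite ltxx.
have r := runp0 V (vX o.1) (vY o.1) o.2.
have p : 0 <= outp P o.2 (vZ o.1) by exact: output0.
move: r p; rewrite !le_eqVlt => /predU1P[<-|r] /predU1P[<-|p];
  by rewrite ?mul0r ?mulr0 ?ltxx.
Qed.

Lemma w_poss o : 0 < w o -> poss P o.2.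
Proof. by move=> /w_gt0[_ r _]; exists (vX o.1), (vY o.1). Qed.

Lemma det_x : determines (A ** C) xv.
Proof.
move=> o o' /w_gt0[c r p] /w_gt0[c' r' p'] e.
exact: (alice_view_determines fs cd nf sec c r p c' r' p' (congr1 fst e) (congr1 snd e)).
Qed.

Lemma det_y : determines (A ** B) yv.
Proof.
move=> o o' /w_gt0[c r p] /w_gt0[c' r' p'] e.
exact: (bob_view_determines fs cd nf sec c r p c' r' p' (congr1 fst e) (congr1 snd e)).
Qed.

Lemma det_z : determines (B ** C) zv.
Proof.
move=> o o' /w_gt0[c r p] /w_gt0[c' r' p'] e.
exact: (charlie_view_determines fs cd nf sec c r p c' r' p' (congr1 fst e) (congr1 snd e)).
Qed.

(** Passes from kernels given a single (x,y,z) to kernels given a coarser event on which they are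
    constant, such as fixed x and z. *)
Lemma Pr_view (F : Omega -> lmsg * lmsg) (f : seq round -> lmsg * lmsg) (c : R)
    (E : X -> Y -> Z -> Prop) (S : set (lmsg * lmsg)) :
  (forall o, F o = f o.2) ->
  (forall x y z, E x y z -> kap P x y z [set rs | S (f rs)] = pZ x y z * c) ->
  Pr w [set o | E (xv o) (yv o) (zv o) /\ S (F o)] =
  Pr w [set o | E (xv o) (yv o) (zv o)] * c.
Proof.
move=> Ff h.
have e1 := Pr_xyz V j0 j1 E [set rs | S (f rs)].
have e2 := Pr_xyz V j0 j1 E setT.
transitivity (Pr w [set o | E (vX o.1) (vY o.1) (vZ o.1) /\ [set rs | S (f rs)] o.2]).
  by congr (Pr w _); apply/seteqP; split=> o /=; rewrite Ff.
rewrite e1; transitivity (Pr w [set o | E (vX o.1) (vY o.1) (vZ o.1) /\ setT o.2] * c); last first.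
  by congr (Pr w _ * _); apply/seteqP; split=> o /=; [case|].
rewrite e2 mulr_suml; apply: eq_bigr => x _; rewrite mulr_suml; apply: eq_bigr => y _.
rewrite mulr_suml; apply: eq_bigr => z _; case: asboolP => [e|]; last by rewrite mul0r.
by rewrite (h _ _ _ e) (kap_setT sec) mulrA.
Qed.

Lemma ci_alice o : 0 < w o ->
  lp (xv ** (yv ** zv) ** (A ** C)) o + lp xv o =
  lp (xv ** (yv ** zv)) o + lp (xv ** (A ** C)) o.
Proof.
have [kp [kp0 h]] := privacy_alice fs sec.
apply: (lp_ci wp0 wp1 (kap := fun x m => kp x [set m])) => // x [y z] m.
rewrite -(@Pr_view (A ** C) (fun rs => (L12 rs, L31 rs)) _
  (fun x' y' z' => (x', (y', z')) = (x, (y, z))) [set m])//; last first.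
  by move=> x' y' z' [-> _ _]; exact: h.
by congr (Pr w _); apply/seteqP; split=> o' /=; [move=> [-> -> -> ->]|move=> [[-> -> ->] ->]].
Qed.

Lemma ci_bob o : 0 < w o ->
  lp (yv ** (xv ** zv) ** (A ** B)) o + lp yv o =
  lp (yv ** (xv ** zv)) o + lp (yv ** (A ** B)) o.
Proof.
have [kp [kp0 h]] := privacy_bob fs sec.
apply: (lp_ci wp0 wp1 (kap := fun y m => kp y [set m])) => // y [x z] m.
rewrite -(@Pr_view (A ** B) (fun rs => (L12 rs, L23 rs)) _
  (fun x' y' z' => (y', (x', z')) = (y, (x, z))) [set m])//; last first.
  by move=> x' y' z' [-> _ _]; exact: h.
by congr (Pr w _); apply/seteqP; split=> o' /=; [move=> [-> -> -> ->]|move=> [[-> -> ->] ->]].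
Qed.

Lemma ci_charlie o : 0 < w o ->
  lp (zv ** (xv ** yv) ** (B ** C)) o + lp zv o =
  lp (zv ** (xv ** yv)) o + lp (zv ** (B ** C)) o.
Proof.
have [kp [kp0 h]] := privacy_charlie fs sec.
apply: (lp_ci wp0 wp1 (kap := fun z m => kp z [set m])) => // z [x y] m.
rewrite -(@Pr_view (B ** C) (fun rs => (L23 rs, L31 rs)) _
  (fun x' y' z' => (z', (x', y')) = (z, (x, y))) [set m])//; last first.
  by move=> x' y' z' [-> _ _]; exact: h.
by congr (Pr w _); apply/seteqP; split=> o' /=; [move=> [-> -> -> ->]|move=> [[-> -> ->] ->]].
Qed.

Lemma q_gt0 t : 0 < q t -> 0 < pZ t.1.1 t.1.2 t.2.
Proof.
rewrite /prodpmf; have [d0 _] := cd t.1.1 t.1.2; have := d0 t.2.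
by rewrite le_eqVlt => /predU1P[<-|//]; rewrite mulr0 ltxx.
Qed.

Lemma w_q_gt0 o : 0 < w o -> 0 < q o.1.
Proof. by move=> wo; rewrite -Pr_input; apply: (Pr_gt0 wp0 wp1) wo. Qed.

(* The conditional law of a link given x, respectively given z, agrees on
   compatible pairs, so its level sets give a common part of x and z that
   screens the link off. *)
Lemma common_xz : exists (al : X -> 'I_#|X|) (be : Z -> 'I_#|X|)
    (kp : 'I_#|X| -> lmsg -> R),
  [/\ forall t, 0 < q t -> al (vX t) = be (vZ t), forall k m, 0 <= kp k m &
   forall x z m, Pr w [set o | (xv o, zv o, C o) = (x, z, m)] =
                 Pr w [set o | (xv o, zv o) = (x, z)] * kp (al x) m].
Proof.
have [kA [kA0 hA]] := privacy_alice fs sec.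
have [kC [kC0 hC]] := privacy_charlie fs sec.
have [i0 _] := support_exists wp0 wp1.
pose E m : set (lmsg * lmsg) := [set p | p.2 = m].
have rel x z : (exists y, 0 < pZ x y z) ->
    (fun m => kA x (E m)) = (fun m => kC z (E m)).
  move=> [y pz]; apply/funext => m; apply: (mulfI (x := pZ x y z)); first by rewrite gt_eqF.
  by rewrite -hA -hC.
have [al [be [rp [hD hr]]]] := common_part (D := fun x m => kA x (E m)) (vX i0.1) rel.
exists al, be, (fun k m => kA (rp k) (E m)); split=> // [t /q_gt0 pt|x z m].
  by apply: hr; exists t.1.2.
rewrite (congr1 (fun D => D m) (hD x) : kA (rp (al x)) (E m) = kA x (E m)).
rewrite -(@Pr_view (A ** C) (fun rs => (L12 rs, L31 rs)) _
  (fun x' y' z' => (x', z') = (x, z)) (E m))//; last first.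
  by move=> x' y' z' [-> _]; exact: hA.
by congr (Pr w _); apply/seteqP; split=> o' /=; [move=> [-> -> <-]|move=> [[-> ->] <-]].
Qed.

Lemma common_yz : exists (al : Y -> 'I_#|Y|) (be : Z -> 'I_#|Y|)
    (kp : 'I_#|Y| -> lmsg -> R),
  [/\ forall t, 0 < q t -> al (vY t) = be (vZ t), forall k m, 0 <= kp k m &
   forall y z m, Pr w [set o | (yv o, zv o, B o) = (y, z, m)] =
                 Pr w [set o | (yv o, zv o) = (y, z)] * kp (al y) m].
Proof.
have [kB [kB0 hB]] := privacy_bob fs sec.
have [kC [kC0 hC]] := privacy_charlie fs sec.
have [i0 _] := support_exists wp0 wp1.
pose E m : set (lmsg * lmsg) := [set p | p.2 = m].
pose E' m : set (lmsg * lmsg) := [set p | p.1 = m].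
have rel y z : (exists x, 0 < pZ x y z) ->
    (fun m => kB y (E m)) = (fun m => kC z (E' m)).
  move=> [x pz]; apply/funext => m; apply: (mulfI (x := pZ x y z)); first by rewrite gt_eqF.
  by rewrite -hB -hC.
have [al [be [rp [hD hr]]]] := common_part (D := fun y m => kB y (E m)) (vY i0.1) rel.
exists al, be, (fun k m => kB (rp k) (E m)); split=> // [t /q_gt0 pt|y z m].
  by apply: hr; exists t.1.1.
rewrite (congr1 (fun D => D m) (hD y) : kB (rp (al y)) (E m) = kB y (E m)).
rewrite -(@Pr_view (A ** B) (fun rs => (L12 rs, L23 rs)) _
  (fun x' y' z' => (y', z') = (y, z)) (E m))//; last first.
  by move=> x' y' z' [-> _]; exact: hB.
by congr (Pr w _); apply/seteqP; split=> o' /=; [move=> [-> -> <-]|move=> [[-> ->] <-]].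
Qed.

Let An n (o : Omega) := h12_of (trunc n o.2).
Let Bn n (o : Omega) := h23_of (trunc n o.2).
Let Cn n (o : Omega) := h31_of (trunc n o.2).
Let bad n : set Omega := [set o | (n < size o.2)%N].

(** By unique decoding the transcript fixes the history up to trailing empty messages, and
    truncation with padding erases that difference. *)
Let dA n : determines A (An n).
Proof.
move=> o o' /w_poss/(poss_coded V)[c _ _] /w_poss/(poss_coded V)[c' _ _] e.
by apply: map_trunc_eq => // i; exact: (coded12_inj V).
Qed.

Let dB n : determines B (Bn n).
Proof.
move=> o o' /w_poss/(poss_coded V)[_ c _] /w_poss/(poss_coded V)[_ c' _] e.
by apply: map_trunc_eq => // i; exact: (coded23_inj V).
Qed.

Let dC n : determines C (Cn n).
Proof.
move=> o o' /w_poss/(poss_coded V)[_ _ c] /w_poss/(poss_coded V)[_ _ c'] e.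
by apply: map_trunc_eq => // i; exact: (coded31_inj V).
Qed.

Let pad (f : round -> lmsg) n rs : f r0 = e0 -> ~ (n < size rs)%N ->
  ltrans (map f (trunc n rs)) = ltrans (map f rs).
Proof.
move=> f0 /negP; rewrite -leqNgt => sz.
by rewrite trunc_pad// map_cat map_nseq f0 ltrans_pad.
Qed.

Let gA n o : ~ bad n o -> ltrans (An n o) = A o. Proof. exact: pad. Qed.
Let gB n o : ~ bad n o -> ltrans (Bn n o) = B o. Proof. exact: pad. Qed.
Let gC n o : ~ bad n o -> ltrans (Cn n o) = C o. Proof. exact: pad. Qed.

(** Total mass 1 is a supremum over finite sets; a finite set of mass above 1 - d has a longest run,
    whose length serves as [n]. *)
Let badP d : 0 < d -> exists n, Pr w (bad n) <= d.
Proof.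
move=> d0.
have : ((1 - d)%:E < \esum_(o in [set: Omega]) (w o)%:E)%E.
  by rewrite wp1 lte_fin; lra.
move=> /ereal_sup_gt[_ [S [finS _] <-]] hS; have /finite_seqP[s Ss] := finS.
pose n := (\max_(o <- s) size o.2)%N.
have Sn o : S o -> (size o.2 <= n)%N.
  move=> So; have os : o \in s by move: So; rewrite Ss.
  exact: (@leq_bigmax_seq Omega s xpredT (fun o => size o.2) o os isT).
exists n; rewrite (_ : bad n = ~` [set o | (size o.2 <= n)%N]); last first.
  by apply/seteqP; split=> o /=; rewrite /bad/= leqNgt => /negP; rewrite ?negbK.
rewrite (Pr_setC wp0 wp1).
suff : 1 - d <= Pr w [set o | (size o.2 <= n)%N] by lra.
rewrite -lee_fin (PrE wp0 wp1) (le_trans (ltW hS))// -esum_fset//.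
  by apply: le_esum_set => // o; rewrite lee_fin wp0.
by move=> o _; rewrite lee_fin wp0.
Qed.

Let coinfo0 n : nn (coinfo w (An n) (Bn n) (Cn n)).
Proof. exact: nn_coinfo_trunc. Qed.

Let coinfo0' n : nn (coinfo w (An n) (Cn n) (Bn n)).
Proof.
apply: nn_le (coinfo0 n) _ => o _.
by rewrite [leLHS](coinfo_swap wp0) [leLHS](coinfo_rot wp0).
Qed.

Lemma mi_residual_xz e : 0 < e ->
  nn (fun o => mi w A B o - ln 2 * RIf q (@vX X Y Z) (@vZ X Y Z) + e).
Proof.
move=> e0; have [al [be [kp [h1 h2 h3]]]] := common_xz.
have albe o : 0 < w o -> al (xv o) = be (zv o) by move=> /w_q_gt0/h1.
have res := nn_mi_residual wp0 wp1 det_x det_z albe h2 h3 dA dB dC gA gB gC badP coinfo0 e0.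
apply: (nn_le (nnD wp0 res (nn_RIf wp0 wp1 Pr_input h1))) => o _.
rewrite -/xv -/zv; lra.
Qed.

Lemma mi_residual_yz e : 0 < e ->
  nn (fun o => mi w A C o - ln 2 * RIf q (@vY X Y Z) (@vZ X Y Z) + e).
Proof.
move=> e0; have [al [be [kp [h1 h2 h3]]]] := common_yz.
have albe o : 0 < w o -> al (yv o) = be (zv o) by move=> /w_q_gt0/h1.
have dz : determines (C ** B) zv by move=> o o' wo wo' h; apply: det_z => //; congruence.
have res := nn_mi_residual wp0 wp1 det_y dz albe h2 h3 dA dC dB gA gC gB badP coinfo0' e0.
apply: (nn_le (nnD wp0 res (nn_RIf wp0 wp1 Pr_input h1))) => o _.
rewrite -/yv -/zv; lra.
Qed.

Lemma cmi_residual_xz :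
  nn (fun o => cmi w A B C o - ln 2 * RIf q (@vX X Y Z) (@vZ X Y Z)).
Proof.
have [al [be [kp [h1 h2 h3]]]] := common_xz.
have albe o : 0 < w o -> al (xv o) = be (zv o) by move=> /w_q_gt0/h1.
have res := nn_cmi_residual wp0 wp1 det_x det_z albe h2 h3.
apply: (nn_le (nnD wp0 res (nn_RIf wp0 wp1 Pr_input h1))) => o _.
rewrite -/xv -/zv; lra.
Qed.

Lemma cmi_residual_yz :
  nn (fun o => cmi w A C B o - ln 2 * RIf q (@vY X Y Z) (@vZ X Y Z)).
Proof.
have [al [be [kp [h1 h2 h3]]]] := common_yz.
have albe o : 0 < w o -> al (yv o) = be (zv o) by move=> /w_q_gt0/h1.
have dz : determines (C ** B) zv by move=> o o' wo wo' h; apply: det_z => //; congruence.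
have res := nn_cmi_residual wp0 wp1 det_y dz albe h2 h3.
apply: (nn_le (nnD wp0 res (nn_RIf wp0 wp1 Pr_input h1))) => o _.
rewrite -/yv -/zv; lra.
Qed.

Let det3 (TF TG TF1 TF2 TG1 TG2 : Type) (F : Omega -> TF) (G : Omega -> TG)
    (F1 : Omega -> TF1) (F2 : Omega -> TF2) (G1 : Omega -> TG1) (G2 : Omega -> TG2) :
  determines F1 G1 -> determines F2 G2 ->
  (forall o o', F o = F o' -> F1 o = F1 o' /\ F2 o = F2 o') ->
  (forall o o', G1 o = G1 o' -> G2 o = G2 o' -> G o = G o') -> determines F G.
Proof.
by move=> d1 d2 hF hG o o' wo wo' /hF[e1 e2]; apply: hG; [apply: d1|apply: d2].
Qed.

Lemma entropy_23_12 : nn (fun o => (lp A o - lp (B ** A) o) -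
  ln 2 * Hc q (fun t => (vY t, vZ t)) (@vX X Y Z)).
Proof.
have dG : determines (A ** B ** C) (yv ** zv).
  by apply: (det3 det_y det_z) => o o'; [split; congruence|move=> e1 e2; congruence].
have h := nn_cond_entropy wp0 wp1 det_x dG ci_alice.
apply: (nn_le (nnD wp0 h (nn_Hc wp0 wp1 Pr_input (fun t => (vY t, vZ t)) (@vX X Y Z)))) => o _.
rewrite -/xv -[(fun t => (vY t, vZ t)) \o fst]/(yv ** zv); lra.
Qed.

Lemma entropy_31_12 : nn (fun o => (lp A o - lp (C ** A) o) -
  ln 2 * Hc q (fun t => (vX t, vZ t)) (@vY X Y Z)).
Proof.
have dG : determines (A ** C ** B) (xv ** zv).
  by apply: (det3 det_x det_z) => o o'; [split; congruence|move=> e1 e2; congruence].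
have h := nn_cond_entropy wp0 wp1 det_y dG ci_bob.
apply: (nn_le (nnD wp0 h (nn_Hc wp0 wp1 Pr_input (fun t => (vX t, vZ t)) (@vY X Y Z)))) => o _.
rewrite -/yv -[(fun t => (vX t, vZ t)) \o fst]/(xv ** zv); lra.
Qed.

Let joint_entropy : nn (fun o => (lp (B ** C) o - lp (A ** B ** C) o) -
  ln 2 * Hc q (fun t => (vX t, vY t)) (@vZ X Y Z)).
Proof.
have dG : determines (A ** B ** C) (xv ** yv).
  by apply: (det3 det_x det_y) => o o'; [split; congruence|move=> e1 e2; congruence].
have h := nn_joint_entropy wp0 wp1 det_z dG ci_charlie.
apply: (nn_le (nnD wp0 h (nn_Hc wp0 wp1 Pr_input (fun t => (vX t, vY t)) (@vZ X Y Z)))) => o _.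
rewrite -/zv -[(fun t => (vX t, vY t)) \o fst]/(xv ** yv); lra.
Qed.

(** H(A|C) = I(A;B|C) + H(A|B,C). The first term is bounded by residual information on the full
    transcripts, without error; the second is at least H(X,Y|Z). *)
Lemma entropy_12_31 : nn (fun o => (lp C o - lp (A ** C) o) -
  ln 2 * (RIf q (@vX X Y Z) (@vZ X Y Z) + Hc q (fun t => (vX t, vY t)) (@vZ X Y Z))).
Proof.
apply: (nn_le (nnD wp0 cmi_residual_xz joint_entropy)) => o _.
rewrite /cmi; lra.
Qed.

Lemma entropy_12_23 : nn (fun o => (lp B o - lp (A ** B) o) -
  ln 2 * (RIf q (@vY X Y Z) (@vZ X Y Z) + Hc q (fun t => (vX t, vY t)) (@vZ X Y Z))).
Proof.
apply: (nn_le (nnD wp0 cmi_residual_yz joint_entropy)) => o _.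
rewrite /cmi.
have -> : lp (A ** C ** B) o = lp (A ** B ** C) o by apply: (lp_eq wp0) => // ? ?; split; congruence.
have -> : lp (C ** B) o = lp (B ** C) o by apply: (lp_eq wp0) => // ? ?; split; congruence.
lra.
Qed.

End SecureProduct.

(** * Joining a mutual information and a conditional entropy from two input laws *)

Section Combine.
Context {R : realType} {I T1 T2 : choiceType}.

Lemma mi_sym (w : I -> R) (w0 : forall o, 0 <= w o) (F : I -> T1) (G : I -> T2) o :
  mi w F G o = mi w G F o.
Proof.
rewrite /mi; have -> : lp w (F ** G) o = lp w (G ** F) o by lpeq.
by rewrite addrAC.
Qed.

Lemma Ex_cond_entropy_law (w w' : I -> R) (F : I -> T1) (G : I -> T2) :
  (forall o, 0 <= w o) -> \esum_(o in [set: I]) (w o)%:E = 1%E ->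
  (forall o, 0 <= w' o) -> \esum_(o in [set: I]) (w' o)%:E = 1%E ->
  (forall E : set (T1 * T2),
    Pr w [set o | E ((F ** G) o)] = Pr w' [set o | E ((F ** G) o)]) ->
  Ex w (fun o => lp w G o - lp w (F ** G) o) =
  Ex w' (fun o => lp w' G o - lp w' (F ** G) o).
Proof.
move=> w0 w1 w0' w1' law.
pose P k := Pr w [set o | (F ** G) o = k].
(* The value 0 off the support makes [h] nonnegative everywhere, as [Ex_comp] requires. *)
pose h k := if P k == 0 then 0 else ln (Pr w [set o | G o = k.2]) - ln (P k).
have h0 k : 0 <= h k.
  rewrite /h; case: eqP => // /eqP Pk.
  have Pk0 : 0 < P k by rewrite lt_neqAle eq_sym Pk Pr_ge0.
  have le_ : P k <= Pr w [set o | G o = k.2] by apply: Pr_le => // o /= <-.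
  by rewrite subr_ge0 ler_ln ?posrE// (lt_le_trans Pk0).
have P' k : P k = Pr w' [set o | (F ** G) o = k] by exact: (law [set k]).
have G' v : Pr w [set o | G o = v] = Pr w' [set o | G o = v].
  exact: (law [set k | k.2 = v]).
transitivity (Ex w (fun o => h ((F ** G) o))).
  apply: eq_Ex => // o wo; rewrite /h ifF//; apply/negbTE; rewrite gt_eqF//.
  by rewrite /P; apply: (Pr_gt0 w0 w1) wo.
transitivity (Ex w' (fun o => h ((F ** G) o))).
  rewrite (Ex_comp w0 w1 (F ** G) h0) (Ex_comp w0' w1' (F ** G) h0).
  by apply: eq_esum => k _; rewrite -P'.
apply: eq_Ex => // o wo; rewrite /h ifF; first by rewrite P' G'.
by apply/negbTE; rewrite gt_eqF// P'; apply: (Pr_gt0 w0' w1') wo.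
Qed.

(** H(F) = I(F;G) + H(F|G). The conditional entropy, whose density is nonnegative on the support,
    has a value in [0,+oo] that depends only on the law of (F,G). It is the term carried from [w']
    to [w]. *)
Lemma entropy_ge_mi_cond (w w' : I -> R) (F : I -> T1) (G : I -> T2) (c1 c2 : R) :
  (forall o, 0 <= w o) -> \esum_(o in [set: I]) (w o)%:E = 1%E ->
  (forall o, 0 <= w' o) -> \esum_(o in [set: I]) (w' o)%:E = 1%E ->
  (forall E : set (T1 * T2),
    Pr w [set o | E ((F ** G) o)] = Pr w' [set o | E ((F ** G) o)]) ->
  (forall e, 0 < e -> nn w (fun o => mi w F G o - c1 + e)) ->
  nn w' (fun o => (lp w' G o - lp w' (F ** G) o) - c2) ->
  ((c1 + c2)%:E <= Ex w (fun o => - lp w F o)%R)%E.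
Proof.
move=> w0 w1 w0' w1' law h1 h2; apply/lee_addgt0Pr => e e0.
have pos (v : I -> R) : (forall o, 0 <= v o) -> \esum_(o in [set: I]) (v o)%:E = 1%E ->
    forall o, 0 < v o -> 0 <= lp v G o - lp v (F ** G) o.
  by move=> v0 v1 o vo; rewrite subr_ge0; apply: (lp_le v0 v1) => // o' _ [].
have b1 : (Ex w (fun o => lp w G o - lp w (F ** G) o)%R + (c1 - e)%:E <=
    Ex w (fun o => - lp w F o)%R)%E.
  apply: nn_Ex_cst => //; last 2 first.
  - exact: pos.
  - by move=> o _; rewrite oppr_ge0 (lp_le0 w0 w1).
  by apply: nn_le (h1 e e0) _ => o _; rewrite /mi; lra.
have b2 : (c2%:E <= Ex w' (fun o => lp w' G o - lp w' (F ** G) o)%R)%E.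
  have := @nn_Ex_cst _ _ w' w0' w1' (fun=> 0) (fun o => lp w' G o - lp w' (F ** G) o) c2.
  rewrite (Ex_cst w0' w1' (lexx 0)) add0e; apply=> //; last exact: pos.
  by apply: nn_le h2 _ => o _; rewrite add0r.
rewrite -(Ex_cond_entropy_law w0 w1 w0' w1' law) in b2.
rewrite -leeBlDr// -EFinB; apply: le_trans b1.
by rewrite (_ : c1 + c2 - e = c2 + (c1 - e)) ?EFinD ?leeD2r//; ring.
Qed.

End Combine.

Lemma sup_fs_ge (R : realType) (T : finType) (F : (T -> R) -> R) (u : R) :
  (exists p : T -> R, fullsupp p) -> (forall p, fullsupp p -> F p <= u) ->
  sup_fs F <= u.
Proof.
move=> [p fp] h; apply: ge_sup; first by exists (F p), p.
by move=> _ [p' [fp' ->]]; exact: h.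
Qed.

Lemma sup_fs2_ge (R : realType) (T T' : finType) (F : (T -> R) -> R)
    (F' : (T' -> R) -> R) (u : R) :
  (exists p : T -> R, fullsupp p) -> (exists p : T' -> R, fullsupp p) ->
  (forall p p', fullsupp p -> fullsupp p' -> F p + F' p' <= u) ->
  sup_fs F + sup_fs F' <= u.
Proof.
move=> e e' h; rewrite -lerBrDr; apply: sup_fs_ge => // p fp.
rewrite lerBrDr -lerBrDl; apply: sup_fs_ge => // p' fp'.
by rewrite lerBrDl h.
Qed.

(** * The bounds for the three links *)

Section Bounds.
Context {R : realType} {X Y Z : finType} (pXY : X -> Y -> R) (pZ : X -> Y -> Z -> R).
Context (P : protocol R X Y Z).
Hypothesis fs : full_support_joint pXY.
Hypothesis cd : cond_dist pZ.
Hypothesis nf : normal_form pZ.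
Hypothesis sec : secure P pXY pZ.

Let V : valid_protocol P. Proof. by case: sec. Qed.
Let p0 x y : 0 <= pXY x y. Proof. by case: fs => h _; exact: ltW. Qed.
Let p1 : \sum_x \sum_y pXY x y = 1. Proof. by case: fs. Qed.

(** Replaces the original inputs by others giving the link the same law, and nats by bits. *)
Lemma Hout_ge (M : outcome X Y Z -> lmsg) (w : X * Y * Z * seq round -> R)
    (F : X * Y * Z * seq round -> lmsg) (c : R) :
  (forall o, 0 <= w o) ->
  \esum_(o in [set: X * Y * Z * seq round]) (w o)%:E = 1%E ->
  (forall m, Pr (wt P pXY) [set o | M (outc o) = m] = Pr w [set o | F o = m]) ->
  ((ln 2 * c)%:E <= Ex w (fun o => - lp w F o)%R)%E ->
  (c%:E <= Hout P pXY M)%E.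
Proof.
move=> w0 w1 law; have l2 := @ln2_gt0 R.
have pr0 m := Pr_ge0 w0 [set o | F o = m]; have pr1 m := Pr_le1 w0 w1 [set o | F o = m].
rewrite (Ex_comp w0 w1 F (g := fun m => - ln (Pr w [set o | F o = m]))); last first.
  by move=> m; rewrite oppr_ge0 ln_le0.
have -> : Hout P pXY M = \esum_(m in [set: lmsg])
    ((ln 2)^-1%:E * (Pr w [set o | F o = m] * - ln (Pr w [set o | F o = m]))%:E)%E.
  apply: eq_esum => m _; rewrite (probE V p0 p1) /ent_hterm /hterm /= law -EFinM; congr EFin.
  by case: eqP => [->|_]; [rewrite mul0r mulr0|field; rewrite gt_eqF].
rewrite esumZ; last 2 first.
- by rewrite invr_ge0 ltW.
- by move=> m; rewrite lee_fin mulr_ge0// oppr_ge0 ln_le0.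
move=> h; rewrite (_ : c%:E = ((ln 2)^-1%:E * (ln 2 * c)%:E)%E).
  by apply: lee_wpmul2l => //; rewrite lee_fin invr_ge0 ltW.
by rewrite -EFinM mulKf// gt_eqF.
Qed.

Lemma fullsupp_marginalX : fullsupp (marginalX pXY).
Proof.
case: fs => h s; split=> // x.
have [y _|Y0] := pickP Y; first by rewrite /marginalX (bigD1 y)//= ltr_pwDl// sumr_ge0.
exfalso; move: s; rewrite big1 => [/eqP|x' _]; first by rewrite eq_sym oner_eq0.
by rewrite big_pred0.
Qed.

Lemma fullsupp_marginalY : fullsupp (marginalY pXY).
Proof.
case: fs => h s; split; last by rewrite exchange_big.
move=> y; have [x _|X0] := pickP X; first by rewrite /marginalY (bigD1 x)//= ltr_pwDl// sumr_ge0.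
by exfalso; move: s; rewrite big_pred0 => [/eqP|//]; rewrite eq_sym oner_eq0.
Qed.

Lemma fullsupp_ge0 (T : finType) (p : T -> R) t : fullsupp p -> 0 <= p t.
Proof. by case=> h _; exact: ltW. Qed.

Lemma marginalX_jprod (a : X -> R) (b : Y -> R) : fullsupp b ->
  marginalX (jprod a b) =1 a.
Proof. by move=> [_ s] x; rewrite /marginalX /jprod -mulr_sumr s mulr1. Qed.

Lemma marginalY_jprod (a : X -> R) (b : Y -> R) : fullsupp a ->
  marginalY (jprod a b) =1 b.
Proof. by move=> [_ s] x; rewrite /marginalY /jprod -mulr_suml s mul1r. Qed.

Local Notation q a b := (prodpmf a b pZ).
Local Notation vX := (@vX X Y Z).
Local Notation vY := (@vY X Y Z).
Local Notation vZ := (@vZ X Y Z).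

Let jp0 (a : X -> R) (b : Y -> R) : fullsupp a -> fullsupp b ->
  forall x y, 0 <= jprod a b x y.
Proof. by move=> fa fb x y; rewrite mulr_ge0// fullsupp_ge0. Qed.

Let jp1 (a : X -> R) (b : Y -> R) : fullsupp a -> fullsupp b ->
  \sum_x \sum_y jprod a b x y = 1.
Proof. by move=> [_ sa] [_ sb]; exact: sum_jprod. Qed.

Let law_x (a : X -> R) (b b' : Y -> R) E : fullsupp a -> fullsupp b -> fullsupp b' ->
  Pr (wt P (jprod a b)) [set o | E (oL12 o, oL31 o)] =
  Pr (wt P (jprod a b')) [set o | E (oL12 o, oL31 o)].
Proof.
move=> fa fb fb'; apply: (Pr_link_x fs cd sec); [exact: jp0|exact: jp0|exact: jp1|exact: jp1|].
by move=> x; rewrite !marginalX_jprod.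
Qed.

Let law_y (a a' : X -> R) (b : Y -> R) E : fullsupp a -> fullsupp a' -> fullsupp b ->
  Pr (wt P (jprod a b)) [set o | E (oL12 o, oL23 o)] =
  Pr (wt P (jprod a' b)) [set o | E (oL12 o, oL23 o)].
Proof.
move=> fa fa' fb; apply: (Pr_link_y fs cd sec); [exact: jp0|exact: jp0|exact: jp1|exact: jp1|].
by move=> x; rewrite !marginalY_jprod.
Qed.

Lemma bound_M23 (a a' : X -> R) : fullsupp a -> fullsupp a' ->
  ((RIf (q a (marginalY pXY)) vX vZ +
    Hc (q a' (marginalY pXY)) (fun t => (vY t, vZ t)) vX)%:E <= Hout P pXY (@oM23 X Y Z))%E.
Proof.
move=> fa fa'; have fb := fullsupp_marginalY.
apply: (Hout_ge (wp0 sec fa fb) (wp1 sec fa fb) (F := @oL23 X Y Z)).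
  move=> m; apply: (Pr_link_y fs cd sec (fun p => p.2 = m)) => //; [exact: jp0|exact: jp1|].
  by move=> y; rewrite marginalY_jprod.
rewrite mulrDr.
apply: (entropy_ge_mi_cond (wp0 sec fa fb) (wp1 sec fa fb) (wp0 sec fa' fb)
  (wp1 sec fa' fb) (G := @oL12 X Y Z)).
- by move=> E; exact: (law_y (fun p => E (p.2, p.1))).
- move=> e e0; apply: nn_le (mi_residual_xz fs cd nf sec fa fb e0) _ => o _.
  by rewrite (mi_sym (wp0 sec fa fb)).
- exact: (entropy_23_12 fs cd nf sec fa' fb).
Qed.

Lemma bound_M31 (b b' : Y -> R) : fullsupp b -> fullsupp b' ->
  ((RIf (q (marginalX pXY) b) vY vZ +
    Hc (q (marginalX pXY) b') (fun t => (vX t, vZ t)) vY)%:E <= Hout P pXY (@oM31 X Y Z))%E.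
Proof.
move=> fb fb'; have fa := fullsupp_marginalX.
apply: (Hout_ge (wp0 sec fa fb) (wp1 sec fa fb) (F := @oL31 X Y Z)).
  move=> m; apply: (Pr_link_x fs cd sec (fun p => p.2 = m)) => //; [exact: jp0|exact: jp1|].
  by move=> x; rewrite marginalX_jprod.
rewrite mulrDr.
apply: (entropy_ge_mi_cond (wp0 sec fa fb) (wp1 sec fa fb) (wp0 sec fa fb')
  (wp1 sec fa fb') (G := @oL12 X Y Z)).
- by move=> E; exact: (law_x (fun p => E (p.2, p.1))).
- move=> e e0; apply: nn_le (mi_residual_yz fs cd nf sec fa fb e0) _ => o _.
  by rewrite (mi_sym (wp0 sec fa fb)).
- exact: (entropy_31_12 fs cd nf sec fa fb').
Qed.

(** Row 1 conditions on M31, whose joint law with M12 depends on [a] only, so [b] and [b'] may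
    differ. Row 2 conditions on M23 and frees the law of X instead. *)
Lemma bound_M12_row1 (a : X -> R) (b b' : Y -> R) :
  fullsupp a -> fullsupp b -> fullsupp b' ->
  ((RIf (q a b) vY vZ + (RIf (q a b') vX vZ + Hc (q a b') (fun t => (vX t, vY t)) vZ))%:E
    <= Hout P pXY (@oM12 X Y Z))%E.
Proof.
move=> fa fb fb'.
apply: (Hout_ge (wp0 sec fa fb) (wp1 sec fa fb) (F := @oL12 X Y Z)).
  by move=> m; apply: (Pr_link12 fs cd sec [set m]) => //; [exact: jp0|exact: jp1].
rewrite mulrDr.
apply: (entropy_ge_mi_cond (wp0 sec fa fb) (wp1 sec fa fb) (wp0 sec fa fb')
  (wp1 sec fa fb') (G := @oL31 X Y Z)).
- by move=> E; exact: law_x.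
- by move=> e e0; exact: (mi_residual_yz fs cd nf sec fa fb e0).
- exact: (entropy_12_31 fs cd nf sec fa fb').
Qed.

Lemma bound_M12_row2 (a a' : X -> R) (b : Y -> R) :
  fullsupp a -> fullsupp a' -> fullsupp b ->
  ((RIf (q a b) vX vZ + (RIf (q a' b) vY vZ + Hc (q a' b) (fun t => (vX t, vY t)) vZ))%:E
    <= Hout P pXY (@oM12 X Y Z))%E.
Proof.
move=> fa fa' fb.
apply: (Hout_ge (wp0 sec fa fb) (wp1 sec fa fb) (F := @oL12 X Y Z)).
  by move=> m; apply: (Pr_link12 fs cd sec [set m]) => //; [exact: jp0|exact: jp1].
rewrite mulrDr.
apply: (entropy_ge_mi_cond (wp0 sec fa fb) (wp1 sec fa fb) (wp0 sec fa' fb)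
  (wp1 sec fa' fb) (G := @oL23 X Y Z)).
- by move=> E; exact: law_y.
- by move=> e e0; exact: (mi_residual_xz fs cd nf sec fa fb e0).
- exact: (entropy_12_23 fs cd nf sec fa' fb).
Qed.

End Bounds.


Theorem theorem4 (R : realType) (X Y Z : finType)
  (pXY : X -> Y -> R) (pZ : X -> Y -> Z -> R) (P : protocol R X Y Z) :
  full_support_joint pXY -> cond_dist pZ -> normal_form pZ ->
  secure P pXY pZ ->
  let pX := marginalX pXY in
  let pY := marginalY pXY in
  let q := fun (a : X -> R) (b : Y -> R) => prodpmf a b pZ in
  let vX := @vX X Y Z in
  let vY := @vY X Y Z in
  let vZ := @vZ X Y Z in
  [/\
   (* H(M23) >= sup_{pX'} RI(X';Z') + sup_{pX''} H(Y,Z''|X'') *)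
   (Hout P pXY (@oM23 X Y Z) >=
     (sup_fs (fun pX' : X -> R => RIf (q pX' pY) vX vZ) +
      sup_fs (fun pX'' : X -> R => Hc (q pX'' pY) (fun t => (vY t, vZ t)) vX))%:E)%E,
   (* H(M31) >= sup_{pY'} RI(Y';Z') + sup_{pY''} H(X,Z''|Y'') *)
   (Hout P pXY (@oM31 X Y Z) >=
     (sup_fs (fun pY' : Y -> R => RIf (q pX pY') vY vZ) +
      sup_fs (fun pY'' : Y -> R => Hc (q pX pY'') (fun t => (vX t, vZ t)) vY))%:E)%E &
   (* H(M12) >= max { row 1 , row 2 } *)
   (Hout P pXY (@oM12 X Y Z) >=
     (Num.max
       (sup_fs (fun pX' : X -> R =>
          sup_fs (fun pY' : Y -> R => RIf (q pX' pY') vY vZ) +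
          sup_fs (fun pY'' : Y -> R =>
            RIf (q pX' pY'') vX vZ + Hc (q pX' pY'') (fun t => (vX t, vY t)) vZ)))
       (sup_fs (fun pY' : Y -> R =>
          sup_fs (fun pX' : X -> R => RIf (q pX' pY') vX vZ) +
          sup_fs (fun pX'' : X -> R =>
            RIf (q pX'' pY') vY vZ + Hc (q pX'' pY') (fun t => (vX t, vY t)) vZ))))%:E)%E].
Proof.
move=> fs cd nf sec pX pY q vX vY vZ.
have fX : fullsupp pX by exact: fullsupp_marginalX.
have fY : fullsupp pY by exact: fullsupp_marginalY.
have eX : exists p : X -> R, fullsupp p by exists pX.
have eY : exists p : Y -> R, fullsupp p by exists pY.
(* An infinite entropy satisfies every bound, and one instance of the bound excludes -oo. The
   suprema are then compared with a real number [u]. *)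
have lift (H : \bar R) (s r0 : R) : (r0%:E <= H)%E ->
    (forall u : R, (H <= u%:E)%E -> s <= u) -> (s%:E <= H)%E.
  by case: H => [u| |]// _ h; rewrite ?leey// lee_fin; exact: h.
split.
- apply: (lift _ _ _ (bound_M23 fs cd nf sec fX fX)) => u hu.
  apply: sup_fs2_ge => // a a' fa fa'; rewrite -lee_fin; apply: le_trans hu.
  exact: bound_M23.
- apply: (lift _ _ _ (bound_M31 fs cd nf sec fY fY)) => u hu.
  apply: sup_fs2_ge => // b b' fb fb'; rewrite -lee_fin; apply: le_trans hu.
  exact: bound_M31.
- apply: (lift _ _ _ (bound_M12_row1 fs cd nf sec fX fY fY)) => u hu.
  rewrite ge_max; apply/andP; split; apply: sup_fs_ge => // p fp;
    apply: sup_fs2_ge => // p1 p2 fp1 fp2; rewrite -lee_fin; apply: le_trans hu.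
    exact: bound_M12_row1.
  exact: bound_M12_row2.
Qed.
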